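(* Let $(M,[g])$ be almost Einstein with corresponding $\alpha\in\mathcal E[1]$, and let $\sigma_{\mathbf a^k}\in\mathcal E^k[k+1]$. For $k\in\{1,\dots,n\}$, $$\overline{\overline\sigma}_{\mathbf a^{k-1}}:=\alpha\nabla^p\sigma_{\mathbf a^{k-1}p}-(n-k+1)(\nabla^p\alpha)\sigma_{\mathbf a^{k-1}p}\in\mathcal E^{k-1}[k]$$ is conformally invariant. For $k\in\{0,\dots,n-1\}$, $$\underline{\underline\sigma}_{\mathbf a^{k+1}}:=\alpha\nabla_{a^{k+1}}\sigma_{\mathbf a^k}-(k+1)(\nabla_{a^{k+1}}\alpha)\sigma_{\mathbf a^k}\in\mathcal E^{k+1}[k+2]$$ is conformally invariant. If $\sigma$ is a solution of the conformal Killing equation then: $$\nabla_{\{c}\overline{\overline\sigma}_{\mathbf a^{k-1}\}_0}=0\iff C_{ca^1}{}^{pq}\sigma_{\dot{\mathbf a}^{k-1}pq}\stackrel{\{c\mathbf a^{k-1}\}_0}{=}0\qquad(2\le k\le n-1),$$ $$\nabla_{\{c}\underline{\underline\sigma}_{\mathbf a^{k+1}\}_0}=0\iff C_{ca^{k+1}a^1}{}^{p}\sigma_{\dot{\mathbf a}^kp}\stackrel{\{c\mathbf a^{k+1}\}_0}{=}0\qquad(1\le k\le n-2).$$ If the first curvature condition is satisfied, then the corresponding conformal Killing form $\overline{\overline\sigma}_{\mathbf a^{k-1}}$ is a Killing form away from the zero set of $\alpha$, in the Einstein scale $g=\alpha^{-2}\mathbf g$. If the second curvature condition is satisfied, then the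 corresponding conformal Killing form $\underline{\underline\sigma}_{\mathbf a^{k+1}}$ is a dual-Killing form away from the zero set of $\alpha$, in the Einstein scale $g=\alpha^{-2}\mathbf g$.
   Context: Setting. $M$ is a smooth $n$-manifold, $n\ge3$, with a conformal structure $[g]$ (any signature); all objects are smooth. $\mathcal E[w]$: conformal densities of weight $w$ (a choice $g\in[g]$ trivialises $\mathcal E[w]$; under $\hat g=e^{2\Upsilon}g$ the representing function $f$ becomes $e^{w\Upsilon}f$); $[w]$ after a bundle means tensoring with it. $\mathbf g_{ab}$ is the conformal metric (tautological section of $S^2T^*M[2]$), used to raise, lower and contract abstract indices. $\nabla$ is the Levi-Civita connection of a chosen $g\in[g]$, acting also on densities via the trivialisation. ''Conformally invariant'' means independent of the choice of $g\in[g]$. $[\nabla_a,\nabla_b]v^c=R_{ab}{}^c{}_dv^d$, $R_{abcd}=C_{abcd}+2\mathbf g_{c[a}P_{b]d}+2\mathbf g_{d[b}P_{a]c}$ with $C$ the Weyl tensor and $P$ the Schouten tensor. Almost Einstein: there is given $\alpha\in\mathcal E[1]$ with $\nabla_{(a}\nabla_{b)_0}\alpha+P_{(ab)_0}\alpha=0$ ($(ab)_0$ = symmetric trace-free part), $\alpha$ being non-trivial, so that it is non-vanishing on an open dense subset of $M$; there $g=\alpha^{-2}\mathbf g$ is an Einstein metric. Form indices. $\mathcal E^k=\mathcal E_{\mathbf a^k}$ is the bundle of $k$-forms. Indices with sequential superscripts at the same level are implicitly skew-symmetrised: $\mathbf a^k=a^1\cdots a^k$, $\dot{\mathbf a}^k=a^2\cdots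 a^k$; e.g. the definition of $\underline{\underline\sigma}$ is skewed over $a^1,\dots,a^{k+1}$. Conformal Killing equation. $\{c\mathbf a^m\}_0$ denotes projection of $T^*M\otimes\Lambda^mT^*M[w]$ onto the trace-free part of $\{f_{c\mathbf a^m}: f_{[c\mathbf a^m]}=0\}$, and $T\stackrel{\{c\mathbf a^m\}_0}{=}S$ means that these projections of $T$ and $S$ agree. The equation for $\sigma\in\mathcal E^k[k+1]$, $1\le k\le n-1$, is $\nabla_{\{c}\sigma_{\mathbf a^k\}_0}=0$ (conformally invariant). In a choice of metric $g$ it is equivalent to $\nabla_u\sigma=\varepsilon(u)\tau+\iota(u)\rho$ for all tangent $u$, for some $(k-1)$-form $\tau$ and $(k+1)$-form $\rho$, where $\varepsilon(u)$ and $\iota(u)$ are exterior multiplication by $g(u,\cdot)$ and its formal adjoint, interior multiplication. Relative to $g$, $\sigma$ is a Killing form if this holds with $\tau=0$, and a dual-Killing form if it holds with $\rho=0$. *)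

(* Defs.v *)
From HB Require Import structures.
From mathcomp Require Import all_boot all_order all_algebra all_fingroup.
From mathcomp Require Import all_classical all_reals all_analysis.

Set Implicit Arguments.
Unset Strict Implicit.
Unset Printing Implicit Defensive.

Import Order.TTheory GRing.Theory Num.Theory.
Import numFieldNormedType.Exports.

Local Open Scope classical_set_scope.
Local Open Scope ring_scope.

(* Abstract indices are read as concrete coordinate indices in a chart: a
   k-index object at a point is a function of a k-tuple of indices. *)

Section Calculus.
Variables (R : realType) (n : nat).

Definition pd (a : 'I_n) (f : 'rV[R]_n -> R) (x : 'rV[R]_n) : R :=
  'D_(delta_mx 0 a) f x.

(* Differentiability is in the sense of Frechet; on an open U,
   "Ck_on m U f for all m" is C^infinity on U. *)
Fixpoint Ck_on (m : nat) (U : set 'rV[R]_n) (f : 'rV[R]_n -> R) : Prop :=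
  match m with
  | 0 => forall x, U x -> {for x, continuous f}
  | m'.+1 => (forall x, U x -> differentiable f x) /\
             (forall a, Ck_on m' U (pd a f))
  end.

Definition smooth_on (U : set 'rV[R]_n) (f : 'rV[R]_n -> R) : Prop :=
  forall m, Ck_on m U f.

End Calculus.

(* Hausdorff, second countable smooth n-manifold, given by a smooth atlas.
   [point i] is the inverse of [coord i], relevant on [cod i] only. *)
Record manifold (R : realType) (n : nat) (M : topologicalType) := Manifold {
  chart : Type;
  dom : chart -> set M;
  cod : chart -> set 'rV[R]_n;
  coord : chart -> M -> 'rV[R]_n;
  point : chart -> 'rV[R]_n -> M;
  manifold_hausdorff : hausdorff_space M;
  manifold_second_countable : @second_countable M;
  chart_cover : forall p, exists i, dom i p;
  dom_open : forall i, open (dom i);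
  cod_open : forall i, open (cod i);
  coordK : forall i p, dom i p -> cod i (coord i p) /\ point i (coord i p) = p;
  pointK : forall i x, cod i x -> dom i (point i x) /\ coord i (point i x) = x;
  coord_continuous : forall i p, dom i p -> {for p, continuous (coord i)};
  point_continuous : forall i x, cod i x -> {for x, continuous (point i)};
  transition_smooth : forall i j a,
    smooth_on [set y | cod j y /\ dom i (point j y)]
              (fun y => coord i (point j y) 0 a)
}.

Section LocalTensors.
Variables (R : realType) (n : nat).

Definition permute_index (k : nat) (s : 'S_k) (a : k.-tuple 'I_n) :
    k.-tuple 'I_n :=
  [tuple tnth a (s r) | r < k].

Definition skew (k : nat) (T : k.-tuple 'I_n -> R) (a : k.-tuple 'I_n) : R :=
  (k`!)%:R^-1 * \sum_(s : 'S_k) (-1) ^+ s * T (permute_index s a).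

Definition replace_index (k : nat) (a : k.-tuple 'I_n) (r : 'I_k) (d : 'I_n) :
    k.-tuple 'I_n :=
  [tuple if q == r then d else tnth a q | q < k].

Definition remove_index (k : nat) (a : k.+1.-tuple 'I_n) (r : 'I_k.+1) :
    k.-tuple 'I_n :=
  [tuple tnth a (lift r q) | q < k].

(* [skew_part T] and [trace_part g T] are the components of T_{c a^m} (skew in
   a^m) in the two O(g)-invariant complements of the trace-free part of
   {f : f_[c a^m] = 0}.  The trace part has the form g_{c[a^1} B_{a^2...a^m]},
   and the factor m / (n - m + 1) is forced by the trace of T being that of its
   trace part, since
     g^{c a^1} g_{c[a^1} B_{a^2...a^m]} = ((n - m + 1) / m) B_{a^2...a^m}. *)
Definition skew_part (m : nat) (T : 'I_n -> m.-tuple 'I_n -> R)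
    (c : 'I_n) (a : m.-tuple 'I_n) : R :=
  skew (fun b : m.+1.-tuple 'I_n => T (thead b) (behead_tuple b))
       (cons_tuple c a).

Definition trace_part (g : 'M[R]_n) (m : nat) :
    ('I_n -> m.-tuple 'I_n -> R) -> 'I_n -> m.-tuple 'I_n -> R :=
  match m with
  | 0 => fun _ _ _ => 0
  | m'.+1 => fun T c a =>
      m'.+1%:R / (n%:R - m'.+1%:R + 1) *
      skew (fun b : m'.+1.-tuple 'I_n =>
              g c (thead b) *
              \sum_p \sum_q invmx g p q * T p (cons_tuple q (behead_tuple b))) a
  end.

(* The projection {c a^m}_0. *)
Definition hook_part (g : 'M[R]_n) (m : nat) (T : 'I_n -> m.-tuple 'I_n -> R)
    (c : 'I_n) (a : m.-tuple 'I_n) : R :=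
  T c a - skew_part T c a - trace_part g T c a.

(* (epsilon(u) tau) = g(u, .) /\ tau *)
Definition ext_mul (g : 'M[R]_n) (u : 'rV[R]_n) (m : nat)
    (tau : m.-tuple 'I_n -> R) (a : m.+1.-tuple 'I_n) : R :=
  \sum_(r < m.+1) (-1) ^+ r * (u *m g) 0 (tnth a r) * tau (remove_index a r).

Definition int_mul (u : 'rV[R]_n) (m : nat) (rho : m.+1.-tuple 'I_n -> R)
    (a : m.-tuple 'I_n) : R :=
  \sum_(c < n) u 0 c * rho (cons_tuple c a).

End LocalTensors.

Section LocalGeometry.
Variables (R : realType) (n : nat) (g : 'rV[R]_n -> 'M[R]_n).

(* [christoffel c a b] is Gamma^c_{ab}. *)
Definition christoffel (c a b : 'I_n) (x : 'rV[R]_n) : R :=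
  2^-1 * \sum_d invmx (g x) c d *
    (pd a (fun y => g y b d) x + pd b (fun y => g y a d) x
     - pd d (fun y => g y a b) x).

(* [nabla T x c a] is nabla_c T_a. *)
Definition nabla (k : nat) (T : 'rV[R]_n -> k.-tuple 'I_n -> R)
    (x : 'rV[R]_n) (c : 'I_n) (a : k.-tuple 'I_n) : R :=
  pd c (fun y => T y a) x
  - \sum_(r < k) \sum_d christoffel d c (tnth a r) x *
                        T x (replace_index a r d).

Definition hessian (f : 'rV[R]_n -> R) (x : 'rV[R]_n) (a b : 'I_n) : R :=
  pd a (pd b f) x - \sum_c christoffel c a b x * pd c f x.

(* [curvature x a b c d] is R_{ab}^c_d. *)
Definition curvature (x : 'rV[R]_n) (a b c d : 'I_n) : R :=
  pd a (christoffel c b d) x - pd b (christoffel c a d) x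
  + \sum_e (christoffel c a e x * christoffel e b d x
            - christoffel c b e x * christoffel e a d x).

Definition riemann (x : 'rV[R]_n) (a b c d : 'I_n) : R :=
  \sum_e g x c e * curvature x a b e d.

Definition ricci (x : 'rV[R]_n) (b d : 'I_n) : R := \sum_a curvature x a b a d.

Definition scalar_curvature (x : 'rV[R]_n) : R :=
  \sum_b \sum_d invmx (g x) b d * ricci x b d.

Definition schouten (x : 'rV[R]_n) (a b : 'I_n) : R :=
  (n%:R - 2)^-1 *
  (ricci x a b - scalar_curvature x / (2 * (n%:R - 1)) * g x a b).

(* C_{abcd} = R_{abcd} - 2 g_{c[a} P_{b]d} - 2 g_{d[b} P_{a]c} *)
Definition weyl (x : 'rV[R]_n) (a b c d : 'I_n) : R :=
  riemann x a b c d
  - (g x c a * schouten x b d - g x c b * schouten x a d)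
  - (g x d b * schouten x a c - g x d a * schouten x b c).

Definition sym_tracefree (x : 'rV[R]_n) (S : 'I_n -> 'I_n -> R) (a b : 'I_n) :
    R :=
  (S a b + S b a) / 2 - n%:R^-1 * (\sum_c \sum_d invmx (g x) c d * S c d) * g x a b.

Definition sigma_up_local (f : 'rV[R]_n -> R) (k : nat) :
    ('rV[R]_n -> k.-tuple 'I_n -> R) -> 'rV[R]_n -> k.-1.-tuple 'I_n -> R :=
  match k with
  | 0 => fun _ _ _ => 0
  | m.+1 => fun T x a =>
      f x * (\sum_p \sum_q invmx (g x) p q * nabla T x q (rcons_tuple a p))
      - (n%:R - m.+1%:R + 1) *
        \sum_p \sum_q invmx (g x) p q * pd q f x * T x (rcons_tuple a p)
  end.

Definition sigma_down_local (f : 'rV[R]_n -> R) (k : nat)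
    (T : 'rV[R]_n -> k.-tuple 'I_n -> R) (x : 'rV[R]_n) :
    k.+1.-tuple 'I_n -> R :=
  skew (fun a : k.+1.-tuple 'I_n =>
    let last_a := tnth a ord_max in
    let init_a := belast_tuple (thead a) (behead_tuple a) in
    f x * nabla T x last_a init_a - k.+1%:R * pd last_a f x * T x init_a).

(* C_{c a^1}^{pq} sigma_{a^2...a^{k-1} p q}, skewed over a^1, ..., a^{k-1};
   meaningful for k >= 2. *)
Definition weyl_up_local (k : nat) :
    ('rV[R]_n -> k.-tuple 'I_n -> R) ->
    'rV[R]_n -> 'I_n -> k.-1.-tuple 'I_n -> R :=
  match k with
  | m.+2 => fun T x c => skew (fun a : m.+1.-tuple 'I_n =>
      \sum_p \sum_q
        (\sum_r \sum_s weyl x c (thead a) r s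
                       * invmx (g x) r p * invmx (g x) s q)
        * T x (rcons_tuple (rcons_tuple (behead_tuple a) p) q))
  | _ => fun _ _ _ _ => 0
  end.

(* C_{c a^{k+1} a^1}^p sigma_{a^2...a^k p}, skewed over a^1, ..., a^{k+1};
   meaningful for k >= 1. *)
Definition weyl_down_local (k : nat) :
    ('rV[R]_n -> k.-tuple 'I_n -> R) ->
    'rV[R]_n -> 'I_n -> k.+1.-tuple 'I_n -> R :=
  match k with
  | 0 => fun _ _ _ _ => 0
  | m.+1 => fun T x c => skew (fun a : m.+2.-tuple 'I_n =>
      let dot_a := behead_tuple (belast_tuple (thead a) (behead_tuple a)) in
      \sum_p (\sum_r weyl x c (tnth a ord_max) (thead a) r * invmx (g x) r p)
             * T x (rcons_tuple dot_a p))
  end.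

End LocalGeometry.

Section Fields.
Variables (R : realType) (n : nat) (M : topologicalType) (X : manifold R n M).

(* Tensor fields are families of components, one for each chart i, as functions
   of the coordinates x in [cod i]; values elsewhere are irrelevant. *)
Definition form_field (k : nat) : Type :=
  chart X -> 'rV[R]_n -> k.-tuple 'I_n -> R.
Definition metric_field : Type := chart X -> 'rV[R]_n -> 'M[R]_n.

(* The part of chart i lying over W. *)
Definition chart_on (W : set M) (i : chart X) : set 'rV[R]_n :=
  [set x | cod i x /\ W (point i x)].

Definition chart_overlap (i j : chart X) : set 'rV[R]_n :=
  [set y | cod j y /\ dom i (point j y)].

(* With the row-vector convention of 'J, entry (b, a) is dx^a / dy^b for the
   coordinates y of chart j and x of chart i. *)
Definition transition_jac (i j : chart X) (y : 'rV[R]_n) : 'M[R]_n :=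
  'J (coord i \o point j) y.

Definition smooth_fun (W : set M) (f : M -> R) : Prop :=
  forall i, smooth_on (chart_on W i) (f \o point i).

Definition is_form (W : set M) (k : nat) (T : form_field k) : Prop :=
  [/\ forall i a, smooth_on (chart_on W i) (fun x => T i x a),
      forall i x, chart_on W i x -> forall (s : 'S_k) a,
        T i x (permute_index s a) = (-1) ^+ s * T i x a
    & forall i j y, chart_on W j y -> chart_overlap i j y -> forall b,
        T j y b = \sum_(a : k.-tuple 'I_n)
          (\prod_(r < k) transition_jac i j y (tnth b r) (tnth a r))
          * T i (coord i (point j y)) a].

(* Pseudo-Riemannian metrics of any signature. *)
Definition is_metric (h : metric_field) : Prop :=
  [/\ forall i a b, smooth_on (cod i) (fun x => h i x a b),
      forall i x, cod i x -> (h i x)^T = h i x,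
      forall i x, cod i x -> h i x \in unitmx
    & forall i j y, chart_overlap i j y ->
        h j y = transition_jac i j y *m h i (coord i (point j y))
                *m (transition_jac i j y)^T].

(* h = e^{2 Upsilon} g *)
Definition rescaling (Upsilon : M -> R) (g h : metric_field) : Prop :=
  forall i x, cod i x -> h i x = expR (2 * Upsilon (point i x)) *: g i x.

Definition conformal_structure (c : set metric_field) : Prop :=
  [/\ c !=set0, c `<=` is_metric
    & forall g h, c g ->
        (c h <-> is_metric h /\
           exists2 Upsilon, smooth_fun setT Upsilon & rescaling Upsilon g h)].

(* A section of a weighted bundle assigns to each g in [g] its representative in
   the trivialisation given by g. *)
Definition density : Type := metric_field -> M -> R.
Definition weighted_field (k : nat) : Type := metric_field -> form_field k.

Variable c : set metric_field.

Definition is_density (w : R) (f : density) : Prop :=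
  (forall g, c g -> smooth_fun setT (f g)) /\
  (forall g h Upsilon, c g -> c h -> smooth_fun setT Upsilon ->
     rescaling Upsilon g h -> forall p, f h p = expR (w * Upsilon p) * f g p).

Definition is_weighted_form (k : nat) (w : R) (sigma : weighted_field k) :
    Prop :=
  (forall g, c g -> is_form setT (sigma g)) /\
  (forall g h Upsilon, c g -> c h -> smooth_fun setT Upsilon ->
     rescaling Upsilon g h -> forall i x, cod i x -> forall a,
     sigma h i x a = expR (w * Upsilon (point i x)) * sigma g i x a).

(* Density of the non-vanishing locus is what "alpha is non-trivial" means
   here: a solution of the equation vanishing on an open set vanishes on every
   component that meets it, and M need not be connected. *)
Definition almost_einstein (alpha : density) : Prop :=
  [/\ is_density 1 alpha,
      forall g, c g -> forall i x, cod i x -> forall a b,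
        sym_tracefree (g i) x
          (fun a' b' => hessian (g i) (alpha g \o point i) x a' b'
                        + schouten (g i) x a' b' * alpha g (point i x)) a b = 0
    & forall g, c g -> dense [set p | alpha g p != 0]].

Definition sigma_up (alpha : density) (k : nat) (sigma : weighted_field k) :
    weighted_field k.-1 :=
  fun g i => sigma_up_local (g i) (alpha g \o point i) (sigma g i).

Definition sigma_down (alpha : density) (k : nat) (sigma : weighted_field k) :
    weighted_field k.+1 :=
  fun g i => sigma_down_local (g i) (alpha g \o point i) (sigma g i).

Definition conformal_killing (k : nat) (sigma : weighted_field k) : Prop :=
  forall g, c g -> forall i x, cod i x -> forall e a,
    hook_part (g i x) (nabla (g i) (sigma g i) x) e a = 0.

Definition weyl_condition_up (k : nat) (sigma : weighted_field k) : Prop :=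
  forall g, c g -> forall i x, cod i x -> forall e a,
    hook_part (g i x) (weyl_up_local (g i) (sigma g i) x) e a = 0.

Definition weyl_condition_down (k : nat) (sigma : weighted_field k) : Prop :=
  forall g, c g -> forall i x, cod i x -> forall e a,
    hook_part (g i x) (weyl_down_local (g i) (sigma g i) x) e a = 0.

Definition killing_form (W : set M) (h : metric_field) (k : nat)
    (T : form_field k) : Prop :=
  exists2 rho : form_field k.+1, is_form W rho &
    forall i x, chart_on W i x -> forall (u : 'rV[R]_n) a,
      \sum_e u 0 e * nabla (h i) (T i) x e a = int_mul u (rho i x) a.

Definition dual_killing_form (W : set M) (h : metric_field) (k : nat)
    (T : form_field k.+1) : Prop :=
  exists2 tau : form_field k, is_form W tau &
    forall i x, chart_on W i x -> forall (u : 'rV[R]_n) a,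
      \sum_e u 0 e * nabla (h i) (T i) x e a = ext_mul (h i x) u (tau i x) a.

(* The metric alpha^{-2} bold-g, and the representative of sigma of weight w in
   the trivialisation it gives over {alpha <> 0}: it is e^{2 Upsilon} g for
   Upsilon = - ln |alpha g|.  Neither depends on g in [g]. *)
Definition nonzero_locus (alpha : density) (g : metric_field) : set M :=
  [set p | alpha g p != 0].

Definition einstein_metric (alpha : density) (g : metric_field) :
    metric_field :=
  fun i x => (alpha g (point i x)) ^- 2 *: g i x.

Definition einstein_rep (alpha : density) (g : metric_field) (k : nat) (w : R)
    (sigma : weighted_field k) : form_field k :=
  fun i x a => expR (w * - ln `|alpha g (point i x)|) * sigma g i x a.

End Fields.

(* Main.v *)
From Pilot Require Import Defs.
From HB Require Import structures.
From mathcomp Require Import all_boot all_order all_algebra all_fingroup.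
From mathcomp Require Import all_classical all_reals all_analysis.
From mathcomp Require Import ring lra zify.
(* Below, [skew] is the skew-symmetrisation of components. *)
Import Pilot.Defs.

Set Implicit Arguments.
Unset Strict Implicit.
Unset Printing Implicit Defensive.

Import Order.TTheory GRing.Theory Num.Theory.
Import numFieldNormedType.Exports.

Local Open Scope classical_set_scope.
Local Open Scope ring_scope.

(** Write [iota_a], [eps^a] for contraction with the a-th coordinate vector and
    exterior multiplication by dx^a, and g_a = g(e_a, .).

    A conformal Killing k-form S satisfies
      nabla_a S = iota_a rho + g_a /\ tau
    with rho and tau multiples of dS and of the divergence of S.  Differentiating
    once more and commuting the two derivatives expresses the curvature operator
    applied to S by nabla rho and nabla tau.  Its interior and exterior traces
    then give, modulo terms iota_a X + g_a /\ Y (prolong_up, prolong_down),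
      nabla_a tau + P_a^f iota_f S  =  const * Weyl contracted twice with S,
      nabla_a rho + P_a /\ S       =  const * Weyl contracted once with S.
    The two forms of the theorem are constant multiples of
      Tup = alpha tau - iota_(grad alpha) S   and   Tdn = alpha rho - d alpha /\ S
    (twist_divE, twist_extE).  The almost Einstein equation says that
    nabla_a nabla_b alpha is - alpha P_ab modulo g_ab, which is exactly what
    makes nabla_a Tup and nabla_a Tdn equal to alpha times the left hand sides
    above, again modulo iota_a X + g_a /\ Y.  Those last terms are what the
    projection {c a^m}_0 kills, so the projected derivative of Tup or Tdn is a
    nonzero constant times alpha times the projected Weyl term (hook_twist_div,
    hook_twist_ext).  Hence the Weyl condition suffices; it is necessary because
    alpha can be cancelled on a dense set and the Weyl term is continuous
    (cancel_alpha).

    If Tup is conformal Killing, then nabla_a Tup = iota_a X + g_a /\ Y with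
    Y = iota_(grad alpha) tau: the only other possible contribution is the
    divergence of tau, which vanishes because the double interior trace of the
    curvature operator is zero (div_tau).  Passing from g to alpha^-2 g changes
    Y by iota_U Tup with U = - grad alpha / alpha, and iota_(grad alpha) Tup is
    alpha Y, so nothing is left (killing_Tup, killing_conformal).  The argument
    for Tdn is dual, with d rho = 0 in place of div tau = 0.

    Conformal invariance is the transformation law of nabla under rescaling,
    where the chosen weights make every derivative of the conformal factor
    cancel (twist_div_conformal, twist_ext_conformal).  That the constructions
    give tensor fields is the naturality of nabla under changes of charts
    (covD_change).

    Technically, a k-form at a point is a function on lists of indices that is
    skew under adjacent swaps and vanishes off lists of length k.  On lists,
    contraction is just consing an index, the degree is not part of the type, and
    the identities between the operators hold for all degrees at once. *)

(** * Algebra of forms on index lists *)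

Section Operators.
Variables (R : numFieldType) (n : nat).
Local Notation form := (seq 'I_n -> R^o).

Definition iot_def (a : 'I_n) (T : form) : form := fun s => T (a :: s).

(** dx^b /\ T in terms of T: move along the list, either spending the
    current index on dx^b or contracting T with it, at the price of a sign. *)
Fixpoint eps_rec (b : 'I_n) (s : seq 'I_n) (T : form) : R :=
  if s is a :: s' then (a == b)%:R * T s' - eps_rec b s' (iot_def a T) else 0.
Definition eps_def b T : form := fun s => eps_rec b s T.
End Operators.

HB.lock Definition iot := iot_def.
HB.lock Definition eps := eps_def.
Arguments iot {R n} a T : rename.
Arguments eps {R n} b T : rename.

Section Clifford.
Variables (R : numFieldType) (n : nat).
Local Notation I := 'I_n.
Local Notation form := (seq 'I_n -> R^o).
Implicit Types (T S : form) (s : seq I) (a b c d : I).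

Lemma addFE T S s : (T + S) s = T s + S s. Proof. by []. Qed.
Lemma oppFE T s : (- T) s = - T s. Proof. by []. Qed.
Lemma scaleFE (x : R) T s : (x *: T) s = x * T s. Proof. by []. Qed.
Lemma zeroFE s : (0 : form) s = 0. Proof. by []. Qed.
Lemma scaleoE (x : R) (y : R^o) : x *: y = x * y. Proof. by []. Qed.

(** With [FE], an identity between combinations of forms with scalar
    coefficients becomes, at each list, one that [ring] decides. *)
Definition FE := (addFE, oppFE, scaleFE, zeroFE, scaleoE).
Lemma sumFE (J : Type) (r : seq J) (P : pred J) (F : J -> form) s :
  (\sum_(j <- r | P j) F j) s = \sum_(j <- r | P j) F j s.
Proof. by elim/big_rec2: _ => // j x y _ <-. Qed.

Lemma iotE a T s : iot a T s = T (a :: s). Proof. by rewrite iot.unlock. Qed.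
Lemma eps_nil b T : eps b T [::] = 0. Proof. by rewrite eps.unlock. Qed.

Lemma iot_linear a : linear (iot a : form -> form).
Proof. by move=> x T S; apply: funext => s; rewrite !FE !iotE !FE. Qed.
HB.instance Definition _ a := GRing.isLinear.Build R form form *:%R (iot a) (iot_linear a).

(** Contraction and exterior multiplication satisfy the Clifford relation by
    the very recursion that defines [eps]; the other operator identities
    follow from it by induction on lists. *)
Lemma iot_eps a b T : iot a (eps b T) = (a == b)%:R *: T - eps b (iot a T).
Proof. by apply: funext => s; rewrite iotE !FE eps.unlock iot.unlock. Qed.

Lemma eps_linear b : linear (eps b : form -> form).
Proof.
move=> x T S; apply: funext => s.
elim: s T S => [|a s IH] T S; rewrite !FE; first by rewrite !eps_nil mulr0 addr0.
rewrite -!iotE !iot_eps iot_linear !FE IH !FE /=; ring.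
Qed.
HB.instance Definition _ a := GRing.isLinear.Build R form form *:%R (eps a) (eps_linear a).

(** The induction principle behind most identities: a function on lists is
    determined by its contractions and its value at the empty list. *)
Lemma formP T S : (forall a, iot a T = iot a S) -> T [::] = S [::] -> T = S.
Proof.
by move=> H H0; apply: funext => -[|a s] //; rewrite -!iotE H.
Qed.

Lemma eps_eps a b T : eps a (eps b T) = - eps b (eps a T).
Proof.
apply: funext => s; elim: s T => [|c s IH] T; first by rewrite FE !eps_nil oppr0.
rewrite FE -!iotE !iot_eps !linearB /= !linearZ /= !FE IH FE.
ring.
Qed.

(** Adjacent swaps suffice, and they do not refer to the length of the list. *)
Definition alt T := forall s a b t, T (s ++ a :: b :: t) = - T (s ++ b :: a :: t).

Lemma alt_iot a T : alt T -> alt (iot a T).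
Proof. by move=> H s b c t; rewrite !iotE; apply: (H (a :: s)). Qed.

Lemma iot_iot a b T : alt T -> iot a (iot b T) = - iot b (iot a T).
Proof. by move=> H; apply: funext => t; rewrite FE !iotE; apply: (H [::]). Qed.

Lemma alt0 : alt 0. Proof. by move=> *; rewrite !FE oppr0. Qed.
Lemma altD T S : alt T -> alt S -> alt (T + S).
Proof. by move=> hT hS s a b t; rewrite !FE hT hS opprD. Qed.
Lemma altZ x T : alt T -> alt (x *: T).
Proof. by move=> hT s a b t; rewrite !FE hT mulrN. Qed.
Lemma altN T : alt T -> alt (- T).
Proof. by rewrite -scaleN1r; apply: altZ. Qed.
Lemma altB T S : alt T -> alt S -> alt (T - S).
Proof. by move=> hT hS; apply: altD => //; apply: altN. Qed.
Lemma alt_sum (J : Type) (r : seq J) (P : pred J) (F : J -> form) :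
  (forall j, P j -> alt (F j)) -> alt (\sum_(j <- r | P j) F j).
Proof. by move=> H; elim/big_rec: _ => [|j x Pj hx]; [exact: alt0|apply: altD => //; apply: H]. Qed.

Lemma alt_eps b T : alt T -> alt (eps b T).
Proof.
move=> hT s; elim: s T hT => [|c s IH] T hT a d t; rewrite !(cat0s, cat_cons) -!iotE.
  rewrite !iot_eps !linearB /= !linearZ /= !iot_eps (iot_iot d a hT) linearN opprK !FE /=.
  ring.
rewrite iot_eps !FE hT IH; last exact: alt_iot.
ring.
Qed.

(** Homogeneity of degree k. *)
Definition hom k T := forall s, size s != k -> T s = 0.
Definition kform k T := alt T /\ hom k T.

Lemma kform0 k : kform k 0.
Proof. by split=> //; exact: alt0. Qed.
Lemma kformD k T S : kform k T -> kform k S -> kform k (T + S).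
Proof.
move=> [aT hT] [aS hS]; split; first exact: altD.
by move=> s hs; rewrite FE hT // hS // addr0.
Qed.
Lemma kformZ k x T : kform k T -> kform k (x *: T).
Proof.
by move=> [aT hT]; split; [exact: altZ|move=> s hs; rewrite FE hT // mulr0].
Qed.
Lemma kformN k T : kform k T -> kform k (- T).
Proof. by rewrite -scaleN1r; apply: kformZ. Qed.
Lemma kformB k T S : kform k T -> kform k S -> kform k (T - S).
Proof. by move=> hT hS; apply: kformD => //; apply: kformN. Qed.
Lemma kform_sum k (J : Type) (r : seq J) (P : pred J) (F : J -> form) :
  (forall j, P j -> kform k (F j)) -> kform k (\sum_(j <- r | P j) F j).
Proof. by move=> H; elim/big_rec: _ => [|j x Pj hx]; [exact: kform0|apply: kformD => //; apply: H]. Qed.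

Lemma hom_iot k a T : hom k T -> hom k.-1 (iot a T).
Proof. by move=> hT s hs; rewrite iotE; apply: hT; case: k hs. Qed.
Lemma hom_eps k b T : hom k T -> hom k.+1 (eps b T).
Proof.
move=> hT s; elim: s k T hT => [|a s IH] k T hT hs; first exact: eps_nil.
rewrite -iotE iot_eps !FE hT // mulr0 sub0r.
case: k hs hT => [|k] hs hT; last by rewrite (IH k) ?oppr0 //; exact: (hom_iot _ hT).
have -> : iot a T = 0 by apply: funext => t; rewrite iotE; apply: hT.
by rewrite linear0 oppr0.
Qed.
Lemma kform_iot k a T : kform k T -> kform k.-1 (iot a T).
Proof. by move=> [aT hT]; split; [exact: alt_iot|exact: hom_iot]. Qed.
Lemma kform_eps k b T : kform k T -> kform k.+1 (eps b T).
Proof. by move=> [aT hT]; split; [exact: alt_eps|exact: hom_eps]. Qed.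

Lemma sum_delta (V : lmodType R) c (F : I -> V) :
  \sum_a (c == a)%:R *: F a = F c.
Proof.
rewrite (bigD1 c) //= eqxx scale1r big1 ?addr0 // => a /negbTE.
by rewrite eq_sym => ->; rewrite scale0r.
Qed.

Lemma sum_eps_iot_at T s : alt T ->
  (\sum_a eps a (iot a T)) s = (size s)%:R * T s.
Proof.
elim: s T => [|c s IH] T aT.
  by rewrite sumFE big1 ?mul0r // => a _; rewrite eps_nil.
rewrite -iotE linear_sum /=.
under eq_bigr => a _ do rewrite iot_eps (iot_iot c a aT) linearN opprK.
rewrite big_split /= sum_delta FE IH; last exact: alt_iot.
by rewrite /= -natr1 !iotE; ring.
Qed.

(** The Euler (number) operator. *)
Lemma sum_eps_iot k T : kform k T -> \sum_a eps a (iot a T) = k%:R *: T.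
Proof.
move=> [aT hT]; apply: funext => s; rewrite sum_eps_iot_at // FE.
by have [->//|/hT ->] := eqVneq (size s) k; rewrite !mulr0.
Qed.

(** By the Clifford relation this is n minus the number operator. *)
Lemma sum_iot_eps k T : kform k T ->
  \sum_a iot a (eps a T) = (n%:R - k%:R) *: T.
Proof.
move=> kT; under eq_bigr => a _ do rewrite iot_eps eqxx scale1r.
by rewrite sumrB (sum_eps_iot kT) sumr_const card_ord scalerBl !scaler_nat.
Qed.

Lemma eps_sumE b T s : eps b T s =
  \sum_(r < size s) (-1) ^+ r * (nth b s r == b)%:R * T (take r s ++ drop r.+1 s).
Proof.
elim: s T => [|c s IH] T; first by rewrite eps_nil big_ord0.
rewrite -iotE iot_eps !FE big_ord_recl /= expr0 mul1r drop0; congr (_ + _).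
rewrite IH -sumrN; apply: eq_bigr => r _.
rewrite iotE /bump /= add1n exprS; ring.
Qed.

Lemma alt_move T s d t : alt T -> T (s ++ d :: t) = (-1) ^+ size s * T (d :: s ++ t).
Proof.
elim: s T => [|c s IH] T aT; first by rewrite mul1r.
rewrite cat_cons -iotE IH; last exact: alt_iot.
rewrite -!iotE /= exprS (iot_iot d c aT) !FE; ring.
Qed.

(** Moving the last index to the front, which is where contractions act. *)
Lemma alt_rcons T s d : alt T -> T (rcons s d) = (-1) ^+ size s * iot d T s.
Proof. by move=> aT; rewrite -cats1 alt_move // cats0 iotE. Qed.

(** The derivation of the exterior algebra extending a matrix acting on
    covectors; with the Christoffel symbols it is the connection term, with the
    curvature the curvature operator. *)
Definition gl (A : I -> I -> R) T : form := \sum_b \sum_d A b d *: eps b (iot d T).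

Lemma gl_linear A : linear (gl A).
Proof.
move=> x T S; rewrite /gl scaler_sumr -big_split; apply: eq_bigr => b _.
rewrite scaler_sumr -big_split; apply: eq_bigr => d _ /=.
by rewrite iot_linear eps_linear scalerDr !scalerA mulrC.
Qed.
HB.instance Definition _ A := GRing.isLinear.Build R form form *:%R (gl A) (gl_linear A).

Lemma glE A T s : alt T -> gl A T s =
  \sum_(r < size s) \sum_d A (tnth (in_tuple s) r) d * T (take r s ++ d :: drop r.+1 s).
Proof.
move=> aT; rewrite /gl sumFE.
under eq_bigr => b _ do rewrite sumFE.
under eq_bigr => b _ do under eq_bigr => d _ do rewrite FE eps_sumE mulr_sumr.
under eq_bigr => b _ do rewrite exchange_big.
rewrite exchange_big /=; apply: eq_bigr => r _.
rewrite exchange_big /=; apply: eq_bigr => d _.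
have rs : (r < size s)%N := ltn_ord r.
rewrite alt_move // size_takel 1?ltnW // (bigD1 (tnth (in_tuple s) r)) //= big1 ?addr0.
  by rewrite -(tnth_nth _ (in_tuple s)) eqxx iotE mulr1.
by move=> b /negbTE E; rewrite -(tnth_nth b (in_tuple s)) eq_sym E !(mulr0, mul0r).
Qed.

Definition epsv (v : I -> R) T : form := \sum_b v b *: eps b T.
Definition iotv (w : I -> R) T : form := \sum_a w a *: iot a T.

Lemma epsv_linear v : linear (epsv v).
Proof.
move=> x T S; rewrite /epsv scaler_sumr -big_split; apply: eq_bigr => b _.
by rewrite eps_linear scalerDr !scalerA mulrC.
Qed.
HB.instance Definition _ v := GRing.isLinear.Build R form form *:%R (epsv v) (epsv_linear v).
Lemma iotv_linear v : linear (iotv v).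
Proof.
move=> x T S; rewrite /iotv scaler_sumr -big_split; apply: eq_bigr => b _.
by rewrite iot_linear scalerDr !scalerA mulrC.
Qed.
HB.instance Definition _ v := GRing.isLinear.Build R form form *:%R (iotv v) (iotv_linear v).

Lemma kform_epsv k v T : kform k T -> kform k.+1 (epsv v T).
Proof. by move=> kT; apply: kform_sum => b _; apply/kformZ/kform_eps. Qed.
Lemma kform_iotv k v T : kform k T -> kform k.-1 (iotv v T).
Proof. by move=> kT; apply: kform_sum => b _; apply/kformZ/kform_iot. Qed.
Lemma kform_gl k A T : kform k T -> kform k (gl A T).
Proof.
move=> kT; apply: kform_sum => b _; apply: kform_sum => d _; apply/kformZ.
case: k kT => [|k] kT; last exact: (kform_eps _ (kform_iot _ kT)).
have -> : iot d T = 0 by apply: funext => s; rewrite iotE (proj2 kT).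
by rewrite linear0; apply: kform0.
Qed.
Lemma alt_iotv v T : alt T -> alt (iotv v T).
Proof. by move=> aT; apply: alt_sum => b _; apply/altZ/alt_iot. Qed.
Lemma alt_epsv v T : alt T -> alt (epsv v T).
Proof. by move=> aT; apply: alt_sum => b _; apply/altZ/alt_eps. Qed.

Lemma iot_epsv a v T : iot a (epsv v T) = v a *: T - epsv v (iot a T).
Proof.
rewrite /epsv linear_sum /=.
under eq_bigr => b _ do rewrite linearZ /= iot_eps scalerBr scalerA mulrC -scalerA.
by rewrite sumrB sum_delta.
Qed.
Lemma iotv_epsv w v T :
  iotv w (epsv v T) = (\sum_a w a * v a) *: T - epsv v (iotv w T).
Proof.
rewrite {1}/iotv; under eq_bigr => a _ do rewrite iot_epsv scalerBr scalerA.
rewrite sumrB scaler_suml; congr (_ - _).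
by rewrite /iotv linear_sum; apply: eq_bigr => a _; rewrite linearZ.
Qed.
Lemma iotv_eps w b T : iotv w (eps b T) = w b *: T - eps b (iotv w T).
Proof.
rewrite {1}/iotv.
under eq_bigr => a _ do rewrite iot_eps scalerBr scalerA mulrC eq_sym -scalerA.
rewrite sumrB sum_delta; congr (_ - _).
by rewrite /iotv linear_sum; apply: eq_bigr => a _; rewrite linearZ.
Qed.
Lemma eps_epsv b v T : eps b (epsv v T) = - epsv v (eps b T).
Proof.
rewrite /epsv linear_sum -sumrN; apply: eq_bigr => a _ /=.
by rewrite linearZ /= eps_eps scalerN.
Qed.
Lemma epsv_epsv v w T : epsv v (epsv w T) = - epsv w (epsv v T).
Proof.
rewrite {1}/epsv; under eq_bigr => a _ do rewrite eps_epsv scalerN.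
rewrite sumrN (_ : epsv v T = \sum_b v b *: eps b T) //; congr (- _); rewrite linear_sum.
by apply: eq_bigr => a _; rewrite linearZ.
Qed.
Lemma iot_iotv b v T : alt T -> iot b (iotv v T) = - iotv v (iot b T).
Proof.
move=> aT; rewrite /iotv linear_sum -sumrN; apply: eq_bigr => a _ /=.
by rewrite linearZ /= iot_iot // scalerN.
Qed.
Lemma iotv_iotv v w T : alt T -> iotv v (iotv w T) = - iotv w (iotv v T).
Proof.
move=> aT; rewrite {1}/iotv; under eq_bigr => a _ do rewrite iot_iotv // scalerN.
rewrite sumrN (_ : iotv v T = \sum_b v b *: iot b T) //; congr (- _); rewrite linear_sum.
by apply: eq_bigr => a _; rewrite linearZ.
Qed.

Lemma iot_gl c A T : alt T -> iot c (gl A T) = iotv (A c) T + gl A (iot c T).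
Proof.
move=> aT; rewrite /gl linear_sum /=.
under eq_bigr => b _ do rewrite linear_sum /=.
under eq_bigr => b _ do under eq_bigr => d _ do
  rewrite linearZ /= iot_eps (iot_iot c d aT) linearN opprK scalerDr scalerA mulrC -scalerA.
under eq_bigr => b _ do rewrite big_split /= -scaler_sumr.
by rewrite big_split /= sum_delta.
Qed.
Lemma gl_eps c A T : gl A (eps c T) = epsv (A^~ c) T + eps c (gl A T).
Proof.
rewrite /gl [X in _ = _ + X]linear_sum /= -big_split /=; apply: eq_bigr => b _.
rewrite linear_sum /= .
under eq_bigr => d _ do
  rewrite iot_eps linearB linearZ /= eps_eps opprK scalerDr scalerA mulrC eq_sym -scalerA.
rewrite big_split /= sum_delta; congr (_ + _).
by apply: eq_bigr => d _; rewrite linearZ.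
Qed.
Lemma gl_epsv v A T : gl A (epsv v T) = epsv (fun b => \sum_c A b c * v c) T + epsv v (gl A T).
Proof.
rewrite {1}/epsv linear_sum /=.
under eq_bigr => c _ do rewrite linearZ /= gl_eps scalerDr.
rewrite big_split; congr (_ + _).
rewrite /epsv; under eq_bigr => c _ do rewrite scaler_sumr.
rewrite exchange_big /=; apply: eq_bigr => b _.
by rewrite scaler_suml; apply: eq_bigr => c _; rewrite scalerA mulrC.
Qed.

Lemma glD A B T : gl (fun b d => A b d + B b d) T = gl A T + gl B T.
Proof.
rewrite /gl -big_split; apply: eq_bigr => b _; rewrite -big_split.
by apply: eq_bigr => d _; rewrite scalerDl.
Qed.
Lemma glN A T : gl (fun b d => - A b d) T = - gl A T.
Proof.
rewrite /gl -sumrN; apply: eq_bigr => b _; rewrite -sumrN.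
by apply: eq_bigr => d _; rewrite scaleNr.
Qed.

(** The commutator of the derivations given by two matrices is the derivation
    given by their commutator. *)
Lemma gl_gl A B T : alt T -> gl A (gl B T) = gl B (gl A T)
  + (gl (fun b f => \sum_d A b d * B d f) T - gl (fun b f => \sum_d B b d * A d f) T).
Proof.
move=> aT.
have -> : gl B (gl A T) = \sum_h \sum_f B h f *: (eps h (gl A (iot f T)) + eps h (iotv (A f) T)).
  rewrite {1}/gl; apply: eq_bigr => h _; apply: eq_bigr => f _.
  by rewrite iot_gl // linearD /= addrC.
have -> : gl A (gl B T) = \sum_h \sum_f B h f *: (epsv (A^~ h) (iot f T) + eps h (gl A (iot f T))).
  rewrite {2}/gl linear_sum; apply: eq_bigr => h _ /=; rewrite linear_sum.
  by apply: eq_bigr => f _ /=; rewrite linearZ /= gl_eps.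
have -> : gl (fun b f => \sum_d A b d * B d f) T = \sum_h \sum_f B h f *: epsv (A^~ h) (iot f T).
  rewrite /gl exchange_big [RHS]exchange_big; apply: eq_bigr => f _ /=.
  under [RHS]eq_bigr => h _ do rewrite /epsv scaler_sumr.
  rewrite [RHS]exchange_big; apply: eq_bigr => b _ /=.
  by rewrite scaler_suml; apply: eq_bigr => d _; rewrite scalerA mulrC.
have -> : gl (fun b f => \sum_d B b d * A d f) T = \sum_h \sum_f B h f *: eps h (iotv (A f) T).
  rewrite /gl; apply: eq_bigr => h _.
  under [RHS]eq_bigr => f _ do rewrite /iotv linear_sum scaler_sumr.
  rewrite [RHS]exchange_big; apply: eq_bigr => b _ /=.
  by rewrite scaler_suml; apply: eq_bigr => d _; rewrite linearZ /= scalerA.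
rewrite -sumrB -big_split; apply: eq_bigr => h _; rewrite -sumrB -big_split.
by apply: eq_bigr => f _ /=; apply: funext => s; rewrite !FE; ring.
Qed.

End Clifford.

(** * Tuples of indices as lists of indices *)

Section Tuples.
Variables (R : realType) (n : nat).
Local Notation I := 'I_n.
Local Notation form := (seq 'I_n -> R^o).

(** Extension by zero to lists of the wrong length. *)
Definition lf k (T : k.-tuple I -> R) : form :=
  fun s => if insub s is Some t then T t else 0.

Lemma lfE k (T : k.-tuple I -> R) (t : k.-tuple I) : lf T t = T t.
Proof. by rewrite /lf valK. Qed.

Lemma lf_hom k (T : k.-tuple I -> R) : hom k (lf T).
Proof. by move=> s hs; rewrite /lf insubN. Qed.

(** Forms of the same degree are compared on tuples of that length, which is
    how statements about components are carried to lists and back. *)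
Lemma hom_lfP k (T S : form) : hom k T -> hom k S ->
  (forall t : k.-tuple I, T t = S t) -> T = S.
Proof.
move=> hT hS E; apply: funext => s.
have [/eqP hs|hs] := eqVneq (size s) k; last by rewrite hT // hS.
exact: (E (Tuple hs)).
Qed.

Lemma lf_inj k (T S : k.-tuple I -> R) : lf T = lf S -> T = S.
Proof. by move=> E; apply: funext => t; rewrite -!lfE E. Qed.

Lemma iot_lf k a (T : k.+1.-tuple I -> R) :
  iot a (lf T) = lf (fun t => T (cons_tuple a t)).
Proof.
apply: (@hom_lfP k).
- by move=> s hs; rewrite iotE lf_hom.
- exact: lf_hom.
- by move=> t; rewrite iotE lfE -[RHS]/(T _) -[a :: t]/(val (cons_tuple a t)) lfE.
Qed.

Lemma iot_lf0 a (T : 0.-tuple I -> R) : iot a (lf T) = 0.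
Proof. by apply: funext => s; rewrite iotE lf_hom. Qed.

Lemma val_remove_index k (a : k.+1.-tuple I) (r : 'I_k.+1) :
  val (remove_index a r) = take r a ++ drop r.+1 a.
Proof.
have rk : (r <= k)%N by rewrite -ltnS ltn_ord.
have sz : size (take r a ++ drop r.+1 a) = k.
  by rewrite size_cat size_takel ?size_drop size_tuple ?subSS ?subnKC // ltnW.
apply: (@eq_from_nth _ (tnth a r)); first by rewrite sz size_tuple.
rewrite size_tuple => q qk.
rewrite -[q]/(val (Ordinal qk)) -tnth_nth tnth_mktuple (tnth_nth (tnth a r)) /=.
rewrite nth_cat size_takel; last by rewrite size_tuple ltnW.
rewrite /bump; case: (ltnP q r) => qr; first by rewrite nth_take.
by rewrite nth_drop add1n addSn subnKC.
Qed.

(** On tuples, [eps] is the alternating sum over the slot taken by dx^b. *)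
Lemma eps_at k b (T : form) (a : k.+1.-tuple I) :
  eps b T a = \sum_(r < k.+1) (-1) ^+ r * (tnth a r == b)%:R * T (remove_index a r).
Proof.
rewrite eps_sumE size_tuple; apply: eq_bigr => r _.
by rewrite val_remove_index (tnth_nth b).
Qed.

Lemma sum_eps_at k (U : I -> form) (a : k.+1.-tuple I) :
  (\sum_b eps b (U b)) a = \sum_(r < k.+1) (-1) ^+ r * U (tnth a r) (remove_index a r).
Proof.
rewrite sumFE; under eq_bigr => b _ do rewrite eps_at.
rewrite exchange_big /=; apply: eq_bigr => r _.
rewrite (bigD1 (tnth a r)) //= big1 ?addr0 ?eqxx ?mulr1 // => b /negbTE.
by rewrite eq_sym => ->; rewrite mulr0 mul0r.
Qed.

(** Skew-symmetrisation by expanding along the first slot; [lf_skew] identifies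
    it with the average over all permutations. *)
Fixpoint sk k (T : form) : form :=
  if k is k'.+1 then (k'.+1)%:R^-1 *: \sum_a eps a (sk k' (iot a T)) else T.

Lemma permute_lift k (s : 'S_k) (r : 'I_k.+1) (a : k.+1.-tuple I) :
  permute_index (lift_perm ord0 r s) a =
  cons_tuple (tnth a r) (permute_index s (remove_index a r)).
Proof.
apply: eq_from_tnth => q; rewrite tnth_mktuple.
case: (unliftP ord0 q) => [q'|] ->; first last.
  by rewrite lift_perm_id [RHS](tnth_nth (tnth a r)).
rewrite lift_perm_lift [RHS](tnth_nth (tnth a r)) /=.
by rewrite -[nat_of_ord q']/(val q') -(tnth_nth _ (permute_index s (remove_index a r))) !tnth_mktuple.
Qed.

Lemma hom_sk k (T : form) : hom k T -> hom k (sk k T).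
Proof.
elim: k T => [//|k IH] T hT s hs; rewrite /= FE sumFE big1 ?mulr0 // => a _.
by rewrite (@hom_eps _ _ k) //; apply: IH; apply: (hom_iot _ hT).
Qed.

(** A permutation of k+1 slots is a choice r of the image of the first slot
    together with a permutation of the remaining ones, and its sign is (-1)^r
    times that of the latter.  So the sum over permutations expands along the
    first slot, as does [sk]. *)
Lemma lf_skew k (T : k.-tuple I -> R) : lf (skew T) = sk k (lf T).
Proof.
elim: k T => [|k IH] T.
  apply: (@hom_lfP 0); [exact: lf_hom|exact: lf_hom|move=> t; rewrite /= !lfE /skew].
  rewrite fact0 invr1 mul1r (big_pred1 1%g) => [|s].
    by rewrite odd_perm1 mul1r; congr T; apply: eq_from_tnth => -[].
  by symmetry; apply/eqP/permP => -[].
have sk_hom (U : k.+1.-tuple I -> R) : hom k.+1 (sk k.+1 (lf U)).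
  exact/hom_sk/lf_hom.
apply: (@hom_lfP k.+1); [exact: lf_hom|exact: sk_hom|move=> a].
rewrite lfE /= FE sum_eps_at /skew factS natrM invfM -mulrA; congr (_ * _).
rewrite (partition_big (fun s : 'S_k.+1 => s ord0) xpredT) // mulr_sumr.
apply: eq_bigr => r _.
rewrite iot_lf -IH lfE /skew [RHS]mulrCA; congr (_ * _).
rewrite mulr_sumr.
rewrite (reindex (lift_perm ord0 r)).
  apply: eq_big => [s|s _]; first by rewrite lift_perm_id eqxx.
  rewrite permute_lift mulrA; congr (_ * _).
  by rewrite -(signr_odd _ r) -signr_addb odd_lift_perm (_ : odd (@ord0 k) = false).
pose u (s : 'S_k.+1) q := odflt q (unlift (s ord0) (s (lift ord0 q))).
have uK (s : 'S_k.+1) q : lift (s ord0) (u s q) = s (lift ord0 q).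
  rewrite /u; have := neq_lift ord0 q.
  by rewrite -(can_eq (permK s)) => /unlift_some[] ? ? ->.
have u_inj (s : 'S_k.+1) : injective (u s).
  move=> p q /(congr1 (lift (s ord0))); rewrite !uK.
  by move=> /perm_inj /lift_inj.
exists (fun s => perm (u_inj s)) => [s _ | s].
  by apply/permP => q; rewrite permE /u lift_perm_lift lift_perm_id liftK.
rewrite inE => /eqP s0; apply/permP => q.
case: (unliftP ord0 q) => [q'|] ->; rewrite ?lift_perm_id //.
by rewrite lift_perm_lift -s0 permE uK.
Qed.

Lemma sk_linear k : linear (sk k).
Proof.
elim: k => [//|k IH] x T S /=.
under eq_bigr => a _ do rewrite iot_linear IH eps_linear.
by rewrite big_split /= -scaler_sumr scalerDr !scalerA mulrC.
Qed.
HB.instance Definition _ k := GRing.isLinear.Build R form form *:%R (sk k) (sk_linear k).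

Lemma kform_sk k (T : form) : hom k T -> kform k (sk k T).
Proof.
elim: k T => [|k IH] T hT.
  by split=> // s a b t; rewrite /= !hT ?oppr0 // size_cat /= addnS.
by apply/kformZ/kform_sum => a _; apply/kform_eps/IH/(hom_iot _ hT).
Qed.

(** Each expansion step is the number operator, and cancels the normalisation. *)
Lemma sk_id k (T : form) : kform k T -> sk k T = T.
Proof.
elim: k T => [//|k IH] T kT /=.
under eq_bigr => a _ do rewrite (IH _ (kform_iot a kT)).
by rewrite (sum_eps_iot kT) scalerA mulVf ?scale1r // pnatr_eq0.
Qed.

Definition last_slot (a : I) (T : form) : form := fun s => T (rcons s a).

Lemma iot_last_slot a b (T : form) : iot b (last_slot a T) = last_slot a (iot b T).
Proof. by apply: funext => s; rewrite /last_slot !iotE. Qed.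

(** The same expansion along the last slot, for tensors whose distinguished
    index is written last. *)
Lemma sk_last k (T : form) : hom k.+1 T ->
  sk k.+1 T = ((-1) ^+ k / k.+1%:R) *: \sum_a eps a (sk k (last_slot a T)).
Proof.
elim: k T => [|k IH] T hT.
  rewrite expr0 /= mul1r; congr (_ *: _); apply: eq_bigr => a _; congr (eps a _).
  by apply: funext => -[|b s]; rewrite iotE // !hT // /last_slot hT // size_rcons.
rewrite -[LHS]/(k.+2%:R^-1 *: \sum_a eps a (sk k.+1 (iot a T))).
under eq_bigr => b _ do rewrite (IH _ (hom_iot b hT)) linearZ linear_sum /=.
rewrite -scaler_sumr exchange_big /= !scaler_sumr; apply: eq_bigr => a _.
under eq_bigr => b _ do rewrite eps_eps -iot_last_slot.
rewrite sumrN -linear_sum [in RHS]linearZ /= !scalerN !scalerA -scaleNr; congr (_ *: _).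
by rewrite exprS; ring.
Qed.

Definition alternating k (T : k.-tuple I -> R) :=
  forall (s : 'S_k) a, T (permute_index s a) = (-1) ^+ s * T a.

Lemma permute_indexM k (s t : 'S_k) (a : k.-tuple I) :
  permute_index s (permute_index t a) = permute_index (s * t)%g a.
Proof. by apply: eq_from_tnth => r; rewrite !tnth_mktuple permM. Qed.

Lemma alternating_skew k (T : k.-tuple I -> R) : alternating (skew T).
Proof.
move=> s a; rewrite /skew mulrCA; congr (_ * _); rewrite mulr_sumr.
rewrite [RHS](reindex_inj (mulIg s)) /=; apply: eq_bigr => t _.
rewrite permute_indexM odd_permM signr_addb mulrA; congr (_ * _).
by rewrite mulrCA -signr_addb addbb mulr1.
Qed.

Lemma skew_id k (T : k.-tuple I -> R) : alternating T -> skew T = T.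
Proof.
move=> aT; apply: funext => a; rewrite /skew.
under eq_bigr => s _ do rewrite aT mulrA -signr_addb addbb mul1r.
rewrite sumr_const card_Sn -(mulr_natl (T a)) mulrA mulVf ?mul1r //.
Qed.

(** Both directions go through the projection onto skew tensors: a tensor is
    fixed by it exactly if it is skew, in either sense. *)
Lemma alternatingP k (T : k.-tuple I -> R) : alternating T <-> kform k (lf T).
Proof.
split=> [/skew_id <-|kT]; first by rewrite lf_skew; apply/kform_sk/lf_hom.
suff -> : T = skew T by apply: alternating_skew.
by apply: lf_inj; rewrite lf_skew sk_id.
Qed.

Lemma lfB k (T S : k.-tuple I -> R) : lf (fun a => T a - S a) = lf T - lf S.
Proof.
apply: (@hom_lfP k); first exact: lf_hom.
  by move=> s hs; rewrite !FE !lf_hom // subr0.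
by move=> t; rewrite !FE !lfE.
Qed.
Lemma lfZ k x (T : k.-tuple I -> R) : lf (fun a => x * T a) = x *: lf T.
Proof.
apply: (@hom_lfP k); first exact: lf_hom.
  by move=> s hs; rewrite !FE !lf_hom // mulr0.
by move=> t; rewrite !FE !lfE.
Qed.
Lemma lf_sum k (J : finType) (F : J -> k.-tuple I -> R) :
  lf (fun a => \sum_j F j a) = \sum_j lf (F j).
Proof.
apply: (@hom_lfP k); first exact: lf_hom.
  by move=> s hs; rewrite sumFE big1 // => j _; rewrite lf_hom.
by move=> t; rewrite sumFE lfE; apply: eq_bigr => j _; rewrite lfE.
Qed.
Lemma lf0 k : lf (fun _ : k.-tuple I => 0) = 0.
Proof.
apply: (@hom_lfP k); first exact: lf_hom.
  by move=> s hs.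
by move=> t; rewrite lfE.
Qed.

Definition sharp (g : 'M[R]_n) (c : I) : I -> R := fun d => invmx g c d.

Lemma lf_skew_part m (T : I -> m.-tuple I -> R) c :
  (forall b, kform m (lf (T b))) ->
  lf (skew_part T c) = m.+1%:R^-1 *: iot c (\sum_b eps b (lf (T b))).
Proof.
move=> kT; rewrite /skew_part -[LHS](iot_lf c) lf_skew /= linearZ /=.
congr (_ *: iot c _); apply: eq_bigr => b _; congr (eps b _).
rewrite iot_lf -[RHS](sk_id (kT b)); congr (sk m (lf _)); apply: funext => t.
by rewrite theadE; congr (T b _); apply: val_inj.
Qed.

(** The skew-symmetrised product of g_c with the trace is [eps] with the
    covector g_c, up to the factor that [trace_part] carries. *)
Lemma lf_trace_part (g : 'M[R]_n) m (T : I -> m.-tuple I -> R) c :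
  (forall b, kform m (lf (T b))) ->
  lf (trace_part g T c) = (n%:R - m%:R + 1)^-1 *:
     epsv (fun b => g c b) (\sum_p iotv (sharp g p) (lf (T p))).
Proof.
case: m T => [|m] T kT.
  rewrite big1 ?linear0 ?scaler0; first exact: lf0.
  by move=> p _; rewrite /iotv big1 // => q _; rewrite iot_lf0 scaler0.
rewrite /trace_part lfZ lf_skew /= scalerA mulrAC divff ?pnatr_eq0 // mul1r.
congr (_ *: _); apply: eq_bigr => b _.
rewrite -linearZ; congr (eps b _); rewrite iot_lf.
have -> : (fun t : m.-tuple I => g c (thead (cons_tuple b t)) *
     \sum_p \sum_q invmx g p q * T p (cons_tuple q (behead_tuple (cons_tuple b t)))) =
   (fun t => g c b * \sum_p \sum_q invmx g p q * T p (cons_tuple q t)).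
  apply: funext => t; rewrite theadE; congr (_ * _).
  apply: eq_bigr => p _; apply: eq_bigr => q _; congr (_ * T p _).
  exact: val_inj.
rewrite lfZ lf_sum sk_id; last first.
  apply/kformZ/kform_sum => p _; rewrite lf_sum; apply/kform_sum => q _.
  by rewrite lfZ -iot_lf; apply/kformZ/(kform_iot _ (kT p)).
congr (_ *: _); apply: eq_bigr => p _; rewrite lf_sum.
by apply: eq_bigr => q _; rewrite lfZ -iot_lf.
Qed.

Lemma lf_int_mul m u (rho : m.+1.-tuple I -> R) :
  lf (int_mul u rho) = iotv (fun c => u 0 c) (lf rho).
Proof.
rewrite /int_mul lf_sum; apply: eq_bigr => c _.
by rewrite lfZ -iot_lf.
Qed.

Lemma ext_mulE (g : 'M[R]_n) m u (tau : m.-tuple I -> R) (a : m.+1.-tuple I) :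
  ext_mul g u tau a = epsv (fun c => (u *m g) 0 c) (lf tau) a.
Proof.
rewrite /epsv; under eq_bigr => c _ do rewrite -linearZ.
rewrite (sum_eps_at (fun c => _ *: _)); apply: eq_bigr => r _.
by rewrite FE lfE mulrA.
Qed.

End Tuples.

(** * Smooth functions of several variables *)

Section Calc.
Variables (R : realType).

(** The difference of two functions that agree near x is differentiable at x
    with derivative 0. *)
Lemma near_eq_differentiable (V W : normedModType R) (f g : V -> W) (x : V) :
  (\near x, f x = g x) -> differentiable f x -> differentiable g x.
Proof.
move=> fg df.
have fgx : f x = g x by exact: (nbhs_singleton fg).
pose h : V -> W := g - f.
have hx : h x = 0 by rewrite /h /= !fctE fgx subrr.
have E : h \o shift x = cst (h x) + (0 : V -> W) +o_ (0 : V) id.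
  apply/eqaddoP => e e0.
  have : \forall y \near (0 : V), f (y + x) = g (y + x).
    by move: fg; rewrite (near_shift 0); apply: filterS => y; rewrite /= subr0.
  apply: filterS => y /= fgy; rewrite !fctE /= hx /h !fctE fgy subrr.
  by rewrite sub0r add0r (_ : (0 : V -> W) y = 0) // oppr0 normr0 mulr_ge0 // ltW.
have dh : differentiable h x.
  apply/diff_locallyP.
  have -> : 'd h x = 0 :> (V -> W).
    have c0 : continuous (\0 : V -> W) by exact: cst_continuous.
    exact: (@diff_unique _ _ _ h _ x c0 E).
  by split=> //; exact: cst_continuous.
have -> : g = f + h by apply: funext => y; rewrite /h !fctE addrC subrK.
exact: differentiableD.
Qed.

Lemma is_derive_line (V : normedModType R) (f : V -> R) (p u : V) (r : R) :
  derivable f (p + r *: u) u ->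
  is_derive r 1 (fun r => f (p + r *: u)) ('D_u f (p + r *: u)).
Proof.
move=> df.
have E : (fun h : R => h^-1 *: (((fun r => f (p + r *: u)) \o shift r) (h *: 1) - f (p + r *: u)))
   = (fun h : R => h^-1 *: ((f \o shift (p + r *: u)) (h *: u) - f (p + r *: u))).
  apply: funext => h; rewrite /= scalerDl [h *: 1]mulr1 addrCA.
  by congr (_ *: (f _ - _)); rewrite addrA [h *: u + p]addrC addrA.
by split; rewrite /derivable /derive E.
Qed.

(** The mean value theorem applied along u to the difference in the direction
    v, and then along v to the u-derivative. *)
Lemma second_difference (V : normedModType R) (f : V -> R) (x u v : V) (s : R) :
  0 < s ->
  (forall r t, 0 <= r <= s -> 0 <= t <= s ->
     differentiable f (x + r *: u + t *: v) /\
     differentiable ('D_u f) (x + r *: u + t *: v)) ->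
  exists r t, [/\ 0 <= r <= s, 0 <= t <= s &
    f (x + s *: u + s *: v) - f (x + s *: u) - f (x + s *: v) + f x =
    s * s * 'D_v ('D_u f) (x + r *: u + t *: v)].
Proof.
move=> s0 H.
have s00 : 0 <= s <= s by rewrite lexx ltW.
have z0 : 0 <= (0 : R) <= s by rewrite lexx ltW.
have E p q (t : R) : p + q + t *: v = p + t *: v + q by rewrite addrAC.
pose phi r := f (x + s *: v + r *: u) - f (x + r *: u).
have dphi r : 0 <= r <= s -> is_derive r 1 phi ('D_u f (x + r *: u + s *: v) - 'D_u f (x + r *: u)).
  move=> rs.
  rewrite [x + r *: u + _]E.
  have [h1 _] := H _ _ rs s00; have [h2 _] := H _ _ rs z0.
  apply: is_deriveB; apply: is_derive_line; apply: diff_derivable.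
    by rewrite -E.
  by rewrite scale0r addr0 in h2.
have [r rs Er] : exists2 r, r \in `[0, s]%R & phi s - phi 0 =
    ('D_u f (x + r *: u + s *: v) - 'D_u f (x + r *: u)) * (s - 0).
  apply: (@MVT_segment _ phi); [exact: ltW| |].
    by move=> r; rewrite in_itv /= => /andP[r1 r2]; apply: dphi; rewrite !ltW.
  apply: derivable_within_continuous => r; rewrite in_itv /= => rs.
  by have [] := dphi r rs.
move: rs; rewrite in_itv /= => rs.
pose psi t := 'D_u f (x + r *: u + t *: v).
have dpsi t : 0 <= t <= s -> is_derive t 1 psi ('D_v ('D_u f) (x + r *: u + t *: v)).
  by move=> ts; apply: is_derive_line; apply: diff_derivable; have [] := H _ _ rs ts.
have [t ts Et] : exists2 t, t \in `[0, s]%R & psi s - psi 0 =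
    'D_v ('D_u f) (x + r *: u + t *: v) * (s - 0).
  apply: (@MVT_segment _ psi); [exact: ltW| |].
    by move=> t; rewrite in_itv /= => /andP[r1 r2]; apply: dpsi; rewrite !ltW.
  apply: derivable_within_continuous => t; rewrite in_itv /= => ts.
  by have [] := dpsi t ts.
move: ts; rewrite in_itv /= => ts.
exists r, t; split=> //.
move: Er Et; rewrite /phi /psi !scale0r !addr0 subr0 => Er Et.
move: Er; rewrite Et [x + s *: v + s *: u]addrAC => Er.
by rewrite mulrAC -mulrA mulrC -Er opprB [f x - _]addrC addrA.
Qed.

(** The second difference over a small square is symmetric in the two
    directions, and divided by the area it is close to either mixed derivative. *)
Lemma schwarz (V : normedModType R) (f : V -> R) (x u v : V) :
  (\near x, differentiable f x) -> (\near x, differentiable ('D_u f) x) ->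
  (\near x, differentiable ('D_v f) x) ->
  {for x, continuous ('D_v ('D_u f))} -> {for x, continuous ('D_u ('D_v f))} ->
  'D_v ('D_u f) x = 'D_u ('D_v f) x.
Proof.
move=> d0 du dv cu cv; apply/eqP; rewrite -subr_eq0 -normr_le0.
apply/ler_addgt0Pl => e e0; rewrite addr0.
have e2 : 0 < e / 2 by rewrite divr_gt0.
have : \forall y \near x, [/\ differentiable f y, differentiable ('D_u f) y,
    differentiable ('D_v f) y, `|'D_v ('D_u f) x - 'D_v ('D_u f) y| < e / 2
    & `|'D_u ('D_v f) x - 'D_u ('D_v f) y| < e / 2].
  move/cvgrPdist_lt : cu => /(_ _ e2) n1; move/cvgrPdist_lt : cv => /(_ _ e2) n2.
  have nI (A B : set V) : nbhs x A -> nbhs x B -> nbhs x (A `&` B) by exact: filterI.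
  have nS (A B : set V) : A `<=` B -> nbhs x A -> nbhs x B by exact: filterS.
  have nn := nI _ _ d0 (nI _ _ du (nI _ _ dv (nI _ _ n1 n2))).
  apply: (nS _ _ _ nn) => y [a1 [a2 [a3 [a4 a5]]]].
  exact: And5 a1 a2 a3 a4 a5.
move=> /nbhs_ballP[d /= dd Hd].
pose K := `|u| + `|v| + 1.
have K0 : 0 < K by rewrite ltr_wpDl // addr_ge0.
pose s := d / 2 / K.
have s0 : 0 < s by rewrite !divr_gt0.
have inb r t : 0 <= r <= s -> 0 <= t <= s -> ball x d (x + r *: u + t *: v).
  move=> /andP[r0 rs] /andP[t0 ts]; rewrite -ball_normE /= -addrA opprD addNKr normrN.
  apply: (@le_lt_trans _ _ (s * K)); last by rewrite /s divfK ?gt_eqF // ltr_pdivrMr // ltr_pMr // ltr1n.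
  apply: (le_trans (ler_normD _ _)); rewrite !normrZ !ger0_norm // /K !mulrDr.
  rewrite -[leLHS]addr0; apply: lerD; last by rewrite mulr1 ltW.
  by apply: lerD; apply: ler_wpM2r.
have [|r [t [rs ts E1]]] := @second_difference _ f x u v s s0.
  by move=> r t rs ts; have [] := Hd _ (inb r t rs ts).
have [|t' [r' [ts' rs' E2]]] := @second_difference _ f x v u s s0.
  by move=> r' t' rs' ts'; have := Hd _ (inb t' r' ts' rs'); rewrite addrAC => -[].
have E : 'D_v ('D_u f) (x + r *: u + t *: v) = 'D_u ('D_v f) (x + r' *: u + t' *: v).
  apply: (@mulfI _ (s * s)); first by rewrite mulf_neq0 // gt_eqF.
  by rewrite [x + r' *: u + _]addrAC -E1 -E2 [x + s *: v + _]addrAC [X in X + f x = _]addrAC.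
have [_ _ _ h1 _] := Hd _ (inb r t rs ts).
have [_ _ _ _ h2] := Hd _ (inb r' t' rs' ts').
rewrite -E in h2.
rewrite -(subrKA ('D_v ('D_u f) (x + r *: u + t *: v))).
apply: (le_trans (ler_normD _ _)); rewrite [leRHS]splitr.
apply: lerD; [exact: (ltW h1)|by rewrite distrC (ltW h2)].
Qed.

End Calc.

Section Partial.
Variables (R : realType) (n : nat).
Local Notation V := 'rV[R]_n.
Implicit Types (f g : V -> R) (U : set V) (x : V) (a b : 'I_n).

Lemma pd_near a f g x : (\near x, f x = g x) -> pd a f x = pd a g x.
Proof. exact: near_eq_derive. Qed.
Lemma near_open U (P : V -> Prop) x : open U -> U x -> (forall y, U y -> P y) -> \near x, P x.
Proof.
move=> oU Ux H; have : nbhs x U by apply: open_nbhs_nbhs; split.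
by apply: filterS.
Qed.

(** Partial derivatives are local, so a formula that holds on an open set only
    may be differentiated there. *)
Lemma pd_on a f g U x : open U -> U x -> (forall y, U y -> f y = g y) -> pd a f x = pd a g x.
Proof. by move=> oU Ux H; apply/pd_near/(near_open oU Ux). Qed.
Lemma pdD a f g x : differentiable f x -> differentiable g x ->
  pd a (fun y => f y + g y) x = pd a f x + pd a g x.
Proof. by move=> df dg; apply: deriveD; apply: diff_derivable. Qed.
Lemma pdN a f x : differentiable f x -> pd a (fun y => - f y) x = - pd a f x.
Proof. by move=> df; apply: deriveN; apply: diff_derivable. Qed.
Lemma pdB a f g x : differentiable f x -> differentiable g x ->
  pd a (fun y => f y - g y) x = pd a f x - pd a g x.
Proof. by move=> df dg; apply: deriveB; apply: diff_derivable. Qed.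
Lemma pdM a f g x : differentiable f x -> differentiable g x ->
  pd a (fun y => f y * g y) x = pd a f x * g x + f x * pd a g x.
Proof.
move=> df dg; rewrite addrC [pd a f x * _]mulrC.
by apply: deriveM; apply: diff_derivable.
Qed.
Lemma pd_cst a (r : R) x : pd a (fun=> r) x = 0.
Proof. exact: derive_cst. Qed.
Lemma pdZ a (r : R) f x : differentiable f x -> pd a (fun y => r * f y) x = r * pd a f x.
Proof. by move=> df; rewrite pdM // pd_cst mul0r add0r. Qed.
Lemma differentiable_bigsum (J : Type) (s : seq J) (P : pred J) (F : J -> V -> R) x :
  (forall j, P j -> differentiable (F j) x) ->
  differentiable (fun y => \sum_(j <- s | P j) F j y) x.
Proof.
move=> H; have -> : (fun y => \sum_(j <- s | P j) F j y) = \sum_(j <- s | P j) F j.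
  by apply: funext => y; elim/big_rec2: _ => // j y1 y2 _ ->.
elim/big_rec: _ => [|j g Pj dg]; first exact: differentiable_cst.
by apply: differentiableD => //; apply: H.
Qed.
Lemma pd_sum (J : Type) (s : seq J) (P : pred J) (F : J -> V -> R) a x :
  (forall j, P j -> differentiable (F j) x) ->
  pd a (fun y => \sum_(j <- s | P j) F j y) x = \sum_(j <- s | P j) pd a (F j) x.
Proof.
move=> H; elim: s => [|j s IH].
  by under eq_fun => y do rewrite big_nil; rewrite big_nil pd_cst.
rewrite big_cons; under eq_fun => y do rewrite big_cons.
case: ifP => // Pj; rewrite -IH; apply: pdD; first exact: H.
exact: differentiable_bigsum.
Qed.

Lemma pdV a f x : differentiable f x -> f x != 0 ->
  pd a (fun y => (f y)^-1) x = - (f x)^-1 * (f x)^-1 * pd a f x.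
Proof.
move=> df f0; rewrite /pd deriveV //; last exact: diff_derivable.
by rewrite /GRing.scale /= expr2 invfM !mulNr.
Qed.

Lemma Ck_near m U f g : open U -> (forall y, U y -> f y = g y) ->
  Ck_on m U f -> Ck_on m U g.
Proof.
move=> oU; elim: m f g => [|m IH] f g E /=.
  move=> cf x Ux; have nE : {near x, f =1 g} by exact: (near_open oU Ux).
  rewrite /prop_for /continuous_at -(E x Ux).
  exact: (cvg_trans (near_eq_cvg nE) (cf x Ux)).
move=> [df cf]; split.
  by move=> x Ux; apply: near_eq_differentiable (df x Ux); exact: (near_open oU Ux).
by move=> a; apply: IH (cf a) => y Uy; apply: (pd_on _ oU Uy).
Qed.

Lemma CkS m U f : Ck_on m.+1 U f -> Ck_on m U f.
Proof.
elim: m f => [|m IH] f [df cf].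
  by move=> x Ux; apply: differentiable_continuous; apply: df.
by split=> // a; apply: IH.
Qed.

Lemma Ck_sub m U U' f : U' `<=` U -> Ck_on m U f -> Ck_on m U' f.
Proof.
move=> sU; elim: m f => [|m IH] f /=; first by move=> cf x /sU /cf.
by move=> [df cf]; split=> [x /sU /df //|a]; apply: IH.
Qed.

Lemma Ck_cst m U (r : R) : Ck_on m U (fun=> r).
Proof.
elim: m r => [|m IH] r /=; first by move=> x _; exact: cst_continuous.
split=> [x _|a]; first exact: differentiable_cst.
by rewrite (_ : pd a _ = fun=> 0) //; apply: funext => x; rewrite pd_cst.
Qed.

Lemma CkD m U f g : open U -> Ck_on m U f -> Ck_on m U g -> Ck_on m U (fun y => f y + g y).
Proof.
move=> oU; elim: m f g => [|m IH] f g /=.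
  by move=> cf cg x Ux; apply: continuousD; [exact: cf|exact: cg].
move=> [df cf] [dg cg]; split=> [x Ux|a]; first by apply: differentiableD; [exact: df|exact: dg].
apply: (@Ck_near _ _ (fun y => pd a f y + pd a g y)) => //; last exact: IH.
by move=> y Uy; rewrite pdD //; [exact: df|exact: dg].
Qed.

Lemma CkM m U f g : open U -> Ck_on m U f -> Ck_on m U g -> Ck_on m U (fun y => f y * g y).
Proof.
move=> oU; elim: m f g => [|m IH] f g.
  by move=> cf cg x Ux; apply: continuousM; [exact: cf|exact: cg].
move=> sf sg; have [df cf] := sf; have [dg cg] := sg.
split=> [x Ux|a]; first by apply: differentiableM; [exact: df|exact: dg].
apply: (@Ck_near _ _ (fun y => pd a f y * g y + f y * pd a g y)) => //.
  by move=> y Uy; rewrite pdM //; [exact: df|exact: dg].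
exact: (CkD oU (IH _ _ (cf a) (CkS sg)) (IH _ _ (CkS sf) (cg a))).
Qed.

(** By induction: the derivative of 1/f is a polynomial in 1/f and f'. *)
Lemma CkV m U f : open U -> (forall x, U x -> f x != 0) -> Ck_on m U f ->
  Ck_on m U (fun y => (f y)^-1).
Proof.
move=> oU f0; elim: m => [|m IH].
  by move=> cf x Ux; exact: (cvgV (f0 x Ux) (cf x Ux)).
move=> sf; have [df cf] := sf.
split=> [x Ux|a]; first by apply: differentiableV; [exact: df|exact: f0].
apply: (@Ck_near _ _ (fun y => (-1) * (((f y)^-1 * (f y)^-1) * pd a f y))) => //.
  by move=> y Uy; rewrite pdV //; [ring|exact: df|exact: f0].
have sV := IH (CkS sf).
exact: (CkM oU (Ck_cst m U (-1)) (CkM oU (CkM oU sV sV) (cf a))).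
Qed.

(** Smoothness is local; this is used for 1/|f|, which agrees with 1/f or
    -1/f near each point. *)
Lemma Ck_local m U f : (forall x, U x -> exists V, [/\ open V, V x & Ck_on m V f]) -> Ck_on m U f.
Proof.
elim: m f => [|m IH] f H /=; first by move=> x /H[V [_ Vx]]; apply.
split=> [x /H[V [_ Vx [df _]]]|a]; first exact: df.
by apply: IH => x /H[V [oV Vx [_ cf]]]; exists V; split=> //; exact: cf.
Qed.

Lemma smooth_diff U f x : smooth_on U f -> U x -> differentiable f x.
Proof. by move=> /(_ 1) [df _]; apply: df. Qed.
Lemma smooth_cont U f x : smooth_on U f -> U x -> {for x, continuous f}.
Proof. by move=> /(_ 0); apply. Qed.
Lemma smooth_pd U f a : smooth_on U f -> smooth_on U (pd a f).
Proof. by move=> sf m; have [_] := sf m.+1; apply. Qed.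
Lemma smooth_near U f g : open U -> (forall y, U y -> f y = g y) -> smooth_on U f -> smooth_on U g.
Proof. by move=> oU E sf m; apply: Ck_near (sf m). Qed.
Lemma smooth_sub U U' f : U' `<=` U -> smooth_on U f -> smooth_on U' f.
Proof. by move=> s sf m; apply: Ck_sub (sf m). Qed.
Lemma smooth_cst U (r : R) : smooth_on U (fun=> r).
Proof. by move=> m; exact: Ck_cst. Qed.
Lemma smoothD U f g : open U -> smooth_on U f -> smooth_on U g -> smooth_on U (fun y => f y + g y).
Proof. by move=> oU sf sg m; apply: CkD. Qed.
Lemma smoothM U f g : open U -> smooth_on U f -> smooth_on U g -> smooth_on U (fun y => f y * g y).
Proof. by move=> oU sf sg m; apply: CkM. Qed.
Lemma smoothN U f : open U -> smooth_on U f -> smooth_on U (fun y => - f y).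
Proof.
move=> oU sf; under eq_fun => y do rewrite -mulN1r.
by apply: smoothM => //; exact: smooth_cst.
Qed.
Lemma smoothB U f g : open U -> smooth_on U f -> smooth_on U g -> smooth_on U (fun y => f y - g y).
Proof. by move=> oU sf sg; apply: smoothD => //; apply: smoothN. Qed.
Lemma smoothV U f : open U -> (forall x, U x -> f x != 0) -> smooth_on U f ->
  smooth_on U (fun y => (f y)^-1).
Proof. by move=> oU f0 sf m; apply: CkV. Qed.
Lemma smoothX U f k : open U -> smooth_on U f -> smooth_on U (fun y => f y ^+ k).
Proof.
move=> oU sf; elim: k => [|k IH]; first exact: smooth_cst.
by under eq_fun => y do rewrite exprS; apply: smoothM.
Qed.
Lemma smooth_sum U (J : Type) (s : seq J) (P : pred J) (F : J -> V -> R) : open U ->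
  (forall j, P j -> smooth_on U (F j)) -> smooth_on U (fun y => \sum_(j <- s | P j) F j y).
Proof.
move=> oU H; elim: s => [|j s IH].
  by under eq_fun => y do rewrite big_nil; exact: smooth_cst.
under eq_fun => y do rewrite big_cons.
by case Pj: (P j) => //; apply: smoothD => //; apply: H.
Qed.
Lemma smooth_prod U (J : Type) (s : seq J) (P : pred J) (F : J -> V -> R) : open U ->
  (forall j, P j -> smooth_on U (F j)) -> smooth_on U (fun y => \prod_(j <- s | P j) F j y).
Proof.
move=> oU H; elim: s => [|j s IH].
  by under eq_fun => y do rewrite big_nil; exact: smooth_cst.
under eq_fun => y do rewrite big_cons.
by case Pj: (P j) => //; apply: smoothM => //; apply: H.
Qed.
Lemma smooth_local U f : (forall x, U x -> exists V, [/\ open V, V x & smooth_on V f]) -> smooth_on U f.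
Proof.
move=> H m; apply: Ck_local => x /H[V [oV Vx sf]]; exists V; split=> //.
Qed.

Lemma pdC U f a b x : open U -> smooth_on U f -> U x -> pd a (pd b f) x = pd b (pd a f) x.
Proof.
move=> oU sf Ux; apply: schwarz.
- by apply: (near_open oU Ux) => y; exact: smooth_diff.
- by apply: (near_open oU Ux) => y; exact: (smooth_diff (smooth_pd b sf)).
- by apply: (near_open oU Ux) => y; exact: (smooth_diff (smooth_pd a sf)).
- exact: (smooth_cont (smooth_pd a (smooth_pd b sf))).
- exact: (smooth_cont (smooth_pd b (smooth_pd a sf))).
Qed.

Lemma differentiable_expR (t : R) : differentiable expR t.
Proof. by apply/derivable1_diffP; exact: derivable_expR. Qed.
Lemma pd_expR f a x : differentiable f x -> pd a (fun y => expR (f y)) x = expR (f x) * pd a f x.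
Proof.
move=> df; have dE := differentiable_expR (f x).
rewrite /pd [LHS](@deriveE _ _ _ (expR \o f)); last exact: differentiable_comp.
rewrite diff_comp // deriveE //= deriv1E; last exact: derivable_expR.
by rewrite derive1E derive_val /GRing.scale /= mulrC.
Qed.
Lemma smooth_expR U f : open U -> smooth_on U f -> smooth_on U (fun y => expR (f y)).
Proof.
move=> oU sf; elim=> [|m IH].
  by move=> x Ux; apply: continuous_comp; [exact: (smooth_cont sf)|exact: continuous_expR].
split=> [x Ux|a].
  exact: (differentiable_comp (smooth_diff sf Ux) (differentiable_expR (f x))).
apply: (@Ck_near _ _ (fun y => expR (f y) * pd a f y)) => //.
  by move=> y Uy; rewrite pd_expR //; exact: (smooth_diff sf).
by apply: CkM => //; exact: (smooth_pd a sf m).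
Qed.

Lemma smooth_det U k (A : V -> 'M[R]_k) : open U ->
  (forall i j, smooth_on U (fun y => A y i j)) -> smooth_on U (fun y => \det (A y)).
Proof.
move=> oU H; apply: smooth_sum => // s _; apply: smoothM => //; first exact: smooth_cst.
by apply: smooth_prod.
Qed.

(** Cramer's rule. *)
Lemma smooth_invmx U k (A : V -> 'M[R]_k) : open U -> (forall y, U y -> A y \in unitmx) ->
  (forall i j, smooth_on U (fun y => A y i j)) ->
  forall i j, smooth_on U (fun y => invmx (A y) i j).
Proof.
move=> oU uA sA i j.
apply: (@smooth_near _ (fun y => (\det (A y))^-1 * ((-1) ^+ (j + i) * \det (row' j (col' i (A y)))))) => //.
  by move=> y Uy; rewrite /invmx uA // !mxE.
apply: smoothM => //.
  apply: smoothV => //; last exact: smooth_det.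
  by move=> y Uy; have := uA y Uy; rewrite unitmxE unitfE.
apply: smoothM => //; first exact: smooth_cst.
apply: smooth_det => // i' j'.
by under eq_fun => y do rewrite !mxE; exact: sA.
Qed.

End Partial.

Section Chain.
Variables (R : realType) (m n : nat).

Lemma rV_sum (v : 'rV[R]_n) : v = \sum_d v 0 d *: delta_mx 0 d.
Proof. exact: row_sum_delta. Qed.

(** Componentwise differentiability, assembled by linear combination of the
    basis vectors. *)
Lemma differentiable_rV (phi : 'rV[R]_m -> 'rV[R]_n) y :
  (forall d, differentiable (fun y => phi y 0 d) y) -> differentiable phi y.
Proof.
move=> H.
have -> : phi = \sum_d (fun y => phi y 0 d *: (delta_mx 0 d : 'rV[R]_n)).
  by apply: funext => z; rewrite [LHS]rV_sum fct_sumE.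
by apply: differentiable_sum => d; apply: differentiableZl.
Qed.

Lemma diff_coord (phi : 'rV[R]_m -> 'rV[R]_n) y v d :
  differentiable phi y ->
  'd phi y v 0 d = 'd (fun y => phi y 0 d) y v.
Proof.
move=> dp.
have dc : differentiable (fun N : 'rV[R]_n => N 0 d) (phi y) := differentiable_coord _ _ _.
have lL : linear (fun N : 'rV[R]_n => N 0 d) by move=> a x z; rewrite !mxE.
pose L : {linear _ -> _} := HB.pack (fun N : 'rV[R]_n => N 0 d)
  (GRing.isLinear.Build _ _ _ _ _ lL).
have cL : continuous L := @matrix_normedtype.coord_continuous R 1 n 0 d.
have E : 'd L (phi y) = L :> ('rV[R]_n -> R) := @diff_lin _ _ _ L (phi y) cL.
rewrite -[RHS]/('d (L \o phi) y v) (@diff_comp _ _ _ _ phi L y dp dc) /=.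
by rewrite E.
Qed.

Lemma pd_comp (phi : 'rV[R]_m -> 'rV[R]_n) (f : 'rV[R]_n -> R) y c :
  (forall d, differentiable (fun y => phi y 0 d) y) -> differentiable f (phi y) ->
  pd c (fun y => f (phi y)) y = \sum_d pd c (fun y => phi y 0 d) y * pd d f (phi y).
Proof.
move=> dp df; have dphi := differentiable_rV dp.
rewrite /pd [LHS](@deriveE _ _ _ (f \o phi)); last exact: differentiable_comp.
rewrite diff_comp //= ['d phi y _]rV_sum linear_sum; apply: eq_bigr => d _.
by rewrite linearZ /= !deriveE // diff_coord.
Qed.

Lemma jacobianE (phi : 'rV[R]_m -> 'rV[R]_n) y c d :
  (forall d, differentiable (fun y => phi y 0 d) y) ->
  ('J phi y) c d = pd c (fun y => phi y 0 d) y.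
Proof.
move=> dp; have dphi := differentiable_rV dp.
rewrite /jacobian /pd deriveE // -diff_coord //.
by rewrite [lin1_mx _ _ _]mxE.
Qed.
End Chain.

(** * The curvature operator on forms at a point *)

Section Sums.
Variables (R : realType) (n : nat) (V : lmodType R).
Local Notation I := 'I_n.

Lemma lmod_double0 (v : V) : v = - v -> v = 0.
Proof.
move=> /eqP; rewrite -addr_eq0 -mulr2n -scaler_nat scaler_eq0 pnatr_eq0 /=.
by move=> /eqP.
Qed.

(** A symmetric matrix contracted with an antisymmetric family gives zero;
    used for P_ab, for Christoffel symbols and for second derivatives. *)
Lemma sym_antisym_sum0 (A : I -> I -> R) (F : I -> I -> V) :
  (forall a b, A a b = A b a) -> (forall a b, F a b = - F b a) ->
  \sum_a \sum_b A a b *: F a b = 0.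
Proof.
move=> sA aF; apply: lmod_double0; rewrite {1}exchange_big -sumrN.
apply: eq_bigr => a _; rewrite -sumrN; apply: eq_bigr => b _.
by rewrite sA aF scalerN.
Qed.
End Sums.

Section Pointwise.
Variables (R : realType) (n : nat) (G : 'M[R]_n).
Hypothesis symG : G^T = G.
Hypothesis unitG : G \in unitmx.
Local Notation I := 'I_n.
Local Notation form := (seq 'I_n -> R^o).
Local Notation H := (invmx G).

Lemma symH : H^T = H.
Proof. by rewrite trmx_inv symG. Qed.
Lemma symGE a b : G a b = G b a.
Proof. by rewrite -{1}symG mxE. Qed.
Lemma symHE a b : H a b = H b a.
Proof. by rewrite -{1}symH mxE. Qed.
Lemma GHE a b : \sum_c G a c * H c b = (a == b)%:R.
Proof. by have := mulmxV unitG => /matrixP/(_ a b); rewrite !mxE. Qed.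
Lemma HGE a b : \sum_c H a c * G c b = (a == b)%:R.
Proof. by have := mulVmx unitG => /matrixP/(_ a b); rewrite !mxE. Qed.

(** Contraction with the index a raised by the metric. *)
Definition up (c : I) : form -> form := iotv (sharp G c).

(** Exterior multiplication by the covector g(e_a, .). *)
Definition lo (c : I) : form -> form := epsv (fun b => G c b).
HB.instance Definition _ c := GRing.Linear.on (up c).
HB.instance Definition _ c := GRing.Linear.on (lo c).

Lemma upE c T : up c T = \sum_d H c d *: iot d T. Proof. by []. Qed.

Lemma lower_up a T : \sum_c G a c *: up c T = iot a T.
Proof.
under eq_bigr => c _ do rewrite upE scaler_sumr.
rewrite exchange_big /=.
under eq_bigr => d _ do (under eq_bigr => c _ do rewrite scalerA; rewrite -scaler_suml GHE).
by rewrite sum_delta.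
Qed.
Lemma lower_up' a T : \sum_c G c a *: up c T = iot a T.
Proof. by under eq_bigr => c _ do rewrite symGE; rewrite lower_up. Qed.
Lemma raise_lo a T : \sum_c H a c *: lo c T = eps a T.
Proof.
under eq_bigr => c _ do rewrite /lo /epsv scaler_sumr.
rewrite exchange_big /=.
under eq_bigr => d _ do (under eq_bigr => c _ do rewrite scalerA; rewrite -scaler_suml HGE).
by rewrite sum_delta.
Qed.

Lemma up_lo c a T : up c (lo a T) = (c == a)%:R *: T - lo a (up c T).
Proof.
rewrite /up /lo iotv_epsv; congr (_ *: _ - _).
by rewrite -HGE; apply: eq_bigr => d _; rewrite /sharp (symGE a).
Qed.

Lemma up_eps c b T : up c (eps b T) = H c b *: T - eps b (up c T).
Proof. exact: iotv_eps. Qed.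
Lemma up_epsv c v T : up c (epsv v T) = (\sum_d H c d * v d) *: T - epsv v (up c T).
Proof. exact: iotv_epsv. Qed.
Lemma up_up a b T : alt T -> up a (up b T) = - up b (up a T).
Proof. exact: iotv_iotv. Qed.
Lemma iot_up a b T : alt T -> iot a (up b T) = - up b (iot a T).
Proof. exact: iot_iotv. Qed.
Lemma eps_lo b a T : eps b (lo a T) = - lo a (eps b T).
Proof. exact: eps_epsv. Qed.
Lemma kform_up k c T : kform k T -> kform k.-1 (up c T).
Proof. exact: kform_iotv. Qed.
Lemma alt_up c T : alt T -> alt (up c T).
Proof. exact: alt_iotv. Qed.

(** The number operator again, after raising an index and lowering it. *)
Lemma sum_up_lo k T : kform k T -> \sum_c up c (lo c T) = (n%:R - k%:R) *: T.
Proof.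
move=> kT; rewrite -(sum_iot_eps kT).
under eq_bigr => c _ do rewrite upE.
rewrite exchange_big /=; apply: eq_bigr => d _.
rewrite -raise_lo linear_sum; apply: eq_bigr => c _ /=.
by rewrite linearZ /= symHE.
Qed.

(** Contractions anticommute while the inverse metric is symmetric. *)
Lemma sum_up_iot T : alt T -> \sum_c up c (iot c T) = 0.
Proof.
move=> aT; under eq_bigr => c _ do rewrite upE.
apply: sym_antisym_sum0 => [a b|a b]; [exact: symHE|exact: iot_iot].
Qed.

Lemma sum_eps_lo T : \sum_c eps c (lo c T) = 0.
Proof.
under eq_bigr => c _ do (rewrite /lo /epsv linear_sum; under eq_bigr => b _ do rewrite linearZ).
by apply: sym_antisym_sum0 => [a b|a b]; [exact: symGE|exact: eps_eps].
Qed.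

Section Curv.
Variables (Rm : I -> I -> I -> I -> R) (P : I -> I -> R).
Hypothesis symP : forall a b, P a b = P b a.
Let C a c e f := Rm a c e f - (G e a * P c f - G e c * P a f) - (G f c * P a e - G f a * P c e).
Hypothesis weylC12 : forall a b c d, C a b c d = - C b a c d.
Hypothesis weylC34 : forall a b c d, C a b c d = - C a b d c.
Hypothesis weylC_bianchi : forall a b c d, C a b c d + C a c d b + C a d b c = 0.
Hypothesis weylC_trace : forall a f, \sum_c \sum_e H c e * C a c e f = 0.

(** Contraction with the vector P_a^f. *)
Definition int_P a T : form := \sum_f P a f *: up f T.
Lemma int_P_linear a : linear (int_P a).
Proof.
move=> x T S; rewrite /int_P scaler_sumr -big_split; apply: eq_bigr => b _ /=.
by rewrite linearP scalerDr !scalerA mulrC.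
Qed.
HB.instance Definition _ a := GRing.isLinear.Build R form form *:%R (int_P a) (int_P_linear a).

(** The action on forms of the curvature endomorphism R_ac. *)
Definition rop a c T : form := \sum_e \sum_f Rm a c e f *: eps e (up f T).

(** The decomposition of the curvature into its Weyl and Schouten parts, in
    operator form. *)
Lemma ropE a c T : rop a c T = (\sum_e \sum_f C a c e f *: eps e (up f T)) +
  (lo a (int_P c T) - lo c (int_P a T) + epsv (P a) (iot c T) - epsv (P c) (iot a T)).
Proof.
have E1 a' c' : lo a' (int_P c' T) = \sum_e \sum_f (G e a' * P c' f) *: eps e (up f T).
  rewrite /lo /epsv; apply: eq_bigr => e _; rewrite /int_P linear_sum scaler_sumr.
  by apply: eq_bigr => f _; rewrite /= linearZ /= scalerA symGE.
have E2 a' c' : epsv (P a') (iot c' T) = \sum_e \sum_f (G f c' * P a' e) *: eps e (up f T).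
  rewrite /epsv; apply: eq_bigr => e _; rewrite -lower_up' linear_sum scaler_sumr.
  by apply: eq_bigr => f _; rewrite /= linearZ /= scalerA mulrC.
rewrite !E1 !E2 -!sumrB -!big_split /= -sumrB -big_split /=.
apply: eq_bigr => e _; rewrite -!sumrB -!big_split /= -sumrB -big_split /=.
apply: eq_bigr => f _; rewrite -!scalerBl -!scalerDl -scalerBl -scalerDl.
by congr (_ *: _); rewrite /C; ring.
Qed.

Lemma sum_up_int_P T : alt T -> \sum_c up c (int_P c T) = 0.
Proof.
move=> aT.
under eq_bigr => c _ do (rewrite /int_P linear_sum; under eq_bigr => f _ do rewrite linearZ).
by apply: sym_antisym_sum0 => // a b; exact: up_up.
Qed.
Lemma sum_eps_epsvP T : \sum_c eps c (epsv (P c) T) = 0.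
Proof.
under eq_bigr => c _ do (rewrite /epsv linear_sum; under eq_bigr => f _ do rewrite linearZ).
by apply: sym_antisym_sum0 => // a b; exact: eps_eps.
Qed.

(** The Weyl term C_ae^cf iota_c iota_f of the first curvature condition; the
    second one is [Wdown]. *)
Definition Wup a T : form := \sum_e eps e (\sum_c \sum_f C a e c f *: up c (up f T)).
Definition Wdown a T : form := \sum_c eps c (\sum_e eps e (\sum_f C a c e f *: up f T)).

(** Contracting the Weyl curvature operator: the trace of C drops out, and by
    the Bianchi identity the remaining contraction over the pair (c, f) of
    C_acef is half of that of C_aecf. *)
Lemma sum_upC a T : alt T ->
  \sum_c up c (\sum_e \sum_f C a c e f *: eps e (up f T)) = - (2^-1 *: Wup a T).
Proof.
move=> aT.
have -> : \sum_c up c (\sum_e \sum_f C a c e f *: eps e (up f T)) =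
   \sum_f (\sum_c \sum_e H c e * C a c e f) *: up f T -
   \sum_e eps e (\sum_c \sum_f C a c e f *: up c (up f T)).
  transitivity (\sum_c \sum_e \sum_f ((H c e * C a c e f) *: up f T - C a c e f *: eps e (up c (up f T)))).
    apply: eq_bigr => c _; rewrite linear_sum; apply: eq_bigr => e _ /=.
    rewrite linear_sum; apply: eq_bigr => f _ /=.
    by rewrite linearZ /= up_eps scalerBr scalerA mulrC.
  under eq_bigr => c _ do under eq_bigr => e _ do rewrite sumrB.
  under eq_bigr => c _ do rewrite sumrB.
  rewrite sumrB; congr (_ - _).
    under eq_bigr => c _ do rewrite exchange_big.
    rewrite exchange_big /=; apply: eq_bigr => f _.
    rewrite scaler_suml; apply: eq_bigr => c _.
    by rewrite scaler_suml.
  rewrite exchange_big /=; apply: eq_bigr => e _.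
  rewrite linear_sum; apply: eq_bigr => c _ /=.
  by rewrite linear_sum; apply: eq_bigr => f _ /=; rewrite linearZ.
rewrite big1 ?sub0r => [|f _]; last by rewrite weylC_trace scale0r.
congr (- _); rewrite /Wup scaler_sumr; apply: eq_bigr => e _.
rewrite -linearZ; congr (eps e _).
set X := LHS.
(* Bianchi, and the antisymmetry of the double contraction in c and f. *)
have E : \sum_c \sum_f C a e c f *: up c (up f T) = X + X.
  have XE : X = - \sum_c \sum_f C a f e c *: up c (up f T).
    rewrite /X exchange_big -sumrN; apply: eq_bigr => c _; rewrite -sumrN; apply: eq_bigr => f _.
    by rewrite up_up // scalerN.
  rewrite {2}XE /X -sumrB; apply: eq_bigr => c _; rewrite -sumrB; apply: eq_bigr => f _.
  rewrite -scalerBl; congr (_ *: _).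
  have := weylC_bianchi a c e f; rewrite (weylC34 a e f c) (weylC34 a f c e); lra.
by rewrite E -mulr2n -(scaler_nat 2 X) scalerA mulVf ?scale1r // pnatr_eq0.
Qed.

(** The interior trace of the curvature operator: the Weyl term, the Schouten
    contraction, and a rest of the form iota_a X that the projection kills. *)
Lemma rop_up k a S : kform k.+1 S ->
  \sum_c up c (rop a c S) = - (2^-1 *: Wup a S) - (n%:R - k.+1%:R) *: int_P a S
    + iot a (\sum_c epsv (P c) (up c S) - (\sum_c \sum_d H c d * P c d) *: S).
Proof.
move=> kS; have aS := proj1 kS.
under eq_bigr => c _ do rewrite ropE linearD /=.
rewrite big_split /= sum_upC // -addrA; congr (_ + _).
under eq_bigr => c _ do rewrite linearB linearD linearB /= up_lo.
rewrite !sumrB big_split /= !sumrB.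
have -> : \sum_c (c == a)%:R *: int_P c S = int_P a S.
  by under eq_bigr => c _ do rewrite eq_sym; rewrite sum_delta.
have -> : \sum_c lo a (up c (int_P c S)) = 0.
  by rewrite -linear_sum sum_up_int_P // linear0.
have kPa : kform k (int_P a S) by apply: kform_sum => f _; apply/kformZ/(kform_up _ kS).
rewrite (sum_up_lo kPa).
have -> : \sum_c up c (epsv (P a) (iot c S)) = int_P a S.
  under eq_bigr => c _ do rewrite up_epsv.
  rewrite sumrB -linear_sum sum_up_iot // linear0 subr0.
  under eq_bigr => c _ do rewrite scaler_suml.
  rewrite exchange_big /=; apply: eq_bigr => d _.
  rewrite upE scaler_sumr; apply: eq_bigr => c _.
  by rewrite scalerA /sharp symHE mulrC.
have -> : \sum_c up c (epsv (P c) (iot a S)) =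
    (\sum_c \sum_d H c d * P c d) *: iot a S + int_P a S - iot a (\sum_c epsv (P c) (up c S)).
  under eq_bigr => c _ do rewrite up_epsv.
  rewrite sumrB -scaler_suml -addrA; congr (_ + _).
  rewrite [in RHS]linear_sum /= /int_P -sumrB -sumrN; apply: eq_bigr => c _ /=.
  rewrite iot_epsv iot_up // [epsv (P c) (- _)]linearN /= symP.
  by apply: funext => s; rewrite !FE; ring.
rewrite [X in _ = _ + X]linearB /= [X in _ = _ + (_ - X)]linearZ /=.
by apply: funext => s; rewrite !FE -natr1; ring.
Qed.

(** The exterior trace, with a rest of the form g_a /\ Y. *)
Lemma rop_down k a S : kform k S ->
  \sum_c eps c (rop a c S) = Wdown a S - k%:R *: epsv (P a) S
    - lo a (\sum_c eps c (int_P c S)).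
Proof.
move=> kS.
under eq_bigr => c _ do rewrite ropE linearD /= linearB linearD linearB /=.
rewrite big_split /= sumrB big_split /= sumrB sum_eps_lo subr0 sum_eps_epsvP subr0.
rewrite -addrA; congr (_ + _).
  apply: eq_bigr => c _; congr (eps c _); apply: eq_bigr => e _.
  by rewrite linear_sum; apply: eq_bigr => f _; rewrite /= linearZ.
rewrite addrC; congr (_ + _).
  transitivity (- \sum_c epsv (P a) (eps c (iot c S))).
    by rewrite -sumrN; apply: eq_bigr => c _; exact: eps_epsv.
  by rewrite -linear_sum (sum_eps_iot kS) linearZ.
transitivity (- \sum_c lo a (eps c (int_P c S))); last by rewrite -linear_sum.
by rewrite -sumrN; apply: eq_bigr => c _; exact: eps_lo.
Qed.

(** The double interior trace vanishes.  This reduces to the symmetry of P and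
    to the fact that C^a_e^cf iota_a iota_c iota_f is totally skew in three
    slots, hence zero by Bianchi; it is what makes the divergence of tau vanish. *)
Lemma rop_up_up k S : kform k.+1 S ->
  \sum_a up a (\sum_c up c (rop a c S)) = 0.
Proof.
move=> kS; have aS := proj1 kS.
have upl a x y (A B D : form) : up a (- (x *: A) - y *: B + D) =
    - (x *: up a A) - y *: up a B + up a D.
  by rewrite linearD linearB linearN /= linearZ /= [up a (y *: _)]linearZ.
under eq_bigr => a _ do rewrite (rop_up _ kS) upl.
rewrite big_split /= sumrB sumrN -!scaler_sumr sum_up_int_P // scaler0 subr0.
rewrite sum_up_iot ?addr0; last first.
  apply: altB; last exact: altZ.
  by apply: alt_sum => c _; apply/alt_epsv/alt_up.
suff -> : \sum_a up a (Wup a S) = 0 by rewrite scaler0 oppr0.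
have -> : \sum_a up a (Wup a S) =
  \sum_c \sum_f (\sum_a \sum_e H a e * C a e c f) *: up c (up f S)
  - \sum_e eps e (\sum_a \sum_c \sum_f C a e c f *: up a (up c (up f S))).
  rewrite [X in _ - X]( _ : _ = \sum_a \sum_e eps e (\sum_c \sum_f C a e c f *: up a (up c (up f S)))); last first.
    by rewrite exchange_big; apply: eq_bigr => e _; rewrite linear_sum.
  rewrite [X in X - _](_ : _ = \sum_a \sum_e \sum_c \sum_f (H a e * C a e c f) *: up c (up f S)); last first.
    under eq_bigr => c _ do under eq_bigr => f _ do rewrite scaler_suml.
    under eq_bigr => c _ do under eq_bigr => f _ do under eq_bigr => a _ do rewrite scaler_suml.
    under eq_bigr => c _ do rewrite exchange_big.
    rewrite exchange_big /=; apply: eq_bigr => a _.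
    under eq_bigr => c _ do rewrite exchange_big.
    by rewrite exchange_big.
  rewrite -sumrB; apply: eq_bigr => a _; rewrite -sumrB.
  rewrite linear_sum; apply: eq_bigr => e _ /=.
  rewrite up_eps; congr (_ - eps e _).
    rewrite scaler_sumr; apply: eq_bigr => c _; rewrite scaler_sumr; apply: eq_bigr => f _.
    by rewrite scalerA.
  rewrite linear_sum; apply: eq_bigr => c _ /=; rewrite linear_sum; apply: eq_bigr => f _ /=.
  by rewrite linearZ.
rewrite big1 ?sub0r => [|c _]; last first.
  rewrite big1 // => f _; rewrite (_ : \sum_a _ = 0) ?scale0r //.
  apply: (@sym_antisym_sum0 R n R^o H (fun a e => C a e c f)) => a b; [exact: symHE|exact: weylC12].
rewrite big1 ?oppr0 // => e _.
set F := fun a c f => up a (up c (up f S)).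
(* F is totally skew, so it only sees the cyclic sum of C over a, c, f. *)
have cycF a c f : F a c f = F c f a.
  rewrite /F up_up; last by apply: alt_up.
  by rewrite (up_up a f aS) linearN /= opprK.
set X := \sum_a _.
have X1 : X = \sum_a \sum_c \sum_f C c e f a *: F a c f.
  rewrite {1}/X [RHS]exchange_big; apply: eq_bigr => c _.
  rewrite [RHS]exchange_big; apply: eq_bigr => f _; apply: eq_bigr => a _.
  by rewrite [in RHS]cycF.
have X2 : X = \sum_a \sum_c \sum_f C f e a c *: F a c f.
  under [RHS]eq_bigr => a _ do rewrite exchange_big.
  rewrite [RHS]exchange_big {1}/X; apply: eq_bigr => f _; apply: eq_bigr => a _; apply: eq_bigr => c _.
  by rewrite -[up f _]/(F f a c) cycF.
suff : 3%:R *: X = 0.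
  by move/eqP; rewrite scaler_eq0 pnatr_eq0 /= => /eqP ->; rewrite linear0.
have -> : 3%:R *: X = X + X + X by apply: funext => s; rewrite !FE; ring.
rewrite {2}X1 {2}X2 /X -!big_split /= big1 // => a _.
rewrite -!big_split /= big1 // => c _; rewrite -!big_split /= big1 // => f _.
rewrite -!scalerDl.
rewrite [X in X *: _](_ : _ = 0) ?scale0r //.
have := weylC_bianchi e a c f; rewrite (weylC12 a e) (weylC12 c e) (weylC12 f e); lra.
Qed.

End Curv.
End Pointwise.

(** * Covariant derivatives of form fields *)

HB.lock Definition pdF (R : realType) (n : nat) (a : 'I_n) (F : 'rV[R]_n -> seq 'I_n -> R^o)
  (x : 'rV[R]_n) : seq 'I_n -> R^o := fun s => pd a (fun y => F y s : R) x.
Arguments pdF {R n} a F x.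

(** The index of differentiation is a fixed coordinate, not a slot of the
    form. *)
HB.lock Definition covD (R : realType) (n : nat) (g : 'rV[R]_n -> 'M[R]_n) (a : 'I_n)
  (F : 'rV[R]_n -> seq 'I_n -> R^o) (x : 'rV[R]_n) : seq 'I_n -> R^o :=
  pdF a F x - gl (fun b d => christoffel g d a b x) (F x).
Arguments covD {R n} g a F x.

Section Fields.
Variables (R : realType) (n : nat) (U : set 'rV[R]_n).
Hypothesis oU : open U.
Local Notation I := 'I_n.
Local Notation form := (seq 'I_n -> R^o).
Local Notation pt := 'rV[R]_n.
Implicit Types (F : pt -> form) (f : pt -> R) (x y : pt).

Definition smoothF F := forall s, smooth_on U (fun y => F y s : R).
Lemma pdFE a F x s : pdF a F x s = pd a (fun y => F y s : R) x.
Proof. by rewrite pdF.unlock. Qed.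

Lemma smoothF_diff F x s : smoothF F -> U x -> differentiable (fun y => F y s : R) x.
Proof. by move=> sF Ux; exact: (smooth_diff (sF s) Ux). Qed.

Lemma smoothF_near F F' : (forall y, U y -> F y = F' y) -> smoothF F -> smoothF F'.
Proof. by move=> E sF s; apply: smooth_near (sF s) => // y Uy; rewrite E. Qed.
Lemma pdF_on a F F' x : (forall y, U y -> F y = F' y) -> U x -> pdF a F x = pdF a F' x.
Proof. by move=> E Ux; apply: funext => s; rewrite !pdFE; apply: (pd_on _ oU Ux) => y Uy; rewrite E. Qed.

Lemma smoothF_pdF a F : smoothF F -> smoothF (pdF a F).
Proof. by move=> sF s; under eq_fun => y do rewrite pdFE; apply: smooth_pd. Qed.
Lemma smoothFZ f F : smooth_on U f -> smoothF F -> smoothF (fun y => f y *: F y).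
Proof. by move=> sf sF s; apply: (smoothM oU sf (sF s)). Qed.
Lemma smoothFB F F' : smoothF F -> smoothF F' -> smoothF (fun y => F y - F' y).
Proof. by move=> sF sF' s; apply: (smoothB oU (sF s) (sF' s)). Qed.
Lemma smoothF_sum (J : Type) (r : seq J) (P : pred J) (F : J -> pt -> form) :
  (forall j, P j -> smoothF (F j)) -> smoothF (fun y => \sum_(j <- r | P j) F j y).
Proof.
move=> H s; under eq_fun => y do rewrite sumFE.
by apply: smooth_sum => // j Pj; apply: H.
Qed.
Lemma smoothF_iot c F : smoothF F -> smoothF (fun y => iot c (F y)).
Proof. by move=> sF s; under eq_fun => y do rewrite iotE; exact: (sF (c :: s)). Qed.
Lemma smoothF_eps c F : smoothF F -> smoothF (fun y => eps c (F y)).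
Proof.
move=> sF s; elim: s F sF => [|b s IH] F sF.
  by under eq_fun => y do rewrite eps_nil; exact: smooth_cst.
under eq_fun => y do rewrite -iotE iot_eps !FE.
apply: smoothB => //; last exact: IH (smoothF_iot b sF).
apply: smoothM => //; exact: smooth_cst.
Qed.
Lemma smoothF_epsv (v : pt -> I -> R) F : (forall b, smooth_on U (v^~ b)) -> smoothF F ->
  smoothF (fun y => epsv (v y) (F y)).
Proof. by move=> sv sF; apply: smoothF_sum => b _; apply/smoothFZ/smoothF_eps. Qed.
Lemma smoothF_iotv (v : pt -> I -> R) F : (forall b, smooth_on U (v^~ b)) -> smoothF F ->
  smoothF (fun y => iotv (v y) (F y)).
Proof. by move=> sv sF; apply: smoothF_sum => b _; apply/smoothFZ/smoothF_iot. Qed.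
Lemma smoothF_gl (A : pt -> I -> I -> R) F : (forall b d, smooth_on U (fun y => A y b d)) ->
  smoothF F -> smoothF (fun y => gl (A y) (F y)).
Proof.
move=> sA sF; apply: smoothF_sum => b _; apply: smoothF_sum => d _.
by apply/smoothFZ/smoothF_eps/smoothF_iot.
Qed.

Lemma pdFD a F F' x : smoothF F -> smoothF F' -> U x ->
  pdF a (fun y => F y + F' y) x = pdF a F x + pdF a F' x.
Proof. by move=> sF sF' Ux; apply: funext => s; rewrite !FE !pdFE; apply: pdD; apply: smoothF_diff. Qed.
Lemma pdFB a F F' x : smoothF F -> smoothF F' -> U x ->
  pdF a (fun y => F y - F' y) x = pdF a F x - pdF a F' x.
Proof. by move=> sF sF' Ux; apply: funext => s; rewrite !FE !pdFE; apply: pdB; apply: smoothF_diff. Qed.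
Lemma pdFZ a f F x : smooth_on U f -> smoothF F -> U x ->
  pdF a (fun y => f y *: F y) x = pd a f x *: F x + f x *: pdF a F x.
Proof.
by move=> sf sF Ux; apply: funext => s; rewrite !FE !pdFE; apply: pdM; [exact: (smooth_diff sf)|apply: smoothF_diff].
Qed.
Lemma pdFc a (r : R) F x : smoothF F -> U x -> pdF a (fun y => r *: F y) x = r *: pdF a F x.
Proof.
move=> sF Ux; rewrite (@pdFZ a (fun=> r)) //; last exact: smooth_cst.
by rewrite pd_cst scale0r add0r.
Qed.
Lemma pdF_sum a (J : Type) (r : seq J) (P : pred J) (F : J -> pt -> form) x :
  (forall j, P j -> smoothF (F j)) -> U x ->
  pdF a (fun y => \sum_(j <- r | P j) F j y) x = \sum_(j <- r | P j) pdF a (F j) x.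
Proof.
move=> H Ux; apply: funext => s; rewrite sumFE pdFE; under [RHS]eq_bigr => j _ do rewrite pdFE.
under eq_fun => y do rewrite sumFE.
by apply: pd_sum => j Pj; apply: smoothF_diff => //; apply: H.
Qed.
Lemma pdF_iot a c F x : pdF a (fun y => iot c (F y)) x = iot c (pdF a F x).
Proof. by apply: funext => s; rewrite iotE !pdFE; under eq_fun => y do rewrite iotE. Qed.
Lemma pdF_eps a c F x : smoothF F -> U x -> pdF a (fun y => eps c (F y)) x = eps c (pdF a F x).
Proof.
move=> sF Ux; apply: funext => s; rewrite pdFE; elim: s F sF => [|b s IH] F sF.
  by rewrite eps_nil; under eq_fun => y do rewrite eps_nil; exact: pd_cst.
under eq_fun => y do rewrite -iotE iot_eps !FE.
rewrite -iotE iot_eps !FE pdB; last 2 first.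
- apply: differentiableM; first exact: differentiable_cst.
  exact: smoothF_diff.
- exact: (smoothF_diff s (smoothF_eps c (smoothF_iot b sF)) Ux).
rewrite IH; last exact: smoothF_iot.
rewrite pdZ; last exact: smoothF_diff.
by rewrite -pdF_iot pdFE.
Qed.
Lemma pdF_epsv a (v : pt -> I -> R) F x : (forall b, smooth_on U (v^~ b)) -> smoothF F -> U x ->
  pdF a (fun y => epsv (v y) (F y)) x =
  epsv (fun b => pd a (v^~ b) x) (F x) + epsv (v x) (pdF a F x).
Proof.
move=> sv sF Ux; rewrite /epsv pdF_sum //; last first.
  by move=> b _; apply/smoothFZ/smoothF_eps.
rewrite -big_split; apply: eq_bigr => b _ /=.
by rewrite pdFZ ?pdF_eps //; exact: smoothF_eps.
Qed.
Lemma pdF_iotv a (v : pt -> I -> R) F x : (forall b, smooth_on U (v^~ b)) -> smoothF F -> U x ->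
  pdF a (fun y => iotv (v y) (F y)) x =
  iotv (fun b => pd a (v^~ b) x) (F x) + iotv (v x) (pdF a F x).
Proof.
move=> sv sF Ux; rewrite /iotv pdF_sum //; last first.
  by move=> b _; apply/smoothFZ/smoothF_iot.
rewrite -big_split; apply: eq_bigr => b _ /=.
by rewrite pdFZ ?pdF_iot //; exact: smoothF_iot.
Qed.
Lemma pdF_gl a (A : pt -> I -> I -> R) F x : (forall b d, smooth_on U (fun y => A y b d)) ->
  smoothF F -> U x ->
  pdF a (fun y => gl (A y) (F y)) x =
  gl (fun b d => pd a (fun y => A y b d) x) (F x) + gl (A x) (pdF a F x).
Proof.
move=> sA sF Ux; rewrite /gl pdF_sum //; last first.
  by move=> b _; apply: smoothF_sum => d _; apply/smoothFZ/smoothF_eps/smoothF_iot.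
rewrite -big_split; apply: eq_bigr => b _ /=.
rewrite pdF_sum //; last by move=> d _; apply/smoothFZ/smoothF_eps/smoothF_iot.
rewrite -big_split; apply: eq_bigr => d _ /=.
rewrite pdFZ ?pdF_eps ?pdF_iot //; first exact: smoothF_iot.
exact/smoothF_eps/smoothF_iot.
Qed.

Lemma kform_pdF k a F x : (forall y, U y -> kform k (F y)) -> smoothF F -> U x -> kform k (pdF a F x).
Proof.
move=> kF sF Ux; split=> [s b c t|s hs].
  rewrite !pdFE -pdN; last exact: smoothF_diff.
  by apply: (pd_on _ oU Ux) => y Uy; exact: (proj1 (kF y Uy)).
rewrite pdFE -[RHS](@pd_cst R n a 0 x).
by apply: (pd_on _ oU Ux) => y Uy; exact: (proj2 (kF y Uy)).
Qed.

Lemma pdFC a b F x : smoothF F -> U x -> pdF a (pdF b F) x = pdF b (pdF a F) x.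
Proof. by move=> sF Ux; apply: funext => s; rewrite !pdFE; under eq_fun => y do rewrite pdFE; under [in RHS]eq_fun => y do rewrite pdFE; exact: (pdC _ _ oU (sF s) Ux). Qed.

(** The curvature of a connection on forms, A and B being its coefficients in
    the directions a and c: the second derivatives and the mixed terms cancel, leaving the derivatives of the coefficients and the
    commutator of the derivations. *)
Lemma connection_commutator (A B : pt -> I -> I -> R) a c F x :
  (forall b d, smooth_on U (fun y => A y b d)) ->
  (forall b d, smooth_on U (fun y => B y b d)) ->
  smoothF F -> U x -> alt (F x) ->
  pdF a (fun y => pdF c F y - gl (B y) (F y)) x - gl (A x) (pdF c F x - gl (B x) (F x))
  - (pdF c (fun y => pdF a F y - gl (A y) (F y)) x - gl (B x) (pdF a F x - gl (A x) (F x)))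
  = - gl (fun b h => pd a (fun y => B y b h) x - pd c (fun y => A y b h) x
        + \sum_d (B x b d * A x d h - A x b d * B x d h)) (F x).
Proof.
move=> sA sB sF Ux aF.
rewrite (pdFB _ (smoothF_pdF c sF) (smoothF_gl sB sF) Ux).
rewrite (pdFB _ (smoothF_pdF a sF) (smoothF_gl sA sF) Ux).
rewrite (pdF_gl a sB sF Ux) (pdF_gl c sA sF Ux) (@pdFC a c F x sF Ux).
rewrite [gl _ (_ - _)]linearB [gl (B x) (_ - _)]linearB /= (gl_gl (A x) (B x) aF).
have -> : gl (fun b h => pd a (fun y => B y b h) x - pd c (fun y => A y b h) x
        + \sum_d (B x b d * A x d h - A x b d * B x d h)) (F x) =
  gl (fun b h => pd a (fun y => B y b h) x) (F x) - gl (fun b h => pd c (fun y => A y b h) x) (F x)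
  + (gl (fun b h => \sum_d B x b d * A x d h) (F x) - gl (fun b h => \sum_d A x b d * B x d h) (F x)).
  rewrite -!glN -!glD; congr (gl _ _); apply: funext => b; apply: funext => h.
  by rewrite sumrB.
by apply: funext => s; rewrite !FE; ring.
Qed.

End Fields.

(** The octahedron argument: the sum of the Bianchi identities for the four
    cyclic rotations of (a, b, c, d). *)
Lemma pair_symmetry (R : realType) (T : Type) (r : T -> T -> T -> T -> R) a b c d :
  (forall a b c d, r a b c d = - r b a c d) -> (forall a b c d, r a b c d = - r a b d c) ->
  (forall a b c d, r a b c d + r b d c a + r d a c b = 0) ->
  r a b c d = r c d a b.
Proof.
move=> A1 A2 B.
have S p q s t : r p q s t + r q s p t + r s p q t = 0.
  have := B p q t s; rewrite (A2 p q t s) (A2 q s t p) (A2 s p t q); lra.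
have := S a b c d; have := S b c d a; have := S c d a b; have := S d a b c.
rewrite (A1 c a b d) (A2 b c d a) (A2 c d b a) (A1 d b c a) (A2 b d c a).
rewrite (A1 d a c b) (A2 a d c b) (A2 a c d b) (A1 d a b c) (A2 a b d c).
lra.
Qed.

Section Lowered.
Variables (R : realType) (n : nat) (g : 'rV[R]_n -> 'M[R]_n).
Implicit Types (a b c : 'I_n) (x : 'rV[R]_n).

(** Christoffel symbols with the upper index lowered (to the first slot);
    unlike the Gammas they are linear in the derivatives of the metric. *)
Definition chrL_def c a b x : R :=
  2^-1 * (pd a (fun y => g y b c) x + pd b (fun y => g y a c) x - pd c (fun y => g y a b) x).
End Lowered.
HB.lock Definition chrL := chrL_def.
Arguments chrL {R n} g c a b x.

HB.lock Definition dchrL (R : realType) (n : nat) (g : 'rV[R]_n -> 'M[R]_n) p q r s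
  (x : 'rV[R]_n) : R := pd p (chrL g q r s) x.
Arguments dchrL {R n} g p q r s x.
HB.lock Definition christoffel_square (R : realType) (n : nat) (g : 'rV[R]_n -> 'M[R]_n) a c b d
  (x : 'rV[R]_n) : R := \sum_e chrL g e a c x * christoffel g e b d x.
Arguments christoffel_square {R n} g a c b d x.

Section Metric.
Variables (R : realType) (n : nat) (U : set 'rV[R]_n) (g : 'rV[R]_n -> 'M[R]_n).
Hypothesis oU : open U.
Local Notation I := 'I_n.
Local Notation form := (seq 'I_n -> R^o).
Local Notation pt := 'rV[R]_n.
Implicit Types (F : pt -> form) (f : pt -> R) (x y : pt).

Definition local_metric := [/\ forall a b, smooth_on U (fun y => g y a b),
  forall x, U x -> (g x)^T = g x & forall x, U x -> g x \in unitmx].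

Hypothesis mg : local_metric.
Let sg : forall a b, smooth_on U (fun y => g y a b) := let: And3 h _ _ := mg in h.
Let symg : forall x, U x -> (g x)^T = g x := let: And3 _ h _ := mg in h.
Let ug : forall x, U x -> g x \in unitmx := let: And3 _ _ h := mg in h.
Local Notation Gam := (christoffel g).

Lemma gE x a b : U x -> g x a b = g x b a.
Proof. by move=> /symg/symGE. Qed.
Lemma pdgE c x a b : U x -> pd c (fun y => g y a b) x = pd c (fun y => g y b a) x.
Proof. by move=> Ux; apply: (pd_on _ oU Ux) => y Uy; exact: gE. Qed.

Lemma smooth_inv a b : smooth_on U (fun y => invmx (g y) a b).
Proof. exact: smooth_invmx. Qed.
Lemma smooth_christoffel c a b : smooth_on U (Gam c a b).
Proof.
apply: smoothM => //; first exact: smooth_cst.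
apply: smooth_sum => // d _; apply: smoothM => //; first exact: smooth_inv.
apply: smoothB => //; last exact: smooth_pd.
by apply: smoothD => //; exact: smooth_pd.
Qed.
Lemma christoffelC c a b x : U x -> Gam c a b x = Gam c b a x.
Proof.
move=> Ux; rewrite /christoffel; congr (_ * _); apply: eq_bigr => d _.
by rewrite (pdgE d a b Ux); congr (_ * _); ring.
Qed.

Lemma chrLE c a b x : chrL g c a b x =
  2^-1 * (pd a (fun y => g y b c) x + pd b (fun y => g y a c) x - pd c (fun y => g y a b) x).
Proof. by rewrite chrL.unlock. Qed.

Lemma smooth_chrL c a b : smooth_on U (chrL g c a b).
Proof.
apply: (@smooth_near _ _ _ _ _ oU (fun y _ => esym (chrLE c a b y))).
apply: smoothM => //; first exact: smooth_cst.
by apply: smoothB; [|apply: smoothD|]; rewrite //; apply: smooth_pd.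
Qed.

Lemma chrLC c a b x : U x -> chrL g c a b x = chrL g c b a x.
Proof. by move=> Ux; rewrite !chrLE (pdgE c a b Ux); congr (_ * _); ring. Qed.

Lemma lower_christoffel c a b x : U x -> \sum_d g x c d * Gam d a b x = chrL g c a b x.
Proof.
move=> Ux; rewrite /christoffel chrLE.
under eq_bigr => d _ do rewrite mulrCA mulr_sumr.
rewrite -mulr_sumr exchange_big /=; congr (_ * _).
under eq_bigr => e _ do (under eq_bigr => d _ do rewrite mulrA; rewrite -mulr_suml GHE //; last exact: ug).
rewrite (bigD1 c) //= eqxx mul1r big1 ?addr0 // => e /negbTE.
by rewrite eq_sym => ->; rewrite mul0r.
Qed.

(** Metric compatibility of the connection. *)
Lemma pd_metric a c b x : U x -> pd a (fun y => g y c b) x = chrL g c a b x + chrL g b a c x.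
Proof.
move=> Ux; rewrite !chrLE (pdgE a b c Ux) (pdgE b a c Ux) (pdgE c a b Ux) (pdgE b c a Ux); lra.
Qed.

Lemma covDE a F x : covD g a F x = pdF a F x - gl (fun b d => Gam d a b x) (F x).
Proof. by rewrite covD.unlock. Qed.

Lemma smoothF_covD a F : smoothF U F -> smoothF U (covD g a F).
Proof.
move=> sF; apply: (@smoothF_near _ _ _ oU (fun y => pdF a F y - gl (fun b d => Gam d a b y) (F y))) => [y _|]; first by rewrite covDE.
apply: smoothFB => //; first exact: smoothF_pdF.
by apply: smoothF_gl => // b d; exact: smooth_christoffel.
Qed.
Lemma kform_covD k a F x : (forall y, U y -> kform k (F y)) -> smoothF U F -> U x ->
  kform k (covD g a F x).
Proof. by move=> kF sF Ux; rewrite covDE; apply: kformB; [exact: (kform_pdF oU _ kF sF Ux)|apply/kform_gl/kF]. Qed.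
Lemma covD_on a F F' x : (forall y, U y -> F y = F' y) -> U x -> covD g a F x = covD g a F' x.
Proof. by move=> E Ux; rewrite !covDE (pdF_on oU _ E Ux) E. Qed.
Lemma covDD a F F' x : smoothF U F -> smoothF U F' -> U x ->
  covD g a (fun y => F y + F' y) x = covD g a F x + covD g a F' x.
Proof. by move=> sF sF' Ux; rewrite !covDE (pdFD _ sF sF' Ux) [gl _ _]linearD opprD addrACA. Qed.
Lemma covDB a F F' x : smoothF U F -> smoothF U F' -> U x ->
  covD g a (fun y => F y - F' y) x = covD g a F x - covD g a F' x.
Proof. by move=> sF sF' Ux; rewrite !covDE (pdFB _ sF sF' Ux) [gl _ _]linearB /=; apply: funext => s; rewrite !FE; ring. Qed.
Lemma covDZ a f F x : smooth_on U f -> smoothF U F -> U x ->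
  covD g a (fun y => f y *: F y) x = pd a f x *: F x + f x *: covD g a F x.
Proof. by move=> sf sF Ux; rewrite !covDE (pdFZ _ sf sF Ux) [gl _ _]linearZ /= -addrA scalerBr. Qed.
Lemma covDc a (r : R) F x : smoothF U F -> U x -> covD g a (fun y => r *: F y) x = r *: covD g a F x.
Proof. by move=> sF Ux; rewrite !covDE (pdFc _ _ sF Ux) [gl _ _]linearZ /= scalerBr. Qed.
Lemma covD_iot a c F x : alt (F x) ->
  covD g a (fun y => iot c (F y)) x = iot c (covD g a F x) + iotv (fun d => Gam d a c x) (F x).
Proof.
move=> aF; rewrite !covDE pdF_iot linearB /= iot_gl // opprD addrA.
by rewrite -[_ + iotv _ _ in RHS]addrA; apply: funext => s; rewrite !FE; ring.
Qed.
Lemma covD_epsv a (v : pt -> I -> R) F x : (forall b, smooth_on U (v^~ b)) -> smoothF U F -> U x ->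
  covD g a (fun y => epsv (v y) (F y)) x =
  epsv (fun b => pd a (v^~ b) x - \sum_d Gam d a b x * v x d) (F x) + epsv (v x) (covD g a F x).
Proof.
move=> sv sF Ux; rewrite !covDE (pdF_epsv oU) // gl_epsv linearB /= opprD addrACA; congr (_ + _).
rewrite /epsv -sumrB; apply: eq_bigr => b _; by rewrite scalerBl.
Qed.
Lemma covD_iotv a (w : pt -> I -> R) F x : (forall b, smooth_on U (w^~ b)) -> smoothF U F -> U x ->
  alt (F x) ->
  covD g a (fun y => iotv (w y) (F y)) x =
  iotv (fun d => pd a (w^~ d) x + \sum_c Gam d a c x * w x c) (F x) + iotv (w x) (covD g a F x).
Proof.
move=> sw sF Ux aF; rewrite !covDE (pdF_iotv oU) // linearB /=.
have -> : gl (fun b d => Gam d a b x) (iotv (w x) (F x)) =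
    iotv (w x) (gl (fun b d => Gam d a b x) (F x)) - iotv (fun d => \sum_c Gam d a c x * w x c) (F x).
  rewrite {1 2}/iotv linear_sum.
  under [in RHS]eq_bigr => c _ do rewrite iot_gl // scalerDr.
  rewrite big_split /= addrAC -[LHS]add0r; congr (_ + _); last by apply: eq_bigr => c _; rewrite linearZ.
  apply/esym/eqP; rewrite subr_eq0; apply/eqP.
  rewrite /iotv; under eq_bigr => c _ do rewrite scaler_sumr.
  rewrite exchange_big /=; apply: eq_bigr => d _; rewrite scaler_suml.
  by apply: eq_bigr => c _; rewrite scalerA mulrC.
have -> : iotv (fun d => pd a (w^~ d) x + \sum_c Gam d a c x * w x c) (F x) =
   iotv (fun d => pd a (w^~ d) x) (F x) + iotv (fun d => \sum_c Gam d a c x * w x c) (F x).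
  by rewrite /iotv -big_split; apply: eq_bigr => d _; rewrite scalerDl.
by apply: funext => s; rewrite !FE; ring.
Qed.

(** g_c is parallel: the last term accounts for the index c, which is inert
    for [covD]. *)
Lemma covD_lo a c F x : smoothF U F -> U x ->
  covD g a (fun y => lo (g y) c (F y)) x =
  lo (g x) c (covD g a F x) + \sum_d Gam d a c x *: lo (g x) d (F x).
Proof.
move=> sF Ux; rewrite /lo covD_epsv // addrC; congr (_ + _).
rewrite /epsv; under [RHS]eq_bigr => d _ do rewrite scaler_sumr.
rewrite [RHS]exchange_big /=; apply: eq_bigr => b _.
under [RHS]eq_bigr => d _ do rewrite scalerA.
rewrite -scaler_suml; congr (_ *: _).
rewrite pd_metric // -[chrL g c _ _ _]lower_christoffel // -[chrL g b _ _ _]lower_christoffel //.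
rewrite addrAC; under [X in _ - X]eq_bigr => d _ do rewrite mulrC.
rewrite subrr add0r; apply: eq_bigr => d _; by rewrite mulrC gE.
Qed.

(** [connection_commutator] for the Levi-Civita connection. *)
Lemma ricci_identity a c F x : smoothF U F -> U x -> (forall y, U y -> alt (F y)) ->
  covD g a (covD g c F) x - covD g c (covD g a F) x = - gl (fun b d => curvature g x a c d b) (F x).
Proof.
move=> sF Ux aF.
have sGam a' b d : smooth_on U (fun y => Gam d a' b y) by exact: smooth_christoffel.
have E a' c' : covD g a' (covD g c' F) x =
    pdF a' (fun y => pdF c' F y - gl (fun b d => Gam d c' b y) (F y)) x
    - gl (fun b d => Gam d a' b x) (pdF c' F x - gl (fun b d => Gam d c' b x) (F x)).
  rewrite covDE covDE; congr (_ - _); apply: (pdF_on oU) => // y _; exact: covDE.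
rewrite (E a c) (E c a) (connection_commutator oU a c (sGam a) (sGam c) sF Ux (aF x Ux)).
have -> // : (fun b d => curvature g x a c d b) =
    (fun b h => pd a (fun y => Gam h c b y) x - pd c (fun y => Gam h a b y) x +
       \sum_d (Gam d c b x * Gam h a d x - Gam d a b x * Gam h c d x)).
apply: funext => b; apply: funext => d; rewrite /curvature; congr (_ + _).
by apply: eq_bigr => e _; rewrite [X in _ = X - _]mulrC [X in _ = _ - X]mulrC.
Qed.

Lemma dchrLE p q r s x : dchrL g p q r s x = pd p (chrL g q r s) x.
Proof. by rewrite dchrL.unlock. Qed.
Lemma christoffel_squareE a c b d x : christoffel_square g a c b d x = \sum_e chrL g e a c x * Gam e b d x.
Proof. by rewrite christoffel_square.unlock. Qed.

Lemma christoffel_squareC a c b d x : U x -> christoffel_square g a c b d x = christoffel_square g b d a c x.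
Proof.
move=> Ux; rewrite !christoffel_squareE.
under eq_bigr => e _ do rewrite -lower_christoffel // mulr_suml.
under [RHS]eq_bigr => e _ do rewrite -lower_christoffel // mulr_suml.
rewrite [RHS]exchange_big; apply: eq_bigr => e _; apply: eq_bigr => f _ /=.
by rewrite (gE f e) //; ring.
Qed.

(** With the index lowered, the derivatives of the metric coming from the
    lowering combine with the quadratic terms, and the symmetries of the Riemann
    tensor become visible. *)
Lemma riemannE a b c d x : U x -> riemann g x a b c d =
  dchrL g a c b d x - dchrL g b c a d x - christoffel_square g a c b d x + christoffel_square g b c a d x.
Proof.
move=> Ux; rewrite !dchrLE !christoffel_squareE.
have E a' b' : \sum_e g x c e * pd a' (Gam e b' d) x =
    pd a' (chrL g c b' d) x - \sum_e (chrL g c a' e x + chrL g e a' c x) * Gam e b' d x.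
  have dG e : differentiable (Gam e b' d) x by apply: (smooth_diff (smooth_christoffel e b' d)).
  have dg e : differentiable (fun y => g y c e) x by apply: (smooth_diff (sg c e)).
  rewrite -(@pd_on _ _ a' (fun y => \sum_e g y c e * Gam e b' d y) _ U x oU Ux); last first.
    by move=> y Uy; exact: lower_christoffel.
  rewrite pd_sum => [|e _]; last exact: differentiableM.
  rewrite -sumrB; apply: eq_bigr => e _.
  by rewrite pdM // pd_metric //; ring.
transitivity
  (\sum_e g x c e * pd a (Gam e b d) x - \sum_e g x c e * pd b (Gam e a d) x +
   \sum_e \sum_f g x c e * (Gam e a f x * Gam f b d x - Gam e b f x * Gam f a d x)).
  rewrite -sumrB -big_split; apply: eq_bigr => e _ /=.
  by rewrite /curvature mulrDr mulrBr mulr_sumr.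
transitivity
  (pd a (chrL g c b d) x - \sum_e (chrL g c a e x + chrL g e a c x) * Gam e b d x -
   (pd b (chrL g c a d) x - \sum_e (chrL g c b e x + chrL g e b c x) * Gam e a d x) +
   \sum_f (chrL g c a f x * Gam f b d x - chrL g c b f x * Gam f a d x)).
  congr (_ - _ + _); [exact: E|exact: E|rewrite exchange_big].
  apply: eq_bigr => f _; rewrite -!lower_christoffel // !mulr_suml -sumrB.
  by apply: eq_bigr => e _; rewrite mulrBr !mulrA.
have D (L L' G : I -> R) : \sum_e (L e + L' e) * G e = \sum_e L e * G e + \sum_e L' e * G e.
  by rewrite -big_split; apply: eq_bigr => e _; rewrite mulrDl.
rewrite (D (fun e => chrL g c a e x)) (D (fun e => chrL g c b e x)) sumrB.
move: (pd _ _ _) (pd _ _ _) => u1 u2.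
move: (bigop _ _ _) (bigop _ _ _) (bigop _ _ _) (bigop _ _ _) => u3 u4 u5 u6.
ring.
Qed.

Lemma riemann12 a b c d x : U x -> riemann g x a b c d = - riemann g x b a c d.
Proof.
move=> Ux; rewrite (riemannE a b c d Ux) (riemannE b a c d Ux).
move: (dchrL _ _ _ _ _ _) (dchrL _ _ _ _ _ _) (christoffel_square _ _ _ _ _ _) (christoffel_square _ _ _ _ _ _) => u1 u2 u3 u4.
ring. Qed.

Lemma riemann34 a b c d x : U x -> riemann g x a b c d = - riemann g x a b d c.
Proof.
move=> Ux; rewrite (riemannE a b c d Ux) (riemannE a b d c Ux).
have E a' b' : dchrL g a' c b' d x + dchrL g a' d b' c x = pd a' (pd b' (fun y => g y c d)) x.
  rewrite !dchrLE -pdD; try by apply: (smooth_diff (smooth_chrL _ _ _)).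
  by apply: (pd_on _ oU Ux) => y Uy; rewrite pd_metric.
have e : dchrL g a c b d x + dchrL g a d b c x = dchrL g b c a d x + dchrL g b d a c x.
  exact: (etrans (E a b) (etrans (pdC a b oU (sg c d) Ux) (esym (E b a)))).
rewrite (christoffel_squareC a c b d Ux) (christoffel_squareC b c a d Ux); move: e; lra.
Qed.

Lemma riemann_bianchi a b c d x : U x ->
  riemann g x a b c d + riemann g x b d c a + riemann g x d a c b = 0.
Proof.
move=> Ux; rewrite (riemannE a b c d Ux) (riemannE b d c a Ux) (riemannE d a c b Ux).
have E p q r s : dchrL g p q r s x = dchrL g p q s r x.
  by rewrite !dchrLE; apply: (pd_on _ oU Ux) => y Uy; exact: chrLC.
have EQ p q r s : christoffel_square g p q r s x = christoffel_square g p q s r x.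
  by rewrite !christoffel_squareE; apply: eq_bigr => e _; rewrite (christoffelC _ r s Ux).
rewrite (E a c d b) (E b c d a) (E d c b a).
rewrite (EQ a c d b) (EQ b c d a) (EQ d c b a); lra.
Qed.

End Metric.

(** * Symmetries and trace of the Weyl tensor *)

Section AbstractRiemann.
Variables (R : realType) (n : nat) (G : 'M[R]_n).
Local Notation I := 'I_n.
Local Notation H := (invmx G).
Hypothesis symG : G^T = G.
Hypothesis unitG : G \in unitmx.
Variable r : I -> I -> I -> I -> R.
Hypothesis r12 : forall a b c d, r a b c d = - r b a c d.
Hypothesis r34 : forall a b c d, r a b c d = - r a b d c.
Hypothesis rB : forall a b c d, r a b c d + r b d c a + r d a c b = 0.

(** The cyclic identity in the last three slots follows from the one in the
    slots 1, 2, 4 by pair symmetry. *)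
Lemma bianchi_last a b c d : r a b c d + r a c d b + r a d b c = 0.
Proof.
have rp p q s t : r p q s t = r s t p q by apply: pair_symmetry.
rewrite (rp a b c d) (rp a c d b) (rp a d b c).
have := rB c d a b; rewrite (r34 d b a c) (r34 b c a d) (r34 c d a b).
rewrite (r34 c d b a) (r34 d b c a) (r34 b c d a); lra.
Qed.

Definition ric b d : R := \sum_a \sum_e H a e * r a b e d.
Lemma ricC b d : ric b d = ric d b.
Proof.
rewrite /ric exchange_big; apply: eq_bigr => a _; apply: eq_bigr => e _ /=.
rewrite (symHE symG); congr (_ * _); exact: pair_symmetry.
Qed.

Hypothesis n3 : (3 <= n)%N.
Variable P : I -> I -> R.
Let Sc := \sum_b \sum_d H b d * ric b d.
Hypothesis PE : forall a b, P a b = (n%:R - 2)^-1 * (ric a b - Sc / (2 * (n%:R - 1)) * G a b).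
Let C a b c d := r a b c d - (G c a * P b d - G c b * P a d) - (G d b * P a c - G d a * P b c).

Lemma P_symmetric a b : P a b = P b a.
Proof. by rewrite !PE ricC (symGE symG a b). Qed.
Lemma weylC12 a b c d : C a b c d = - C b a c d.
Proof. by rewrite /C r12; ring. Qed.
Lemma weylC34 a b c d : C a b c d = - C a b d c.
Proof. by rewrite /C r34; ring. Qed.
Lemma weylC_bianchi a b c d : C a b c d + C a c d b + C a d b c = 0.
Proof.
have := bianchi_last a b c d; rewrite /C.
rewrite (symGE symG c b) (symGE symG d b) (symGE symG d c).
rewrite (symGE symG b a) (symGE symG c a) (symGE symG d a).
rewrite (P_symmetric c b) (P_symmetric d b) (P_symmetric d c) => e.
set u := r a b c d in e *; set v := r a c d b in e *; set w := r a d b c in e *.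
have -> : u = - v - w by lra.
ring.
Qed.

Lemma n1_neq0 : n%:R - 1 != 0 :> R.
Proof. by rewrite subr_eq0 -[1]/(1%:R) eqr_nat; case: n n3 => [|[]]. Qed.
Lemma n2_neq0 : n%:R - 2 != 0 :> R.
Proof. by rewrite subr_eq0 eqr_nat; case: n n3 => [|[|[]]]. Qed.

Lemma sum_delta_r (F : I -> R) a : \sum_c (c == a)%:R * F c = F a.
Proof.
rewrite (bigD1 a) //= eqxx mul1r big1 ?addr0 // => c /negbTE ->.
by rewrite mul0r.
Qed.

Lemma traceG : \sum_b \sum_d H b d * G b d = n%:R.
Proof.
under eq_bigr => b _ do under eq_bigr => d _ do rewrite (symGE symG).
under eq_bigr => b _ do rewrite (HGE unitG) eqxx.
by rewrite sumr_const card_ord.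
Qed.

Lemma traceP : \sum_b \sum_d H b d * P b d = Sc / (2 * (n%:R - 1)).
Proof.
have -> : \sum_b \sum_d H b d * P b d =
   (n%:R - 2)^-1 * (Sc - Sc / (2 * (n%:R - 1)) * \sum_b \sum_d H b d * G b d).
  rewrite /Sc mulrBr mulrA !mulr_sumr -sumrB; apply: eq_bigr => b _.
  rewrite !mulr_sumr -sumrB; apply: eq_bigr => d _; rewrite PE /Sc; ring.
rewrite traceG; field.
by rewrite n1_neq0 n2_neq0.
Qed.

(** The normalisation of P is the one for which all traces of C vanish. *)
Lemma weylC_trace a f : \sum_c \sum_e H c e * C a c e f = 0.
Proof.
have -> : \sum_c \sum_e H c e * C a c e f =
  - ric a f - (P a f - n%:R * P a f) - (P a f - G f a * \sum_c \sum_e H c e * P c e).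
  have E1 : \sum_c \sum_e H c e * r a c e f = - ric a f.
    rewrite /ric -sumrN; apply: eq_bigr => c _; rewrite -sumrN; apply: eq_bigr => e _.
    by rewrite r12 mulrN.
  have E2 : \sum_c \sum_e H c e * (G e a * P c f) = P a f.
    rewrite -[RHS](sum_delta_r (fun c => P c f)); apply: eq_bigr => c _.
    by rewrite -(HGE unitG) mulr_suml; apply: eq_bigr => e _; rewrite mulrA.
  have E3 : \sum_c \sum_e H c e * (G e c * P a f) = n%:R * P a f.
    rewrite -traceG mulr_suml; apply: eq_bigr => c _; rewrite mulr_suml.
    by apply: eq_bigr => e _; rewrite (symGE symG e c) mulrA.
  have E4 : \sum_c \sum_e H c e * (G f c * P a e) = P a f.
    rewrite exchange_big -[RHS](sum_delta_r (fun c => P a c)); apply: eq_bigr => e _ /=.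
    rewrite -(HGE unitG) mulr_suml; apply: eq_bigr => c _.
    by rewrite (symHE symG c e) (symGE symG f c) mulrA.
  have E5 : \sum_c \sum_e H c e * (G f a * P c e) = G f a * \sum_c \sum_e H c e * P c e.
    rewrite mulr_sumr; apply: eq_bigr => c _; rewrite mulr_sumr.
    by apply: eq_bigr => e _; rewrite mulrCA.
  rewrite -E1 -E3 -E5 -[X in _ - (X - _) - _]E2 -[X in _ - _ - (X - _)]E4.
  rewrite -!sumrB; apply: eq_bigr => c _; rewrite -!sumrB.
  by apply: eq_bigr => e _; rewrite /C; ring.
rewrite traceP PE (symGE symG f a); field.
by rewrite n1_neq0 n2_neq0.
Qed.
End AbstractRiemann.

(** * Prolongation of the conformal Killing equation *)

Section Hook.
Variables (R : realType) (n : nat) (G : 'M[R]_n).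
Local Notation I := 'I_n.
Local Notation form := (seq 'I_n -> R^o).
Hypothesis symG : G^T = G.
Hypothesis unitG : G \in unitmx.

(** [hook_part] in operator form: subtract the fully skew part and the pure
    trace part (see [lf_hook_part]). *)
Definition hookF m (T : I -> form) c : form :=
  T c - m.+1%:R^-1 *: iot c (\sum_b eps b (T b))
  - (n%:R - m%:R + 1)^-1 *: lo G c (\sum_p up G p (T p)).

Lemma hookF_lin m (x : R) T S c :
  hookF m (fun a => x *: T a + S a) c = x *: hookF m T c + hookF m S c.
Proof.
have E1 : \sum_b eps b (x *: T b + S b) = x *: (\sum_b eps b (T b)) + \sum_b eps b (S b).
  by rewrite scaler_sumr -big_split; apply: eq_bigr => b _; rewrite eps_linear.
have E2 : \sum_b up G b (x *: T b + S b) = x *: (\sum_b up G b (T b)) + \sum_b up G b (S b).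
  by rewrite scaler_sumr -big_split; apply: eq_bigr => b _; rewrite /up iotv_linear.
rewrite /hookF E1 E2 iot_linear [lo G c (_ + _)]epsv_linear.
by apply: funext => s; rewrite !FE /lo; ring.
Qed.

Lemma hookF_iot m X c : kform m.+1 X -> hookF m (fun a => iot a X) c = 0.
Proof.
move=> kX; rewrite /hookF (sum_eps_iot kX) (sum_up_iot symG (proj1 kX)) linear0 scaler0 subr0.
by rewrite [iot c (_ *: _)]linearZ /= scalerA mulVf ?scale1r ?subrr // pnatr_eq0.
Qed.

Lemma hookF_lo m Y c : (m < n)%N -> kform m Y -> hookF m.+1 (fun a => lo G a Y) c = 0.
Proof.
move=> mn kY; rewrite /hookF sum_eps_lo // linear0 scaler0 subr0 (sum_up_lo symG unitG kY).
have nm : n%:R - m%:R != 0 :> R by rewrite subr_eq0 eqr_nat gtn_eqF.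
rewrite [lo G c (_ *: _)]linearZ /= scalerA -natr1.
have -> : n%:R - (m%:R + 1) + 1 = n%:R - m%:R :> R by ring.
by rewrite mulVf // scale1r subrr.
Qed.

(** The two complementary summands are the tensors iota_a X and g_a /\ Y, and
    the coefficients in [hookF] are the ones that annihilate them. *)
Lemma hookF_triv m X Y c : (m < n)%N -> kform m.+2 X -> kform m Y ->
  hookF m.+1 (fun a => iot a X + lo G a Y) c = 0.
Proof.
move=> mn kX kY.
have -> : (fun a => iot a X + lo G a Y) = (fun a => 1 *: iot a X + lo G a Y).
  by apply: funext => a; rewrite scale1r.
by rewrite hookF_lin (hookF_iot _ kX) (hookF_lo _ mn kY) scaler0 addr0.
Qed.

(** Vanishing of the projection exhibits the two forms in the conformal Killing
    equation explicitly, as multiples of the exterior derivative and of the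
    divergence. *)
Lemma hookF_eq0 m T c : hookF m T c = 0 ->
  T c = iot c (m.+1%:R^-1 *: \sum_b eps b (T b))
      + lo G c ((n%:R - m%:R + 1)^-1 *: \sum_p up G p (T p)).
Proof.
move=> /eqP; rewrite /hookF -addrA -opprD subr_eq0 => /eqP {1}->.
by rewrite linearZ /= [lo G c (_ *: _)]linearZ.
Qed.

End Hook.

Lemma lf_hook_part (R : realType) n (g : 'M[R]_n) m (T : 'I_n -> m.-tuple 'I_n -> R) c :
  (forall b, kform m (lf (T b))) ->
  lf (hook_part g T c) = hookF g m (fun b => lf (T b)) c.
Proof. by move=> kT; rewrite /hook_part lfB lfB lf_skew_part // lf_trace_part. Qed.

Section Local.
Variables (R : realType) (n : nat) (U : set 'rV[R]_n) (g : 'rV[R]_n -> 'M[R]_n).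
Hypothesis oU : open U.
Hypothesis n3 : (3 <= n)%N.
Local Notation I := 'I_n.
Local Notation form := (seq 'I_n -> R^o).
Local Notation pt := 'rV[R]_n.
Implicit Types (F : pt -> form) (x y : pt).
Hypothesis mg : local_metric U g.
Let sg : forall a b, smooth_on U (fun y => g y a b) := let: And3 h _ _ := mg in h.
Let symg : forall x, U x -> (g x)^T = g x := let: And3 _ h _ := mg in h.
Let ug : forall x, U x -> g x \in unitmx := let: And3 _ _ h := mg in h.
Local Notation Gam := (christoffel g).

Section AtPoint.
Variables (x : pt).
Hypothesis Ux : U x.
Let r12 := fun a b c d => riemann12 oU mg a b c d Ux.
Let r34 := fun a b c d => riemann34 oU mg a b c d Ux.
Let rB := fun a b c d => riemann_bianchi oU mg a b c d Ux.

Lemma curvatureE a b c d : curvature g x a b c d = \sum_e invmx (g x) c e * riemann g x a b e d.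
Proof.
rewrite /riemann; under eq_bigr => e _ do rewrite mulr_sumr.
rewrite exchange_big /=.
under eq_bigr => f _ do (under eq_bigr => e _ do rewrite mulrA; rewrite -mulr_suml (HGE (ug Ux))).
rewrite (bigD1 c) //= eqxx mul1r big1 ?addr0 // => f /negbTE.
by rewrite eq_sym => ->; rewrite mul0r.
Qed.

Lemma ricciE b d : ricci g x b d = ric (g x) (riemann g x) b d.
Proof. by apply: eq_bigr => a _; rewrite curvatureE. Qed.

Lemma schoutenE a b : schouten g x a b = (n%:R - 2)^-1 *
  (ric (g x) (riemann g x) a b
   - (\sum_b \sum_d invmx (g x) b d * ric (g x) (riemann g x) b d) / (2 * (n%:R - 1)) * g x a b).
Proof.
rewrite /schouten ricciE /scalar_curvature; congr (_ * (_ - _ / _ * _)).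
by apply: eq_bigr => c _; apply: eq_bigr => d _; rewrite ricciE.
Qed.

Lemma schoutenC a b : schouten g x a b = schouten g x b a.
Proof. exact: (P_symmetric (symg Ux) r12 r34 rB schoutenE). Qed.
Lemma weyl12 a b c d : weyl g x a b c d = - weyl g x b a c d.
Proof. exact: (@weylC12 R n (g x) (riemann g x) r12 (schouten g x) a b c d). Qed.
Lemma weyl34 a b c d : weyl g x a b c d = - weyl g x a b d c.
Proof. exact: (@weylC34 R n (g x) (riemann g x) r34 (schouten g x) a b c d). Qed.
Lemma weyl_bianchi a b c d : weyl g x a b c d + weyl g x a c d b + weyl g x a d b c = 0.
Proof. exact: (weylC_bianchi (symg Ux) r12 r34 rB schoutenE). Qed.
Lemma weyl_trace a f : \sum_c \sum_e invmx (g x) c e * weyl g x a c e f = 0.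
Proof. exact: (weylC_trace (symg Ux) (ug Ux) r12 n3 schoutenE). Qed.

Definition int_schouten a T : form := int_P (g x) (schouten g x) a T.
Definition weyl_int a T : form := \sum_e eps e (\sum_c \sum_f weyl g x a e c f *: up (g x) c (up (g x) f T)).
Definition weyl_ext a T : form := \sum_c eps c (\sum_e eps e (\sum_f weyl g x a c e f *: up (g x) f T)).

Lemma commutator_rop a c F : smoothF U F -> (forall y, U y -> alt (F y)) ->
  covD g a (covD g c F) x - covD g c (covD g a F) x = rop (g x) (riemann g x) a c (F x).
Proof.
move=> sF aF; rewrite (ricci_identity oU mg a c sF Ux aF).
rewrite /gl -sumrN; apply: eq_bigr => b _.
under eq_bigr => d _ do rewrite curvatureE scaler_suml.
rewrite exchange_big -sumrN; apply: eq_bigr => e _ /=.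
rewrite r34 upE [in RHS]linear_sum [in RHS]scaler_sumr -sumrN; apply: eq_bigr => d _ /=.
by rewrite [eps b (_ *: _)]linearZ /= scalerA -scaleNr (symHE (symg Ux) d e); congr (_ *: _); ring.
Qed.

Lemma rop_upS k a S : kform k.+1 S ->
  \sum_c up (g x) c (rop (g x) (riemann g x) a c S) =
   - (2^-1 *: weyl_int a S) - (n%:R - k.+1%:R) *: int_schouten a S
    + iot a (\sum_c epsv (schouten g x c) (up (g x) c S)
             - (\sum_c \sum_d invmx (g x) c d * schouten g x c d) *: S).
Proof.
move=> kS.
exact: (rop_up (symg Ux) (ug Ux) schoutenC weyl34 weyl_bianchi weyl_trace a kS).
Qed.
Lemma rop_downS k a S : kform k S ->
  \sum_c eps c (rop (g x) (riemann g x) a c S) = weyl_ext a S - k%:R *: epsv (schouten g x a) S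
    - lo (g x) a (\sum_c eps c (int_schouten c S)).
Proof.
move=> kS.
exact: (@rop_down R n (g x) (symg Ux) (ug Ux) (riemann g x) (schouten g x) schoutenC k a S kS).
Qed.
Lemma rop_up_upS k S : kform k.+1 S ->
  \sum_a up (g x) a (\sum_c up (g x) c (rop (g x) (riemann g x) a c S)) = 0.
Proof.
move=> kS.
exact: (rop_up_up (symg Ux) (ug Ux) schoutenC weyl12 weyl34 weyl_bianchi weyl_trace kS).
Qed.
Lemma sum_up_int_schouten T : alt T -> \sum_c up (g x) c (int_schouten c T) = 0.
Proof. by move=> aT; apply: sum_up_int_P => //; exact: schoutenC. Qed.

End AtPoint.

Lemma smoothF_lo c F : smoothF U F -> smoothF U (fun y => lo (g y) c (F y)).
Proof. by move=> sF; apply: smoothF_epsv. Qed.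
Lemma smoothF_up c F : smoothF U F -> smoothF U (fun y => up (g y) c (F y)).
Proof. by move=> sF; apply: smoothF_iotv => // b; exact: (smooth_inv oU mg). Qed.

(** The Levi-Civita connection is torsion free, so the skew part of nabla F is
    dF. *)
Lemma sum_eps_covD F x : U x -> \sum_c eps c (covD g c F x) = \sum_c eps c (pdF c F x).
Proof.
move=> Ux; apply/eqP; rewrite -subr_eq0 -sumrB; apply/eqP.
have E c : eps c (covD g c F x) - eps c (pdF c F x) =
    - \sum_b \sum_d Gam d c b x *: eps c (eps b (iot d (F x))).
  rewrite covDE linearB /= [_ - _ - _]addrAC subrr add0r /gl linear_sum; congr (- _).
  apply: eq_bigr => b _ /=; rewrite linear_sum; apply: eq_bigr => d _ /=.
  by rewrite [eps c (_ *: _)]linearZ.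
under eq_bigr => c _ do rewrite E exchange_big.
rewrite sumrN exchange_big big1 ?oppr0 // => d _ /=.
by apply: sym_antisym_sum0 => a b; [exact: (christoffelC oU mg)|exact: eps_eps].
Qed.

(** d d = 0, by the symmetry of second derivatives. *)
Lemma sum_eps_pdF_pdF F x : smoothF U F -> U x ->
  \sum_a eps a (pdF a (fun y => \sum_c eps c (pdF c F y)) x) = 0.
Proof.
move=> sF Ux.
under eq_bigr => a _.
  rewrite (@pdF_sum _ _ U a) //; last by move=> c _; apply: smoothF_eps => //; exact: smoothF_pdF.
  rewrite linear_sum /=.
  under eq_bigr => c _ do rewrite (pdF_eps oU a c (smoothF_pdF c sF) Ux).
  over.
apply: lmod_double0; rewrite {1}exchange_big -sumrN; apply: eq_bigr => a _.
rewrite -sumrN; apply: eq_bigr => c _.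
by rewrite eps_eps (pdFC oU c a sF Ux).
Qed.

Section CKE.
Variables (k : nat) (S rho tau : pt -> form).
Hypothesis sS : smoothF U S.
Hypothesis srho : smoothF U rho.
Hypothesis stau : smoothF U tau.
Hypothesis kS : forall y, U y -> kform k.+1 (S y).
Hypothesis krho : forall y, U y -> kform k.+2 (rho y).
Hypothesis ktau : forall y, U y -> kform k (tau y).
Hypothesis cke : forall y, U y -> forall c,
  covD g c S y = iot c (rho y) + lo (g y) c (tau y).
Variable x : pt.
Hypothesis Ux : U x.
Local Notation Ra a := (covD g a rho x).
Local Notation Ta a := (covD g a tau x).

Lemma kform_covD_rho a : kform k.+2 (Ra a). Proof. exact: (kform_covD g oU a krho srho Ux). Qed.
Lemma kform_covD_tau a : kform k (Ta a). Proof. exact: (kform_covD g oU a ktau stau Ux). Qed.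

(** The Christoffel term accounts for the inert index c; it is symmetric in a
    and c and drops out of the commutator. *)
Lemma covD_covD a c : covD g a (covD g c S) x =
  iot c (Ra a) + lo (g x) c (Ta a) + \sum_d Gam d a c x *: covD g d S x.
Proof.
rewrite (covD_on g oU a (F' := fun y => iot c (rho y) + lo (g y) c (tau y))) //; last first.
  by move=> y Uy; exact: cke.
rewrite (covDD g a (smoothF_iot c srho) (smoothF_lo c stau) Ux).
rewrite (covD_iot g a c (proj1 (krho Ux))) (covD_lo oU mg a c stau Ux).
rewrite addrACA; congr (_ + _).
rewrite /iotv -big_split; apply: eq_bigr => d _ /=.
by rewrite cke // scalerDr.
Qed.

(** The Ricci identity with both second derivatives of S replaced by first
    derivatives of rho and tau. *)
Lemma ropCKE a c : rop (g x) (riemann g x) a c (S x) =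
  iot c (Ra a) - iot a (Ra c) + (lo (g x) c (Ta a) - lo (g x) a (Ta c)).
Proof.
rewrite -(commutator_rop Ux a c sS); last by move=> y /kS[].
rewrite !covD_covD.
have -> : \sum_d Gam d c a x *: covD g d S x = \sum_d Gam d a c x *: covD g d S x.
  by apply: eq_bigr => d _; rewrite (christoffelC oU mg d c a Ux).
move: (\sum_ _ _) => z; by apply: funext => s; rewrite !FE; ring.
Qed.

Lemma sum_up_ropCKE a : \sum_c up (g x) c (rop (g x) (riemann g x) a c (S x)) =
  (n%:R - k.+1%:R) *: Ta a + iot a (\sum_c up (g x) c (Ra c)) + lo (g x) a (\sum_c up (g x) c (Ta c)).
Proof.
have E c : up (g x) c (rop (g x) (riemann g x) a c (S x)) =
   up (g x) c (iot c (Ra a)) + iot a (up (g x) c (Ra c)) + up (g x) c (lo (g x) c (Ta a))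
   - (c == a)%:R *: Ta c + lo (g x) a (up (g x) c (Ta c)).
  rewrite ropCKE linearD !linearB /= (up_lo (symg Ux) (ug Ux) c a).
  rewrite (iot_up _ _ _ (proj1 (kform_covD_rho c))).
  by apply: funext => s; rewrite !FE; ring.
under eq_bigr => c _ do rewrite E.
rewrite !big_split /= sumrN (sum_up_iot (symg Ux) (proj1 (kform_covD_rho a))).
rewrite (sum_up_lo (symg Ux) (ug Ux) (kform_covD_tau a)) -!linear_sum.
have -> : \sum_c (c == a)%:R *: Ta c = Ta a.
  by under eq_bigr => c _ do rewrite eq_sym; rewrite sum_delta.
by apply: funext => s; rewrite !FE /= -natr1; ring.
Qed.

Lemma sum_eps_ropCKE a : \sum_c eps c (rop (g x) (riemann g x) a c (S x)) =
  k.+1%:R *: Ra a + iot a (\sum_c eps c (Ra c)) + lo (g x) a (\sum_c eps c (Ta c)).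
Proof.
have E c : eps c (rop (g x) (riemann g x) a c (S x)) =
   eps c (iot c (Ra a)) + iot a (eps c (Ra c)) - (a == c)%:R *: Ra c
   + eps c (lo (g x) c (Ta a)) + lo (g x) a (eps c (Ta c)).
  rewrite ropCKE linearD !linearB /= iot_eps [eps c (lo _ a _)]eps_lo.
  by apply: funext => s; rewrite !FE; ring.
under eq_bigr => c _ do rewrite E.
rewrite !big_split /= sumrN (sum_eps_iot (kform_covD_rho a)) (sum_eps_lo (symg Ux)) -!linear_sum sum_delta.
by apply: funext => s; rewrite !FE /= -[k.+2%:R]natr1; ring.
Qed.

(** The interior trace of [ropCKE] computed in two ways. *)
Lemma prolong_up a : (n%:R - k.+1%:R) *: (Ta a + int_schouten x a (S x)) =
  - (2^-1 *: weyl_int x a (S x)) + iot a (\sum_c epsv (schouten g x c) (up (g x) c (S x))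
             - (\sum_c \sum_d invmx (g x) c d * schouten g x c d) *: S x - \sum_c up (g x) c (Ra c))
  + lo (g x) a (- \sum_c up (g x) c (Ta c)).
Proof.
have := sum_up_ropCKE a; rewrite (rop_upS Ux a (kS Ux)).
set X := \sum_c epsv _ _ - _; set Y := \sum_c up _ _ _; set Z := \sum_c up _ _ _.
rewrite [iot a (X - Y)]linearB [lo _ _ (- _)]linearN /= scalerDr => e.
apply: funext => s; have := congr1 (fun T : form => T s) e; rewrite !FE /= => {}e.
lra.
Qed.

(** The exterior trace of [ropCKE] computed in two ways. *)
Lemma prolong_down a : k.+1%:R *: (Ra a + epsv (schouten g x a) (S x)) =
  weyl_ext x a (S x) - iot a (\sum_c eps c (Ra c))
  - lo (g x) a (\sum_c eps c (int_schouten x c (S x)) + \sum_c eps c (Ta c)).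
Proof.
have := sum_eps_ropCKE a; rewrite (rop_downS Ux a (kS Ux)).
set X := \sum_c eps c _; set Y := \sum_c eps c _; set Z := \sum_c eps c _.
rewrite [lo _ _ (_ + _)]linearD /= scalerDr => e.
apply: funext => s; have := congr1 (fun T : form => T s) e; rewrite !FE /= => {}e.
lra.
Qed.

(** Contracting [sum_up_ropCKE] once more gives 2 (n - k - 1) div tau on one
    side, and by [rop_up_up] zero on the other. *)
Lemma div_tau : (k < n)%N -> \sum_a up (g x) a (Ta a) = 0.
Proof.
move=> kn.
case: k kn kform_covD_tau sum_up_ropCKE kS => [|j] kn kTj sumj kSj.
  rewrite big1 // => a _; rewrite upE big1 // => d _.
  have -> : iot d (Ta a) = 0 by apply: funext => s; rewrite iotE (proj2 (kTj a)).
  by rewrite scaler0.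
have := rop_up_upS Ux (kSj x Ux).
set Y := \sum_a up _ _ (Ta a).
have kY : kform j Y by apply: kform_sum => a _; exact: (kform_up _ _ (kTj a)).
set X := \sum_c up (g x) c (Ra c) in sumj.
have aX : alt X by apply: alt_sum => c _; exact/alt_up/(proj1 (kform_covD_rho c)).
have -> : \sum_a up (g x) a (\sum_c up (g x) c (rop (g x) (riemann g x) a c (S x))) =
   (n%:R - j.+2%:R) *: Y + \sum_a up (g x) a (iot a X) + \sum_a up (g x) a (lo (g x) a Y).
  rewrite scaler_sumr -!big_split; apply: eq_bigr => a _ /=.
  by rewrite sumj -/X -/Y !linearD /= [up _ _ (_ *: _)]linearZ.
rewrite (sum_up_iot (symg Ux) aX) addr0 (sum_up_lo (symg Ux) (ug Ux) kY) -scalerDl => /eqP.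
rewrite scaler_eq0 => /orP[|/eqP //].
have -> : n%:R - j.+2%:R + (n%:R - j%:R) = 2 * (n%:R - j.+1%:R) :> R.
  by rewrite -[j.+2%:R]natr1 -[j.+1%:R]natr1; ring.
by rewrite mulf_eq0 pnatr_eq0 subr_eq0 eqr_nat (gtn_eqF kn).
Qed.

Section Alpha.
Variable f : pt -> R.
Hypothesis sf : smooth_on U f.
Variable lam : R.
Hypothesis ae : forall a b, hessian g f x a b + schouten g x a b * f x = lam * g x a b.

Definition grad y d : R := \sum_e invmx (g y) d e * pd e f y.

Lemma smooth_grad d : smooth_on U (fun y => grad y d).
Proof.
apply: smooth_sum => // e _; apply: smoothM => //; last exact: smooth_pd.
exact: (smooth_inv oU mg).
Qed.

Lemma lower_grad y c : U y -> \sum_d g y c d * grad y d = pd c f y.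
Proof.
move=> Uy; rewrite /grad; under eq_bigr => d _ do rewrite mulr_sumr.
rewrite exchange_big /=.
under eq_bigr => e _ do (under eq_bigr => d _ do rewrite mulrA; rewrite -mulr_suml (GHE (ug Uy))).
rewrite (bigD1 c) //= eqxx mul1r big1 ?addr0 // => e /negbTE.
by rewrite eq_sym => ->; rewrite mul0r.
Qed.

Definition dgrad a d : R := pd a (fun y => grad y d) x + \sum_c Gam d a c x * grad x c.

(** nabla commutes with lowering, so nabla_a grad^d f is the Hessian with an
    index raised. *)
Lemma lower_dgrad a c : \sum_d g x c d * dgrad a d = hessian g f x a c.
Proof.
have E : \sum_d g x c d * pd a (fun y => grad y d) x =
   pd a (pd c f) x - \sum_d (chrL g c a d x + chrL g d a c x) * grad x d.
  have dG d : differentiable (fun y => grad y d) x by exact: (smooth_diff (smooth_grad d)).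
  have dg d : differentiable (fun y => g y c d) x by exact: (smooth_diff (sg c d)).
  rewrite -(@pd_on _ _ a (fun y => \sum_d g y c d * grad y d) (pd c f) U x oU Ux); last first.
    by move=> y Uy; exact: lower_grad.
  rewrite pd_sum => [|d _]; last exact: differentiableM.
  rewrite -sumrB; apply: eq_bigr => d _.
  rewrite pdM // (pd_metric oU mg a c d Ux).
  move: (chrL g c a d x) (chrL g d a c x) (pd a _ x) (grad x d) (g x c d) => u1 u2 u3 u4 u5; ring.
have E2 : \sum_d g x c d * \sum_e Gam d a e x * grad x e = \sum_d chrL g c a d x * grad x d.
  under eq_bigr => d _ do rewrite mulr_sumr.
  rewrite exchange_big /=; apply: eq_bigr => e _.
  rewrite -(lower_christoffel mg c a e Ux) mulr_suml.
  by apply: eq_bigr => d _; rewrite mulrA.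
have E3 : \sum_d chrL g d a c x * grad x d = \sum_e Gam e a c x * pd e f x.
  under eq_bigr => d _ do rewrite -(lower_christoffel mg d a c Ux) mulr_suml.
  rewrite exchange_big /=; apply: eq_bigr => e _.
  rewrite -(lower_grad _ Ux) mulr_sumr; apply: eq_bigr => d _.
  by rewrite (gE mg d e Ux) -mulrA mulrCA.
have D (L L' G' : I -> R) : \sum_e (L e + L' e) * G' e = \sum_e L e * G' e + \sum_e L' e * G' e.
  by rewrite -big_split; apply: eq_bigr => e _; rewrite mulrDl.
transitivity (\sum_d g x c d * pd a (fun y => grad y d) x
   + \sum_d g x c d * \sum_e Gam d a e x * grad x e).
  by rewrite -big_split; apply: eq_bigr => d _; rewrite mulrDr.
rewrite E E2 D E3 /hessian.
by rewrite opprD addrA addrAC subrK.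
Qed.

(** The almost Einstein equation: the derivative of the gradient is - f P_a^d
    up to a multiple of the identity. *)
Lemma iotv_dgrad a T : iotv (dgrad a) T = lam *: iot a T - f x *: int_schouten x a T.
Proof.
have E d : dgrad a d = \sum_c invmx (g x) d c * hessian g f x a c.
  under eq_bigr => c _ do rewrite -lower_dgrad mulr_sumr.
  rewrite exchange_big /=.
  under eq_bigr => e _ do (under eq_bigr => c _ do rewrite mulrA; rewrite -mulr_suml (HGE (ug Ux))).
  rewrite (bigD1 d) //= eqxx mul1r big1 ?addr0 // => e /negbTE.
  by rewrite eq_sym => ->; rewrite mul0r.
have -> : iotv (dgrad a) T = \sum_c hessian g f x a c *: up (g x) c T.
  rewrite /iotv; under eq_bigr => d _ do rewrite E scaler_suml.
  rewrite exchange_big; apply: eq_bigr => c _ /=.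
  rewrite upE scaler_sumr; apply: eq_bigr => d _.
  by rewrite scalerA mulrC (symHE (symg Ux) d c).
rewrite -(lower_up (ug Ux)) /int_schouten /int_P !scaler_sumr -sumrB; apply: eq_bigr => c _.
have -> : hessian g f x a c = lam * g x a c - f x * schouten g x a c.
  by have := ae a c; lra.
by rewrite scalerBl !scalerA.
Qed.

(** Up to a constant factor this is the form with two overbars; see
    [twist_divE]. *)
Definition Tup y : form := f y *: tau y - iotv (grad y) (S y).

(** Up to a constant factor this is the form with two underbars; see
    [twist_extE]. *)
Definition Tdn y : form := f y *: rho y - epsv (fun b => pd b f y) (S y).

Lemma smoothF_Tup : smoothF U Tup.
Proof.
apply: smoothFB => //; first exact: smoothFZ.
by apply: smoothF_iotv => // d; exact: smooth_grad.
Qed.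
Lemma smoothF_Tdn : smoothF U Tdn.
Proof.
apply: smoothFB => //; first exact: smoothFZ.
by apply: smoothF_epsv => // d; exact: smooth_pd.
Qed.
Lemma kform_Tup y : U y -> kform k (Tup y).
Proof. by move=> Uy; apply: kformB; [apply/kformZ/ktau|exact: (kform_iotv _ (kS Uy))]. Qed.
Lemma kform_Tdn y : U y -> kform k.+2 (Tdn y).
Proof. by move=> Uy; apply: kformB; [apply/kformZ/krho|exact: (kform_epsv _ (kS Uy))]. Qed.

(** The Schouten terms of the Hessian of f combine with nabla tau into the left
    hand side of [prolong_up]. *)
Lemma covD_Tup a : covD g a Tup x = f x *: (Ta a + int_schouten x a (S x))
  + iot a (iotv (grad x) (rho x) - lam *: S x) + lo (g x) a (iotv (grad x) (tau x)).
Proof.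
have aS := proj1 (kS Ux).
rewrite (covDB g a (smoothFZ oU sf stau) (smoothF_iotv oU smooth_grad sS) Ux).
rewrite (covDZ g a sf stau Ux) (covD_iotv g oU a smooth_grad sS Ux aS).
rewrite -[iotv (fun d => _) (S x)]/(iotv (dgrad a) (S x)) iotv_dgrad.
rewrite (cke Ux) [iotv (grad x) (_ + _)]linearD /= /lo iotv_epsv.
have -> : \sum_d grad x d * g x a d = pd a f x.
  by rewrite -(lower_grad _ Ux); apply: eq_bigr => d _; rewrite mulrC.
rewrite [iot a (_ - _)]linearB /= [iot a (_ *: _)]linearZ /= (iot_iotv a (grad x) (proj1 (krho Ux))).
by apply: funext => s; rewrite !FE; ring.
Qed.

(** Dual to [covD_Tup], for the left hand side of [prolong_down]. *)
Lemma covD_Tdn a : covD g a Tdn x = f x *: (Ra a + epsv (schouten g x a) (S x))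
  + iot a (epsv (fun b => pd b f x) (rho x)) + lo (g x) a (epsv (fun b => pd b f x) (tau x) - lam *: S x).
Proof.
have sdf b : smooth_on U (pd b f) by exact: smooth_pd.
rewrite (covDB g a (smoothFZ oU sf srho) (smoothF_epsv oU sdf sS) Ux).
rewrite (covDZ g a sf srho Ux) (covD_epsv g oU a sdf sS Ux).
have -> : epsv (fun b => pd a (pd b f) x - \sum_d Gam d a b x * pd d f x) (S x) =
    lam *: lo (g x) a (S x) - f x *: epsv (schouten g x a) (S x).
  rewrite /lo /epsv !scaler_sumr -sumrB; apply: eq_bigr => b _.
  rewrite !scalerA -scalerBl; congr (_ *: _).
  by have := ae a b; rewrite /hessian; lra.
rewrite (cke Ux) [epsv _ (iot a _ + _)]linearD /= iot_epsv.
rewrite [lo _ _ (_ - _)]linearB /= [lo _ _ (_ *: _)]linearZ /=.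
rewrite [epsv _ (lo _ _ _)]epsv_epsv -/(lo (g x) a).
by apply: funext => s; rewrite !FE /lo; ring.
Qed.

Lemma kform_weyl_int a : kform k (weyl_int x a (S x)).
Proof.
case: k kS => [|j] kSj.
  rewrite /weyl_int big1 => [|e _]; first exact: kform0.
  rewrite big1 ?linear0 // => c _; rewrite big1 // => d _.
  have kf : kform 0 (up (g x) d (S x)) by exact: (kform_up _ _ (kSj x Ux)).
  rewrite upE big1 ?scaler0 // => b _.
  have -> : iot b (up (g x) d (S x)) = 0 by apply: funext => s; rewrite iotE (proj2 kf).
  by rewrite scaler0.
apply: kform_sum => e _; apply/kform_eps/kform_sum => c _; apply: kform_sum => d _.
by apply/kformZ/(kform_up _ c (kform_up _ d (kSj x Ux))).
Qed.

(** Insert [prolong_up] into [covD_Tup]; the rest is iota_a X + g_a /\ Y, which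
    the projection kills. *)
Lemma hook_Tup c : (0 < k)%N -> (k.+1 < n)%N ->
  hookF (g x) k (fun a => covD g a Tup x) c =
  (- (f x / (2 * (n%:R - k.+1%:R)))) *: hookF (g x) k (fun a => weyl_int x a (S x)) c.
Proof.
move=> k0 kn.
have N0 : n%:R - k.+1%:R != 0 :> R by rewrite subr_eq0 eqr_nat (gtn_eqF kn).
set N : R := n%:R - _ in N0 *.
set X1 := \sum_c epsv (schouten g x c) (up (g x) c (S x))
             - (\sum_c \sum_d invmx (g x) c d * schouten g x c d) *: S x - \sum_c up (g x) c (Ra c).
set Y1 := - \sum_c up (g x) c (Ta c).
pose X := (f x / N) *: X1 + (iotv (grad x) (rho x) - lam *: S x).
pose Y := (f x / N) *: Y1 + iotv (grad x) (tau x).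
have E a : covD g a Tup x = (- (f x / (2 * N))) *: weyl_int x a (S x) + (iot a X + lo (g x) a Y).
  have P : Ta a + int_schouten x a (S x) = N^-1 *: (- (2^-1 *: weyl_int x a (S x)) + iot a X1 + lo (g x) a Y1).
    by rewrite -prolong_up scalerA mulVf // scale1r.
  rewrite covD_Tup P /X /Y [iot a (_ + (_ - _))]linearD /= [iot a (_ *: X1)]linearZ /=.
  rewrite [lo _ _ (_ + _)]linearD /= [lo _ _ (_ *: _)]linearZ /= invfM.
  move: (iot a _) (iot a _) (lo _ _ _) (lo _ _ _) (weyl_int _ _ _) => z1 z2 z3 z4 z5.
  by apply: funext => s; rewrite !FE; ring.
have -> : (fun a => covD g a Tup x) =
   (fun a => (- (f x / (2 * N))) *: weyl_int x a (S x) + (iot a X + lo (g x) a Y)).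
  by apply: funext.
rewrite hookF_lin.
have kX : kform k.+1 X.
  apply: kformD; [apply/kformZ/kformB; [apply: kformB|]|apply: kformB].
  - by apply: kform_sum => d _; exact: (kform_epsv _ (kform_up _ d (kS Ux))).
  - exact/kformZ/kS.
  - by apply: kform_sum => d _; exact: (kform_up _ d (kform_covD_rho d)).
  - exact: (kform_iotv _ (krho Ux)).
  - exact/kformZ/kS.
have kY : kform k.-1 Y.
  apply: kformD; [apply/kformZ/kformN|exact: (kform_iotv _ (ktau Ux))].
  by apply: kform_sum => d _; exact: (kform_up _ d (kform_covD_tau d)).
have kk : k = k.-1.+1 by rewrite prednK.
rewrite [X in _ + X](_ : _ = 0) ?addr0 //.
rewrite {1}kk; apply: (hookF_triv (symg Ux) (ug Ux)) => //; last by rewrite -kk.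
by lia.
Qed.

(** Insert [prolong_down] into [covD_Tdn]. *)
Lemma hook_Tdn c : (k.+1 < n)%N ->
  hookF (g x) k.+2 (fun a => covD g a Tdn x) c =
  (f x / k.+1%:R) *: hookF (g x) k.+2 (fun a => weyl_ext x a (S x)) c.
Proof.
move=> kn.
set X1 := \sum_c eps c (Ra c).
set Y1 := \sum_c eps c (int_schouten x c (S x)) + \sum_c eps c (Ta c).
pose X := (- (f x / k.+1%:R)) *: X1 + epsv (fun b => pd b f x) (rho x).
pose Y := (- (f x / k.+1%:R)) *: Y1 + (epsv (fun b => pd b f x) (tau x) - lam *: S x).
have E a : covD g a Tdn x = (f x / k.+1%:R) *: weyl_ext x a (S x) + (iot a X + lo (g x) a Y).
  have P : Ra a + epsv (schouten g x a) (S x) =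
      k.+1%:R^-1 *: (weyl_ext x a (S x) - iot a X1 - lo (g x) a Y1).
    by rewrite -prolong_down scalerA mulVf ?scale1r // pnatr_eq0.
  rewrite covD_Tdn P /X /Y [iot a (_ *: X1 + _)]linearD /= [iot a (_ *: X1)]linearZ /=.
  rewrite [lo _ _ (_ *: Y1 + _)]linearD /= [lo _ _ (_ *: Y1)]linearZ /=.
  move: (iot a _) (iot a _) (lo _ _ _) (lo _ _ _) (weyl_ext _ _ _) => z1 z2 z3 z4 z5.
  by apply: funext => s; rewrite !FE; ring.
have -> : (fun a => covD g a Tdn x) =
   (fun a => (f x / k.+1%:R) *: weyl_ext x a (S x) + (iot a X + lo (g x) a Y)).
  by apply: funext.
rewrite hookF_lin (hookF_triv (symg Ux) (ug Ux)) ?addr0 //.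
- apply: kformD; [apply/kformZ|exact: (kform_epsv _ (krho Ux))].
  by apply: kform_sum => d _; exact: (kform_eps d (kform_covD_rho d)).
- apply: kformD; [apply/kformZ/kformD|apply: kformB].
  + apply: kform_sum => d _; apply/kform_eps/kform_sum => e _.
    exact/kformZ/(kform_up _ e (kS Ux)).
  + by apply: kform_sum => d _; exact: (kform_eps d (kform_covD_tau d)).
  + exact: (kform_epsv _ (ktau Ux)).
  + exact/kformZ/kS.
Qed.

(** The pure trace part of nabla Tup is its divergence, to which only
    iota_(grad f) tau contributes, as div tau = 0 and P is symmetric.  Knowing it
    exactly is what allows a change of scale to remove it. *)
Lemma killing_Tup c : (0 < k)%N -> (k < n)%N ->
  hookF (g x) k (fun a => covD g a Tup x) c = 0 ->
  covD g c Tup x = iot c (k.+1%:R^-1 *: \sum_b eps b (covD g b Tup x))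
    + lo (g x) c (iotv (grad x) (tau x)).
Proof.
move=> k0 kn hk; have -> := hookF_eq0 hk; congr (_ + lo _ _ _).
have aS := proj1 (kS Ux).
set Z := iotv (grad x) (rho x) - lam *: S x.
set Y := iotv (grad x) (tau x).
have aZ : alt Z by apply: altB; [exact: (alt_iotv _ (proj1 (krho Ux)))|exact: altZ].
have kY : kform k.-1 Y by exact: (kform_iotv _ (ktau Ux)).
have -> : \sum_a up (g x) a (covD g a Tup x) = f x *: (\sum_a up (g x) a (Ta a)
    + \sum_a up (g x) a (int_schouten x a (S x))) + \sum_a up (g x) a (iot a Z)
    + \sum_a up (g x) a (lo (g x) a Y).
  rewrite scalerDr !scaler_sumr -!big_split; apply: eq_bigr => a _ /=.
  rewrite covD_Tup scalerDr -/Z -/Y.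
  by rewrite !linearD /= [up _ _ (f x *: _)]linearZ /= [up _ _ (f x *: int_schouten _ _ _)]linearZ.
rewrite (div_tau kn) (sum_up_int_schouten Ux aS) addr0 scaler0 add0r.
rewrite (sum_up_iot (symg Ux) aZ) add0r (sum_up_lo (symg Ux) (ug Ux) kY) scalerA.
have -> : n%:R - k.-1%:R = n%:R - k%:R + 1 :> R.
  by rewrite -[in k%:R](prednK k0) -natr1; ring.
rewrite mulVf ?scale1r //.
by rewrite -natrB ?natr1 ?pnatr_eq0 // ltnW.
Qed.

(** rho is a constant multiple of dS. *)
Lemma ext_rho : \sum_a eps a (Ra a) = 0.
Proof.
rewrite (sum_eps_covD _ Ux).
have E y : U y -> rho y = k.+2%:R^-1 *: \sum_c eps c (pdF c S y).
  move=> Uy; rewrite -(sum_eps_covD _ Uy).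
  under eq_bigr => c _ do rewrite cke // linearD /=.
  rewrite big_split /= (sum_eps_iot (krho Uy)) (sum_eps_lo (symg Uy)) addr0.
  by rewrite scalerA mulVf ?scale1r // pnatr_eq0.
have sd : smoothF U (fun y => \sum_c eps c (pdF c S y)).
  by apply: smoothF_sum => // c _; apply: smoothF_eps => //; exact: smoothF_pdF.
under eq_bigr => a _ do rewrite (pdF_on oU a E Ux) (pdFc a _ sd Ux) linearZ /=.
by rewrite -scaler_sumr sum_eps_pdF_pdF // scaler0.
Qed.

(** Dual to [killing_Tup], with d rho = 0 and P symmetric. *)
Lemma killing_Tdn c : (k.+1 < n)%N ->
  hookF (g x) k.+2 (fun a => covD g a Tdn x) c = 0 ->
  covD g c Tdn x = iot c (epsv (fun b => pd b f x) (rho x))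
    + lo (g x) c ((n%:R - k.+2%:R + 1)^-1 *: \sum_p up (g x) p (covD g p Tdn x)).
Proof.
move=> kn hk; have -> := hookF_eq0 hk; congr (iot _ _ + _).
set Z := epsv _ (rho x).
set Y := epsv (fun b => pd b f x) (tau x) - lam *: S x.
have kZ : kform k.+3 Z by exact: (kform_epsv _ (krho Ux)).
have -> : \sum_a eps a (covD g a Tdn x) = f x *: (\sum_a eps a (Ra a)
    + \sum_a eps a (epsv (schouten g x a) (S x))) + \sum_a eps a (iot a Z)
    + \sum_a eps a (lo (g x) a Y).
  rewrite scalerDr !scaler_sumr -!big_split; apply: eq_bigr => a _ /=.
  rewrite covD_Tdn scalerDr -/Z -/Y.
  by rewrite !linearD /= [eps _ (f x *: _)]linearZ /= [eps _ (f x *: epsv _ _)]linearZ.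
have PS := schoutenC Ux.
rewrite ext_rho (sum_eps_epsvP PS) addr0 scaler0 add0r.
rewrite (sum_eps_iot kZ) (sum_eps_lo (symg Ux)) addr0 scalerA.
by rewrite mulVf ?scale1r // pnatr_eq0.
Qed.

End Alpha.
End CKE.
End Local.

(** * Rescaling the metric *)

Section Ops.
Variables (R : realType) (n : nat) (g : 'rV[R]_n -> 'M[R]_n) (f : 'rV[R]_n -> R).
Local Notation form := (seq 'I_n -> R^o).
Implicit Types (F : 'rV[R]_n -> form) (x : 'rV[R]_n).

(** The divergence and the skew-symmetrisation of this expression, for the
    right r, are the two invariant operators of the theorem. *)
Definition twist (r : R) F c x : form := f x *: covD g c F x - (r * pd c f x) *: F x.
Definition twist_div r F x : form := \sum_c up (g x) c (twist r F c x).
Definition twist_ext r F x : form := \sum_c eps c (twist r F c x).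
End Ops.

Section Conformal.
Variables (R : realType) (n : nat) (U : set 'rV[R]_n) (g gh : 'rV[R]_n -> 'M[R]_n).
Hypothesis oU : open U.
Local Notation I := 'I_n.
Local Notation form := (seq 'I_n -> R^o).
Local Notation pt := 'rV[R]_n.
Implicit Types (F : pt -> form) (x y : pt).
Hypothesis mg : local_metric U g.
Let sg : forall a b, smooth_on U (fun y => g y a b) := let: And3 h _ _ := mg in h.
Let symg : forall x, U x -> (g x)^T = g x := let: And3 _ h _ := mg in h.
Let ug : forall x, U x -> g x \in unitmx := let: And3 _ _ h := mg in h.
Variable Om : pt -> R.
Hypothesis sOm : smooth_on U Om.
Hypothesis Om0 : forall y, U y -> Om y != 0.
Hypothesis ghE : forall y, U y -> gh y = Om y ^+ 2 *: g y.

(** The 1-form d log Om, and in [upsv] its gradient.  Using Om instead of its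
    logarithm makes the weights exponents of powers. *)
Definition ups a x : R := pd a Om x / Om x.
Definition upsv x d : R := \sum_e invmx (g x) d e * ups e x.

Lemma invgh x : U x -> invmx (gh x) = (Om x ^+ 2)^-1 *: invmx (g x).
Proof.
move=> Ux; rewrite ghE // invmxZ // unitmxZ ?ug //.
by rewrite unitfE expf_neq0 // Om0.
Qed.

Lemma conformal_metric : local_metric U gh.
Proof.
split.
- move=> a b; apply: (@smooth_near _ _ _ (fun y => Om y ^+ 2 * g y a b)) => //.
    by move=> y Uy; rewrite ghE // mxE.
  by apply: smoothM => //; exact: smoothX.
- by move=> x Ux; rewrite ghE // linearZ /= symg.
- move=> x Ux; rewrite ghE // unitmxZ ?ug //.
  by rewrite unitfE expf_neq0 // Om0.
Qed.

Lemma up_gh x c T : U x -> up (gh x) c T = (Om x ^+ 2)^-1 *: up (g x) c T.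
Proof.
move=> Ux; rewrite !upE invgh // scaler_sumr; apply: eq_bigr => d _.
by rewrite mxE scalerA.
Qed.

Lemma pd_Om2 a x : U x -> pd a (fun y => Om y ^+ 2) x = 2 * Om x ^+ 2 * ups a x.
Proof.
move=> Ux; have dOm := smooth_diff sOm Ux.
rewrite /ups (_ : (fun y => _) = (fun y => Om y * Om y)); last by apply: funext => y; rewrite expr2.
by rewrite pdM //; field; exact: Om0.
Qed.

Lemma christoffel_gh c a b x : U x -> christoffel gh c a b x = christoffel g c a b x
  + ((c == a)%:R * ups b x + (c == b)%:R * ups a x - g x a b * upsv x c).
Proof.
move=> Ux.
have dO2 : differentiable (fun y => Om y ^+ 2) x by exact: (smooth_diff (smoothX 2 oU sOm)).
have E p q r : pd p (fun y => gh y q r) x =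
    Om x ^+ 2 * (pd p (fun y => g y q r) x + 2 * ups p x * g x q r).
  rewrite (@pd_on _ _ p _ (fun y => Om y ^+ 2 * g y q r) U x oU Ux); last first.
    by move=> y Uy; rewrite ghE // mxE.
  by rewrite pdM //; [rewrite pd_Om2 //; ring|exact: (smooth_diff (sg q r))].
have O20 : Om x ^+ 2 != 0 by rewrite expf_neq0 // Om0.
have -> : christoffel gh c a b x = 2^-1 * \sum_d invmx (g x) c d *
    (pd a (fun y => g y b d) x + pd b (fun y => g y a d) x - pd d (fun y => g y a b) x
     + 2 * (ups a x * g x b d + ups b x * g x a d - ups d x * g x a b)).
  rewrite /christoffel; congr (_ * _); apply: eq_bigr => d _.
  rewrite (E a b d) (E b a d) (E d a b) invgh // mxE.
  move: (pd a _ x) (pd b _ x) (pd d _ x) (ups a x) (ups b x) (ups d x) => u1 u2 u3 u4 u5 u6.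
  by field; exact: Om0.
under eq_bigr => d _ do rewrite mulrDr.
rewrite big_split mulrDr; congr (_ + _).
have -> : (c == a)%:R = \sum_d invmx (g x) c d * g x d a by rewrite (HGE (ug Ux)).
have -> : (c == b)%:R = \sum_d invmx (g x) c d * g x d b by rewrite (HGE (ug Ux)).
rewrite /upsv !mulr_suml !mulr_sumr -big_split -sumrB; apply: eq_bigr => d _ /=.
rewrite (gE mg d a Ux) (gE mg d b Ux).
move: (ups a x) (ups b x) (ups d x) => u1 u2 u3; by field.
Qed.

(** The change of the Christoffel symbols consists of two matrices of
    rank one and a multiple of the identity, and [gl] turns each into a familiar operator. *)
Lemma covD_gh k F a x : U x -> kform k (F x) ->
  covD gh a F x = covD g a F x - epsv (fun b => ups b x) (iot a (F x))
   - (k%:R * ups a x) *: F x + lo (g x) a (iotv (upsv x) (F x)).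
Proof.
move=> Ux kF; rewrite !covDE.
have -> : gl (fun b d => christoffel gh d a b x) (F x) = gl (fun b d => christoffel g d a b x) (F x)
   + (epsv (fun b => ups b x) (iot a (F x)) + (k%:R * ups a x) *: F x
      - lo (g x) a (iotv (upsv x) (F x))).
  have -> : (fun b d => christoffel gh d a b x) = (fun b d => christoffel g d a b x
      + ((d == a)%:R * ups b x + (d == b)%:R * ups a x - g x a b * upsv x d)).
    by apply: funext => b; apply: funext => d; exact: christoffel_gh.
  rewrite glD; congr (_ + _).
  have -> : epsv (fun b => ups b x) (iot a (F x)) = gl (fun b d => (d == a)%:R * ups b x) (F x).
    apply: eq_bigr => b _; rewrite -(sum_delta a (fun d => ups b x *: eps b (iot d (F x)))).
    by apply: eq_bigr => d _; rewrite scalerA eq_sym.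
  have -> : (k%:R * ups a x) *: F x = gl (fun b d => (d == b)%:R * ups a x) (F x).
    rewrite mulrC -scalerA -(sum_eps_iot kF) scaler_sumr; apply: eq_bigr => b _.
    rewrite -(sum_delta b (fun d => ups a x *: eps b (iot d (F x)))).
    by apply: eq_bigr => d _; rewrite scalerA eq_sym.
  have -> : lo (g x) a (iotv (upsv x) (F x)) = gl (fun b d => g x a b * upsv x d) (F x).
    apply: eq_bigr => b _; rewrite /iotv linear_sum scaler_sumr; apply: eq_bigr => d _ /=.
    by rewrite linearZ /= scalerA.
  by rewrite -glN -!glD.
by apply: funext => s; rewrite !FE; ring.
Qed.

Lemma pd_Omw (w : nat) a x : U x -> pd a (fun y => Om y ^+ w) x = w%:R * Om x ^+ w * ups a x.
Proof.
move=> Ux; have dOm := smooth_diff sOm Ux; have O0 := Om0 Ux.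
elim: w => [|w IH]; first by rewrite mul0r mul0r (_ : (fun y => _) = fun=> 1) ?pd_cst.
rewrite (_ : (fun y => _) = (fun y => Om y * Om y ^+ w)); last by apply: funext => y; rewrite exprS.
rewrite pdM //; last exact: (smooth_diff (smoothX w oU sOm)).
by rewrite IH exprS -natr1 /ups; field.
Qed.

Lemma covD_gh_w (w k : nat) F a x : smoothF U F -> U x -> kform k (F x) ->
  covD gh a (fun y => Om y ^+ w *: F y) x = Om x ^+ w *: (covD g a F x
   + ((w%:R - k%:R) * ups a x) *: F x - epsv (fun b => ups b x) (iot a (F x))
   + lo (g x) a (iotv (upsv x) (F x))).
Proof.
move=> sF Ux kF.
rewrite (covDZ gh a (smoothX w oU sOm) sF Ux) (covD_gh a Ux kF) pd_Omw //.
by apply: funext => s; rewrite !FE; ring.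
Qed.

Lemma pd_Omf f a x : smooth_on U f -> U x ->
  pd a (fun y => Om y * f y) x = Om x * (ups a x * f x + pd a f x).
Proof.
move=> sf Ux; rewrite pdM; [|exact: (smooth_diff sOm)|exact: (smooth_diff sf)].
by rewrite /ups; field; exact: Om0.
Qed.

Lemma sum_ups_up x T : U x -> \sum_c ups c x *: up (g x) c T = iotv (upsv x) T.
Proof.
move=> Ux; rewrite /iotv /upsv; under [RHS]eq_bigr => d _ do rewrite scaler_suml.
rewrite exchange_big /=; apply: eq_bigr => c _.
rewrite upE scaler_sumr; apply: eq_bigr => d _.
by rewrite scalerA mulrC (symHE (symg Ux) c d).
Qed.

Lemma twist_gh (f : pt -> R) (r : R) (w k : nat) F c x : smooth_on U f -> smoothF U F -> U x ->
  kform k (F x) ->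
  twist gh (fun y => Om y * f y) r (fun y => Om y ^+ w *: F y) c x =
  Om x ^+ w.+1 *: (twist g f r F c x + (f x * (w%:R - k%:R - r)) *: (ups c x *: F x)
     - f x *: epsv (fun b => ups b x) (iot c (F x)) + f x *: lo (g x) c (iotv (upsv x) (F x))).
Proof.
move=> sf sF Ux kF; rewrite /twist (covD_gh_w _ _ sF Ux kF) pd_Omf // exprS.
by apply: funext => s; rewrite !FE; ring.
Qed.

(** The terms with the derivative of Om left over by [twist_gh] have divergence
    proportional to iota_(grad log Om) F, with a coefficient that is zero for this
    weight and this r. *)
Lemma twist_div_conformal f k F x : smooth_on U f -> smoothF U F -> U x -> kform k.+1 (F x) ->
  twist_div gh (fun y => Om y * f y) (n%:R - k.+1%:R + 1) (fun y => Om y ^+ k.+2 *: F y) x =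
  Om x ^+ k.+1 *: twist_div g f (n%:R - k.+1%:R + 1) F x.
Proof.
move=> sf sF Ux kF; have aF := proj1 kF; have O0 := Om0 Ux.
set r := n%:R - k.+1%:R + 1.
set Z := iotv (upsv x) (F x).
have kZ : kform k Z by exact: (kform_iotv _ kF).
have upL c (r1 r2 r3 r4 : R) (A B C D : form) :
   up (g x) c (r1 *: (A + r2 *: B - r3 *: C + r4 *: D)) =
   r1 *: (up (g x) c A + r2 *: up (g x) c B - r3 *: up (g x) c C + r4 *: up (g x) c D).
  rewrite [up _ _ (r1 *: _)]linearZ /= [up _ _ (_ + r4 *: D)]linearD /= [up _ _ (_ - r3 *: C)]linearB /=.
  rewrite [up _ _ (A + _)]linearD /=.
  by rewrite [up _ _ (r2 *: _)]linearZ [up _ _ (r3 *: _)]linearZ [up _ _ (r4 *: _)]linearZ.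
rewrite /twist_div; under eq_bigr => c _ do rewrite up_gh // (twist_gh _ _ _ sf sF Ux kF) upL scalerA.
rewrite -scaler_sumr !big_split sumrN /= -!scaler_sumr.
have -> : \sum_c up (g x) c (ups c x *: F x) = Z.
  by rewrite /Z -sum_ups_up //; apply: eq_bigr => c _; rewrite linearZ.
have -> : \sum_c up (g x) c (epsv (fun b => ups b x) (iot c (F x))) = Z.
  under eq_bigr => c _ do rewrite up_epsv.
  rewrite sumrB -linear_sum (sum_up_iot (symg Ux) aF) linear0 subr0 /Z -sum_ups_up //.
  under [RHS]eq_bigr => d _ do rewrite upE scaler_sumr.
  rewrite [RHS]exchange_big; apply: eq_bigr => c _ /=.
  rewrite scaler_suml; apply: eq_bigr => d _.
  by rewrite scalerA mulrC (symHE (symg Ux) c d).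
rewrite (sum_up_lo (symg Ux) (ug Ux) kZ).
have -> : (Om x ^+ 2)^-1 * Om x ^+ k.+3 = Om x ^+ k.+1.
  by rewrite -[k.+3]/(2 + k.+1)%N exprD mulKf // expf_neq0.
congr (_ *: _); rewrite /r -[k.+2%:R]natr1 -[k.+1%:R]natr1.
by apply: funext => s; rewrite !FE; ring.
Qed.

(** Here the leftover terms are multiples of d log Om /\ F, again with total
    coefficient zero. *)
Lemma twist_ext_conformal f k F x : smooth_on U f -> smoothF U F -> U x -> kform k (F x) ->
  twist_ext gh (fun y => Om y * f y) k.+1%:R (fun y => Om y ^+ k.+1 *: F y) x =
  Om x ^+ k.+2 *: twist_ext g f k.+1%:R F x.
Proof.
move=> sf sF Ux kF.
have epsL c (r1 r2 r3 r4 : R) (A B C D : form) :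
   eps c (r1 *: (A + r2 *: B - r3 *: C + r4 *: D)) =
   r1 *: (eps c A + r2 *: eps c B - r3 *: eps c C + r4 *: eps c D).
  rewrite [eps _ (r1 *: _)]linearZ /= [eps _ (_ + r4 *: D)]linearD /= [eps _ (_ - r3 *: C)]linearB /=.
  rewrite [eps _ (A + _)]linearD /=.
  by rewrite [eps _ (r2 *: _)]linearZ [eps _ (r3 *: _)]linearZ [eps _ (r4 *: _)]linearZ.
rewrite /twist_ext; under eq_bigr => c _ do rewrite (twist_gh _ _ _ sf sF Ux kF) epsL.
rewrite -scaler_sumr !big_split sumrN /= -!scaler_sumr.
rewrite (sum_eps_lo (symg Ux)) scaler0 addr0.
have -> : \sum_c eps c (epsv (fun b => ups b x) (iot c (F x))) =
    - (k%:R *: \sum_c eps c (ups c x *: F x)).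
  have -> : \sum_c eps c (ups c x *: F x) = epsv (fun b => ups b x) (F x).
    by rewrite /epsv; apply: eq_bigr => c _; rewrite linearZ.
  transitivity (- \sum_c epsv (fun b => ups b x) (eps c (iot c (F x)))).
    by rewrite -sumrN; apply: eq_bigr => c _; exact: eps_epsv.
  by rewrite -linear_sum (sum_eps_iot kF) [X in - X = _]linearZ.
congr (_ *: _); rewrite -natr1.
by apply: funext => s; rewrite !FE; ring.
Qed.

(** A rescaling adds the contraction of T with grad log Om to Y and
    d log Om /\ T to X; the other terms cancel for weight k + 1. *)
Lemma killing_conformal k T X Y c x : smoothF U T -> U x -> kform k (T x) ->
  covD g c T x = iot c X + lo (g x) c Y -> Y + iotv (upsv x) (T x) = 0 ->
  covD gh c (fun y => Om y ^+ k.+1 *: T y) x =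
  iot c (Om x ^+ k.+1 *: (X + epsv (fun b => ups b x) (T x))).
Proof.
move=> sT Ux kT e1 e2; rewrite (covD_gh_w _ _ sT Ux kT) e1.
have e3 : lo (g x) c Y = - lo (g x) c (iotv (upsv x) (T x)).
  by rewrite -linearN; congr lo; apply/eqP; rewrite -addr_eq0 e2.
rewrite e3 [iot c (_ *: _)]linearZ /= [iot c (_ + _)]linearD /= iot_epsv -natr1.
by apply: funext => s; rewrite !FE; ring.
Qed.

Lemma dual_killing_conformal k T X Y c x : smoothF U T -> U x -> kform k (T x) ->
  covD g c T x = iot c X + lo (g x) c Y -> X + epsv (fun b => ups b x) (T x) = 0 ->
  covD gh c (fun y => Om y ^+ k.+1 *: T y) x =
  lo (gh x) c (Om x ^+ k.+1 *: ((Om x ^+ 2)^-1 *: (Y + iotv (upsv x) (T x)))).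
Proof.
move=> sT Ux kT e1 e2; have O0 := Om0 Ux; rewrite (covD_gh_w _ _ sT Ux kT) e1.
have e3 : iot c X = - (ups c x *: T x - epsv (fun b => ups b x) (iot c (T x))).
  rewrite -iot_epsv -linearN; congr iot; apply/eqP; by rewrite -addr_eq0 e2.
have -> : lo (gh x) c (Om x ^+ k.+1 *: ((Om x ^+ 2)^-1 *: (Y + iotv (upsv x) (T x)))) =
    Om x ^+ k.+1 *: (lo (g x) c Y + lo (g x) c (iotv (upsv x) (T x))).
  have -> : lo (gh x) c = (fun T => Om x ^+ 2 *: lo (g x) c T).
    apply: funext => T'; rewrite /lo /epsv scaler_sumr; apply: eq_bigr => b _.
    by rewrite ghE // mxE scalerA.
  rewrite scalerA [lo _ _ (_ *: _)]linearZ /= scalerA [lo _ _ (_ + _)]linearD /=.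
  by congr (_ *: _); field.
rewrite e3 -natr1.
by apply: funext => s; rewrite !FE; ring.
Qed.

End Conformal.

(** * Changing the chart *)

Section PullDef.
Variables (R : realType) (n : nat).
Local Notation form := (seq 'I_n -> R^o).
Fixpoint pull_rec (J : 'M[R]_n) (s : seq 'I_n) (T : form) : R :=
  if s is b :: s' then pull_rec J s' (iotv (J b) T) else T [::].

(** Pullback of forms by the linear map with matrix J, slot by slot. *)
Definition pull_def J (T : form) : form := fun s => pull_rec J s T.
End PullDef.
HB.lock Definition pull := pull_def.
Arguments pull {R n} J T.

Section Pull.
Variables (R : realType) (n : nat) (J : 'M[R]_n).
Local Notation I := 'I_n.
Local Notation form := (seq 'I_n -> R^o).

Lemma pull_nil T : pull J T [::] = T [::]. Proof. by rewrite pull.unlock. Qed.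
Lemma iot_pull b T : iot b (pull J T) = pull J (iotv (J b) T).
Proof. by apply: funext => s; rewrite iotE pull.unlock. Qed.
Lemma pull_linear : linear (pull J).
Proof.
move=> x T S; apply: funext => s; elim: s T S => [|b s IH] T S; rewrite !FE.
  by rewrite !pull_nil !FE.
by rewrite -!iotE !iot_pull iotv_linear IH !FE.
Qed.
HB.instance Definition _ := GRing.isLinear.Build R form form *:%R (pull J) pull_linear.

Lemma hom_pull k T : hom k T -> hom k (pull J T).
Proof.
move=> hT s; elim: s k T hT => [|c s IH] k T hT hs.
  by rewrite pull_nil hT.
rewrite -iotE iot_pull; case: k hs hT => [|k] hs hT.
  have -> : iotv (J c) T = 0.
    rewrite /iotv big1 // => a _; rewrite (_ : iot a T = 0) ?scaler0 //.
    by apply: funext => u; rewrite iotE hT.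
  by rewrite linear0.
apply: (IH k) => // u hu; rewrite /iotv sumFE big1 // => a _.
by rewrite FE iotE hT ?mulr0.
Qed.
Lemma pull_eps a T : pull J (eps a T) = epsv (fun b => J b a) (pull J T).
Proof.
apply: funext => s; elim: s T => [|c s IH] T.
  by rewrite pull_nil eps_nil /epsv sumFE big1 // => b _; rewrite FE eps_nil mulr0.
rewrite -!iotE iot_pull iotv_eps iot_epsv linearB /= linearZ /= !FE IH.
by rewrite -iot_pull.
Qed.

Lemma epsv_pull (A : I -> form) : \sum_c eps c (\sum_d J c d *: pull J (A d)) = pull J (\sum_d eps d (A d)).
Proof.
under eq_bigr => c _ do rewrite linear_sum /=.
rewrite exchange_big linear_sum; apply: eq_bigr => d _ /=.
rewrite pull_eps /epsv; apply: eq_bigr => c _.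
by rewrite linearZ.
Qed.

(** The inverse metric transforms with the inverse of J, which cancels the two
    factors of J. *)
Lemma up_pull (G : 'M[R]_n) (A : I -> form) : G \in unitmx -> J \in unitmx ->
  \sum_c up (J *m G *m J^T) c (\sum_d J c d *: pull J (A d)) = pull J (\sum_d up G d (A d)).
Proof.
move=> uG uJ.
have E d h : \sum_c \sum_e J c d * invmx (J *m G *m J^T) c e * J e h = invmx G d h.
  have -> : invmx G = J^T *m invmx (J *m G *m J^T) *m J.
    have uX : J *m G *m J^T \in unitmx by rewrite !unitmx_mul uJ uG unitmx_tr uJ.
    have uT : J^T \in unitmx by rewrite unitmx_tr.
    have E1 : J^T *m invmx (J *m G *m J^T) *m J *m G *m J^T = J^T.
      by rewrite -!mulmxA [J *m (G *m J^T)]mulmxA mulVmx ?mulmx1 // -!mulmxA.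
    have E2 : J^T *m invmx (J *m G *m J^T) *m J *m G = 1%:M.
      by apply: (can_inj (mulmxK uT)); rewrite E1 mul1mx.
    by rewrite -[LHS]mul1mx -E2 (mulmxK uG).
  rewrite !mxE exchange_big; apply: eq_bigr => e _ /=.
  by rewrite mxE mulr_suml; apply: eq_bigr => c _; rewrite !mxE.
rewrite linear_sum /=.
have L c : up (J *m G *m J^T) c (\sum_d J c d *: pull J (A d)) =
   \sum_d \sum_h (\sum_e J c d * invmx (J *m G *m J^T) c e * J e h) *: pull J (iot h (A d)).
  rewrite linear_sum; apply: eq_bigr => d _ /=; rewrite linearZ /= upE scaler_sumr.
  under [LHS]eq_bigr => e _ do rewrite iot_pull /iotv linear_sum !scaler_sumr.
  rewrite exchange_big; apply: eq_bigr => h _ /=.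
  by rewrite scaler_suml; apply: eq_bigr => e _; rewrite [pull J (_ *: _)]linearZ /= !scalerA.
under eq_bigr => c _ do rewrite L.
rewrite exchange_big; apply: eq_bigr => d _ /=.
rewrite exchange_big upE linear_sum; apply: eq_bigr => h _ /=.
by rewrite -scaler_suml E linearZ.
Qed.
End Pull.

Section SmoothComp.
Variables (R : realType) (n : nat) (U U' : set 'rV[R]_n).
Hypothesis oU' : open U'.
Variable phi : 'rV[R]_n -> 'rV[R]_n.
Hypothesis sphi : forall d, smooth_on U' (fun y => phi y 0 d).
Hypothesis phiU : forall y, U' y -> U (phi y).

Lemma phi_diff y : U' y -> forall d, differentiable (fun y => phi y 0 d) y.
Proof. by move=> Uy d; exact: (smooth_diff (sphi d)). Qed.

Lemma smooth_comp f : smooth_on U f -> smooth_on U' (fun y => f (phi y)).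
Proof.
move=> sf m; elim: m f sf => [|m IH] f sf.
  move=> y Uy; apply: differentiable_continuous.
  exact: (differentiable_comp (differentiable_rV (phi_diff Uy)) (smooth_diff sf (phiU Uy))).
split=> [y Uy|a].
  exact: (differentiable_comp (differentiable_rV (phi_diff Uy)) (smooth_diff sf (phiU Uy))).
apply: (@Ck_near _ _ _ _ (fun y => \sum_d pd a (fun y => phi y 0 d) y * pd d f (phi y))) => //.
  move=> y Uy; rewrite [RHS](pd_comp a (phi_diff Uy) (smooth_diff sf (phiU Uy))) //.
have sumCk (s : seq 'I_n) (F : 'I_n -> 'rV[R]_n -> R) : (forall d, Ck_on m U' (F d)) ->
    Ck_on m U' (fun y => \sum_(d <- s) F d y).
  move=> H; elim: s => [|d s IHs].
    by under eq_fun => y do rewrite big_nil; exact: Ck_cst.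
  by under eq_fun => y do rewrite big_cons; exact: CkD.
apply: sumCk => d; apply: CkM => //; last by apply: IH; exact: smooth_pd.
exact: (smooth_pd a (sphi d)).
Qed.

End SmoothComp.

Section ChartChange.
Variables (R : realType) (n : nat) (U U' : set 'rV[R]_n).
Hypothesis oU : open U.
Hypothesis oU' : open U'.
Local Notation I := 'I_n.
Local Notation form := (seq 'I_n -> R^o).
Local Notation pt := 'rV[R]_n.
Variable phi : pt -> pt.
Hypothesis sphi : forall d, smooth_on U' (fun y => phi y 0 d).
Hypothesis phiU : forall y, U' y -> U (phi y).
Variables (g g' : pt -> 'M[R]_n).
Hypothesis mg : local_metric U g.
Hypothesis mg' : local_metric U' g'.
Let sg : forall a b, smooth_on U (fun y => g y a b) := let: And3 h _ _ := mg in h.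
Let symg : forall x, U x -> (g x)^T = g x := let: And3 _ h _ := mg in h.
Let ug : forall x, U x -> g x \in unitmx := let: And3 _ _ h := mg in h.
Let ug' : forall x, U' x -> g' x \in unitmx := let: And3 _ _ h := mg' in h.
Variable J : pt -> 'M[R]_n.
Hypothesis JE : forall y, U' y -> forall b a, J y b a = pd b (fun y => phi y 0 a) y.
Hypothesis gE' : forall y, U' y -> g' y = J y *m g (phi y) *m (J y)^T.

Lemma smooth_J b a : smooth_on U' (fun y => J y b a).
Proof.
apply: (smooth_near oU' (f := pd b (fun y => phi y 0 a))); last exact: smooth_pd.
by move=> y Uy; rewrite JE.
Qed.

Lemma unitJ y : U' y -> J y \in unitmx.
Proof.
move=> Uy; have := ug' Uy; rewrite gE' // -mulmxA unitmx_mul => /andP[]//.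
Qed.

Lemma pdJC c b a y : U' y -> pd c (fun y => J y b a) y = pd b (fun y => J y c a) y.
Proof.
move=> Uy.
rewrite (@pd_on _ _ c _ (pd b (fun y => phi y 0 a)) U' y oU' Uy); last by move=> z Uz; rewrite JE.
rewrite (@pd_on _ _ b _ (pd c (fun y => phi y 0 a)) U' y oU' Uy); last by move=> z Uz; rewrite JE.
exact: (pdC c b oU' (sphi a) Uy).
Qed.

Lemma pd_phi f c y : smooth_on U f -> U' y ->
  pd c (fun y => f (phi y)) y = \sum_d J y c d * pd d f (phi y).
Proof.
move=> sf Uy; rewrite (pd_comp c (phi_diff sphi Uy) (smooth_diff sf (phiU Uy))).
by apply: eq_bigr => d _; rewrite JE.
Qed.

Lemma g'E y b d : U' y -> g' y b d = \sum_p \sum_q J y b p * J y d q * g (phi y) p q.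
Proof.
move=> Uy; rewrite gE' // mxE exchange_big; apply: eq_bigr => q _ /=.
rewrite !mxE mulr_suml; apply: eq_bigr => p _.
by rewrite mulrAC.
Qed.

Lemma pd_g' c b d y : U' y -> pd c (fun y => g' y b d) y =
  \sum_p \sum_q pd c (fun y => J y b p) y * J y d q * g (phi y) p q +
  \sum_p \sum_q pd c (fun y => J y d q) y * J y b p * g (phi y) p q +
  \sum_p \sum_q \sum_r J y b p * J y d q * J y c r * pd r (fun z => g z p q) (phi y).
Proof.
move=> Uy.
have dJ p q : differentiable (fun y => J y p q) y by exact: (smooth_diff (smooth_J p q)).
have dg p q : differentiable (fun y => g (phi y) p q) y.
  exact: (smooth_diff (smooth_comp oU' sphi phiU (sg p q))).
rewrite (@pd_on _ _ c _ (fun y => \sum_p \sum_q J y b p * J y d q * g (phi y) p q) U' y oU' Uy); last first.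
  by move=> z Uz; exact: g'E.
rewrite pd_sum; last first.
  by move=> p _; apply: differentiable_bigsum => q _; do !apply: differentiableM.
rewrite -!big_split; apply: eq_bigr => p _ /=.
rewrite pd_sum; last by move=> q _; do !apply: differentiableM.
rewrite -!big_split; apply: eq_bigr => q _ /=.
rewrite pdM //; last exact: differentiableM.
rewrite pdM // (@pd_phi (fun z => g z p q) c y) // mulr_sumr.
under [X in _ + X = _]eq_bigr => r _ do rewrite mulrA.
move: (pd c _ y) (pd c _ y) (\sum_ _ _) => u1 u2 u3; ring.
Qed.

(** The lowered symbols of the pulled back metric.  The second derivatives of
    the coordinate change, symmetric in c and b, occur six times and four of them
    cancel. *)
Lemma chrL_change d c b y : U' y -> chrL g' d c b y =
  \sum_e J y d e * (\sum_p \sum_q J y c p * J y b q * chrL g e p q (phi y)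
                    + \sum_h g (phi y) e h * pd c (fun y => J y b h) y).
Proof.
move=> Uy.
pose A p b q := pd p (fun y => J y b q) y.
pose B c b d := \sum_p \sum_q A c b p * J y d q * g (phi y) p q.
pose D r p q := pd r (fun z => g z p q) (phi y).
pose E c b d := \sum_p \sum_q \sum_r J y b p * J y d q * J y c r * D r p q.
have gC p q : g (phi y) p q = g (phi y) q p by exact: (gE mg p q (phiU Uy)).
have pdg c' b' d' : pd c' (fun y => g' y b' d') y = B c' b' d' + B c' d' b' + E c' b' d'.
  rewrite pd_g' //; congr (_ + _ + _).
  rewrite /B exchange_big; apply: eq_bigr => p _; apply: eq_bigr => q _.
  by rewrite (gC q p).
have BC c' b' d' : B c' b' d' = B b' c' d'.
  by rewrite /B; apply: eq_bigr => p _; apply: eq_bigr => q _; rewrite /A (pdJC _ _ _ Uy).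
rewrite chrLE (pdg c b d) (pdg b c d) (pdg d c b) (BC b c d) (BC d c b) (BC d b c).
have -> : 2^-1 * (B c b d + B c d b + E c b d + (B c b d + B b d c + E b c d)
    - (B c d b + B b d c + E d c b)) = 2^-1 * (E c b d + E b c d - E d c b) + B c b d.
  by move: (B c b d) (B c d b) (B b d c) (E c b d) (E b c d) (E d c b) => u1 u2 u3 u4 u5 u6; field.
have E1 : E c b d = \sum_e \sum_p \sum_q J y d e * J y c p * J y b q * D p q e.
  rewrite /E exchange_big; apply: eq_bigr => e _ /=.
  rewrite exchange_big; apply: eq_bigr => p _; apply: eq_bigr => q _.
  by move: (D _ _ _) => u; ring.
have E2 : E b c d = \sum_e \sum_p \sum_q J y d e * J y c p * J y b q * D q p e.
  rewrite /E exchange_big; apply: eq_bigr => e _ /=.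
  apply: eq_bigr => p _; apply: eq_bigr => q _.
  by rewrite [J y c p * _]mulrC.
have E3 : E d c b = \sum_e \sum_p \sum_q J y d e * J y c p * J y b q * D e p q.
  rewrite /E; under eq_bigr => p _ do rewrite exchange_big.
  rewrite exchange_big; apply: eq_bigr => e _ /=; apply: eq_bigr => p _; apply: eq_bigr => q _.
  by move: (D _ _ _) => u; ring.
have E4 : B c b d = \sum_e J y d e * \sum_h g (phi y) e h * pd c (fun y => J y b h) y.
  rewrite /B exchange_big; apply: eq_bigr => e _ /=.
  rewrite mulr_sumr; apply: eq_bigr => h _.
  by rewrite (gC h e) /A; move: (pd _ _ _) => u; ring.
have E5 : 2^-1 * (E c b d + E b c d - E d c b) =
    \sum_e J y d e * \sum_p \sum_q J y c p * J y b q * chrL g e p q (phi y).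
  rewrite E1 E2 E3 -big_split -sumrB mulr_sumr; apply: eq_bigr => e _ /=.
  rewrite -big_split -sumrB !mulr_sumr; apply: eq_bigr => p _ /=.
  rewrite -big_split -sumrB !mulr_sumr; apply: eq_bigr => q _ /=.
  rewrite chrLE /D.
  move: (pd p _ _) (pd q _ _) (pd e _ _) => u1 u2 u3; by field.
rewrite E5 E4 -big_split; apply: eq_bigr => e _ /=.
by rewrite mulrDr.
Qed.

(** [chrL_change] with the index raised: both sides agree after multiplication
    by the invertible matrix J g. *)
Lemma christoffel_change c b f y : U' y ->
  \sum_d christoffel g' d c b y * J y d f =
  \sum_p \sum_q christoffel g f p q (phi y) * J y c p * J y b q + pd c (fun y => J y b f) y.
Proof.
move=> Uy.
pose v : 'cV[R]_n := \col_f \sum_d christoffel g' d c b y * J y d f.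
pose w : 'cV[R]_n := \col_f (\sum_p \sum_q christoffel g f p q (phi y) * J y c p * J y b q + pd c (fun y => J y b f) y).
suff /matrixP/(_ f 0) : v = w by rewrite !mxE.
have uJg : J y *m g (phi y) \in unitmx by rewrite unitmx_mul unitJ // ug //; exact: phiU.
apply: (can_inj (mulKmx uJg)); rewrite -!mulmxA; apply/matrixP => d z.
have -> : (J y *m (g (phi y) *m v)) d z = chrL g' d c b y.
  rewrite -(lower_christoffel mg' d c b Uy) mulmxA mxE.
  have vE h : v h z = \sum_d0 christoffel g' d0 c b y * J y d0 h by rewrite /v mxE.
  under eq_bigr => h _ do rewrite vE mulr_sumr.
  rewrite exchange_big; apply: eq_bigr => e _ /=.
  rewrite gE' // [in RHS]mxE mulr_suml; apply: eq_bigr => h _.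
  by rewrite [(J y)^T h e]mxE [X in _ * X = _]mulrC mulrA.
rewrite chrL_change // mxE; apply: eq_bigr => e _; congr (_ * _).
have wE h : w h z = \sum_p \sum_q christoffel g h p q (phi y) * J y c p * J y b q
    + pd c (fun y => J y b h) y by rewrite /w mxE.
rewrite mxE; under [RHS]eq_bigr => h _ do rewrite wE mulrDr.
rewrite big_split; congr (_ + _) => /=.
under eq_bigr => p _ do under eq_bigr => q _ do
  rewrite -(lower_christoffel mg e p q (phiU Uy)) mulr_sumr.
under eq_bigr => p _ do rewrite exchange_big.
rewrite exchange_big; apply: eq_bigr => h _ /=.
rewrite mulr_sumr; apply: eq_bigr => p _; rewrite mulr_sumr; apply: eq_bigr => q _.
move: (christoffel _ _ _ _ _) => u; ring.
Qed.

(** The Leibniz rule over the slots of the pullback. *)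
Lemma pdF_pull c (F : pt -> form) y : smoothF U' F -> (forall z, U' z -> alt (F z)) -> U' y ->
  pdF c (fun y => pull (J y) (F y)) y =
  \sum_b \sum_f pd c (fun y => J y b f) y *: eps b (pull (J y) (iot f (F y)))
  + pull (J y) (pdF c F y).
Proof.
move=> sF aF Uy; apply: funext => s; elim: s F sF aF => [|b0 s IH] F sF aF.
  rewrite FE pdFE pull_nil pdFE sumFE big1 ?add0r => [|b _].
    by under eq_fun => z do rewrite pull_nil.
  by rewrite sumFE big1 // => f _; rewrite FE eps_nil mulr0.
have -> : pdF c (fun y => pull (J y) (F y)) y (b0 :: s) =
    pdF c (fun y => pull (J y) (iotv (J y b0) (F y))) y s.
  by rewrite !pdFE; under eq_fun => z do rewrite -iotE iot_pull.
have sJ b : smooth_on U' (fun y => J y b0 b) by exact: smooth_J.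
rewrite IH; last 2 first.
- exact: smoothF_iotv.
- by move=> z Uz; apply/alt_iotv/aF.
rewrite -[RHS]iotE; apply: (congr1 (fun T : form => T s)).
rewrite (pdF_iotv oU' c sJ sF Uy) [pull _ (_ + _)]linearD /= [RHS]linearD /= iot_pull addrA; congr (_ + _).
rewrite [RHS]linear_sum /=.
have E b : iot b0 (\sum_f pd c (fun y => J y b f) y *: eps b (pull (J y) (iot f (F y)))) =
   (b0 == b)%:R *: pull (J y) (iotv (fun f => pd c (fun y => J y b f) y) (F y))
   + \sum_f pd c (fun y => J y b f) y *: eps b (pull (J y) (iot f (iotv (J y b0) (F y)))).
  rewrite [in RHS]linear_sum /= scaler_sumr linear_sum -big_split; apply: eq_bigr => f _ /=.
  rewrite linearZ /= iot_eps iot_pull [pull _ (_ *: _)]linearZ /=.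
  rewrite (iot_iotv _ _ (aF y Uy)) linearN /= [eps b (- _)]linearN /=.
  by apply: funext => u; rewrite !FE; ring.
under [RHS]eq_bigr => b _ do rewrite E.
by rewrite big_split /= sum_delta addrC.
Qed.

(** Naturality of the Levi-Civita connection: the inhomogeneous term in the
    change of the Christoffel symbols cancels the derivative of the Jacobian in
    [pdF_pull]. *)
Lemma covD_change k (F F' : pt -> form) c y : smoothF U F -> (forall z, U z -> kform k (F z)) ->
  (forall z, U' z -> F' z = pull (J z) (F (phi z))) -> U' y ->
  covD g' c F' y = \sum_d J y c d *: pull (J y) (covD g d F (phi y)).
Proof.
move=> sF kF E Uy.
have aF z : U' z -> alt (F (phi z)) by move=> Uz; exact: (proj1 (kF _ (phiU Uz))).
have sFp : smoothF U' (fun z => F (phi z)).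
  by move=> s; exact: (smooth_comp oU' sphi phiU (sF s)).
rewrite covDE (pdF_on oU' c E Uy) (pdF_pull c sFp aF Uy) E //.
have E1 : pdF c (fun z => F (phi z)) y = \sum_d J y c d *: pdF d F (phi y).
  apply: funext => s; rewrite pdFE sumFE (pd_phi c (sF s) Uy).
  by apply: eq_bigr => d _; rewrite FE pdFE.
have E2 : gl (fun b d => christoffel g' d c b y) (pull (J y) (F (phi y))) =
   \sum_b \sum_f (\sum_p \sum_q christoffel g f p q (phi y) * J y c p * J y b q
      + pd c (fun y => J y b f) y) *: eps b (pull (J y) (iot f (F (phi y)))).
  rewrite /gl; apply: eq_bigr => b _.
  under eq_bigr => d _ do rewrite iot_pull /iotv linear_sum linear_sum scaler_sumr /=.
  rewrite exchange_big; apply: eq_bigr => f _ /=.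
  rewrite -christoffel_change // scaler_suml; apply: eq_bigr => d _.
  by rewrite [pull _ (_ *: _)]linearZ /= [eps b (_ *: _)]linearZ /= scalerA.
rewrite E2 E1.
have E3 d : pull (J y) (covD g d F (phi y)) = pull (J y) (pdF d F (phi y)) -
   \sum_b \sum_f \sum_q (christoffel g f d q (phi y) * J y b q) *: eps b (pull (J y) (iot f (F (phi y)))).
  rewrite covDE linearB; congr (_ - _).
  rewrite /gl linear_sum /=.
  under eq_bigr => q _ do (rewrite linear_sum /=; under eq_bigr => f _ do
    rewrite linearZ /= pull_eps /epsv scaler_sumr).
  under eq_bigr => q _ do rewrite exchange_big.
  rewrite exchange_big; apply: eq_bigr => b _ /=.
  rewrite exchange_big; apply: eq_bigr => f _ /=; apply: eq_bigr => q _.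
  by rewrite scalerA.
under [RHS]eq_bigr => d _ do rewrite E3 scalerBr.
rewrite sumrB linear_sum /=.
under [X in _ + X - _ = _]eq_bigr => d _ do rewrite linearZ /=.
rewrite addrAC addrC; congr (_ + _).
rewrite -sumrB -sumrN.
under [RHS]eq_bigr => d _ do rewrite scaler_sumr -sumrN.
rewrite [RHS]exchange_big; apply: eq_bigr => b _ /=.
rewrite -sumrB.
under [RHS]eq_bigr => d _ do rewrite scaler_sumr -sumrN.
rewrite [RHS]exchange_big; apply: eq_bigr => f _ /=.
rewrite -scalerBl opprD addrA addrAC subrr add0r scaleNr sumrN; congr (- _).
rewrite scaler_suml; apply: eq_bigr => p _; rewrite scaler_suml scaler_sumr; apply: eq_bigr => q _.
by rewrite scalerA; congr (_ *: _); move: (christoffel _ _ _ _ _) => u; ring.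
Qed.

End ChartChange.

(** * Components of the constructions as operators on forms *)

Section Bridge.
Variables (R : realType) (n : nat).
Local Notation I := 'I_n.
Local Notation form := (seq 'I_n -> R^o).
Local Notation pt := 'rV[R]_n.

(** Tensoriality of components is [pull]. *)
Lemma lf_bigtuple (J : 'M[R]_n) k (T : k.-tuple I -> R) :
  lf (fun b : k.-tuple I => \sum_(a : k.-tuple I) (\prod_(r < k) J (tnth b r) (tnth a r)) * T a)
  = pull J (lf T).
Proof.
elim: k T => [|k IH] T.
  apply: (@hom_lfP _ _ 0); [exact: lf_hom|exact/hom_pull/lf_hom|move=> t].
  rewrite lfE (tuple0 t) /= pull_nil -[ [::] ]/(val [tuple]) lfE (big_pred1 [tuple]).
    by rewrite big_ord0 mul1r.
  by move=> a; symmetry; apply/eqP; exact: tuple0.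
apply: formP => [b|]; last first.
  by rewrite lf_hom // (hom_pull J (lf_hom T)).
rewrite iot_lf iot_pull /iotv.
under eq_bigr => a _ do rewrite iot_lf -lfZ.
rewrite -lf_sum -IH; congr lf; apply: funext => t.
rewrite (reindex (fun p : I * k.-tuple I => cons_tuple p.1 p.2)) /=; last first.
  exists (fun a : k.+1.-tuple I => (thead a, behead_tuple a)) => [[a u] _|a _] /=.
    by rewrite theadE; congr pair; apply: val_inj.
  by rewrite [RHS]tuple_eta.
rewrite -(pair_bigA _ (fun a u => (\prod_(r < k.+1) J (tnth (cons_tuple b t) r) (tnth (cons_tuple a u) r)) * T (cons_tuple a u))) /=.
rewrite exchange_big; apply: eq_bigr => u _ /=.
rewrite mulr_sumr; apply: eq_bigr => a _.
rewrite big_ord_recl [tnth _ ord0](tnth_nth b) [tnth (cons_tuple a u) ord0](tnth_nth b) /= -mulrA mulrCA; congr (_ * _).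
apply: eq_bigr => r _.
by rewrite !(tnth_nth b) /=.
Qed.

Variables (g : pt -> 'M[R]_n).
Variables (i0 : I).

Lemma glE0 A (T : form) s : alt T -> gl A T s =
  \sum_(r < size s) \sum_d A (nth i0 s r) d * T (take r s ++ d :: drop r.+1 s).
Proof.
move=> aT; rewrite glE //; apply: eq_bigr => r _; apply: eq_bigr => d _.
by rewrite (tnth_nth i0).
Qed.

Lemma val_replace_index k (a : k.-tuple I) (r : 'I_k) d :
  val (replace_index a r d) = take r a ++ d :: drop r.+1 a.
Proof.
have rk : (r <= k)%N by rewrite ltnW.
have sz : size (take r a ++ d :: drop r.+1 a) = k.
  by rewrite size_cat /= size_takel ?size_drop size_tuple // addnS -addSn subnKC.
apply: (@eq_from_nth _ d); first by rewrite sz size_tuple.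
rewrite size_tuple => q qk.
rewrite -[q]/(val (Ordinal qk)) -tnth_nth tnth_mktuple (tnth_nth d) /=.
rewrite nth_cat size_takel ?size_tuple //.
rewrite -val_eqE /=; case: ltngtP => [qr|qr|->].
- by rewrite nth_take.
- by rewrite -[(q - r)%N]prednK ?subn_gt0 //= nth_drop; congr nth; lia.
- by rewrite subnn.
Qed.

Lemma pdF_lf k (T : pt -> k.-tuple I -> R) c x :
  pdF c (fun y => lf (T y)) x = lf (fun a => pd c (fun y => T y a) x).
Proof.
apply: (@hom_lfP _ _ k); [|exact: lf_hom|].
  by move=> s hs; rewrite pdFE; under eq_fun => y do rewrite lf_hom //; exact: pd_cst.
by move=> t; rewrite pdFE lfE; under eq_fun => y do rewrite lfE.
Qed.

Lemma smoothF_lf U k (T : pt -> k.-tuple I -> R) : (forall a, smooth_on U (fun y => T y a)) ->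
  smoothF U (fun y => lf (T y)).
Proof.
move=> sT s; have [/eqP hs|hs] := eqVneq (size s) k; last first.
  by under eq_fun => y do rewrite lf_hom //; exact: smooth_cst.
by under eq_fun => y do rewrite (lfE _ (Tuple hs)); exact: sT.
Qed.

(** The index i0 only serves as a default value in list lookups. *)
Lemma lf_nabla k (T : pt -> k.-tuple I -> R) x c : kform k (lf (T x)) ->
  lf (nabla g T x c) = covD g c (fun y => lf (T y)) x.
Proof.
move=> kT; rewrite covDE pdF_lf /nabla lfB; congr (_ - _).
apply: (@hom_lfP _ _ k); [exact: lf_hom|exact: (proj2 (kform_gl _ kT))|move=> a].
rewrite lfE glE0 ?size_tuple; last exact: (proj1 kT).
apply: eq_bigr => r _; apply: eq_bigr => d _.
by rewrite (tnth_nth i0) -val_replace_index lfE.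
Qed.

Lemma lf_rcons m (T : m.+1.-tuple I -> R) p : kform m.+1 (lf T) ->
  lf (fun a : m.-tuple I => T (rcons_tuple a p)) = (-1) ^+ m *: iot p (lf T).
Proof.
move=> kT; apply: (@hom_lfP _ _ m); [exact: lf_hom| |move=> a].
  by move=> s hs; rewrite FE (proj2 (kform_iot p kT)) // mulr0.
rewrite lfE FE -[T _](lfE T) (alt_rcons a p (proj1 kT)) size_tuple //.
Qed.

(** The sign comes from the contracted slot being the last one. *)
Lemma lf_sigma_up f m (T : pt -> m.+1.-tuple I -> R) x : (g x)^T = g x ->
  kform m.+1 (lf (T x)) -> (forall q, kform m.+1 (covD g q (fun y => lf (T y)) x)) ->
  lf (sigma_up_local g f T x) =
  (-1) ^+ m *: twist_div g f (n%:R - m.+1%:R + 1) (fun y => lf (T y)) x.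
Proof.
move=> sg kT kD; rewrite /sigma_up_local.
set r := n%:R - m.+1%:R + 1.
rewrite lfB !lfZ !lf_sum.
under eq_bigr => p _ do rewrite lf_sum.
under [X in _ - _ *: X]eq_bigr => p _ do rewrite lf_sum.
under eq_bigr => p _ do under eq_bigr => q _ do rewrite lfZ lf_rcons ?lf_nabla //.
under [X in _ - _ *: X]eq_bigr => p _ do under eq_bigr => q _ do rewrite lfZ lf_rcons //.
rewrite exchange_big [X in _ - _ *: X]exchange_big /twist_div /= !scaler_sumr.
rewrite -sumrB; apply: eq_bigr => c _.
rewrite [up (g x) c _]upE !scaler_sumr -sumrB; apply: eq_bigr => p _.
rewrite /twist linearB !linearZ /= (symHE sg p c).
by apply: funext => s; rewrite !FE; ring.
Qed.

Lemma last_slot_lf k h (T : k.+1.-tuple I -> R) : last_slot h (lf T) = lf (fun t => T (rcons_tuple t h)).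
Proof.
apply: (@hom_lfP _ _ k); [|exact: lf_hom|].
  by move=> s hs; rewrite /last_slot lf_hom // size_rcons.
by move=> t; rewrite /last_slot lfE -[RHS](lfE T).
Qed.

Lemma belast_rcons k (t : k.-tuple I) h :
  belast_tuple (thead (rcons_tuple t h)) (behead_tuple (rcons_tuple t h)) = t.
Proof.
apply: val_inj => /=; rewrite /thead (tnth_nth h) /=.
by case: (val t) => [//|b s] /=; rewrite belast_rcons.
Qed.

Lemma tnth_rcons k (t : k.-tuple I) h : tnth (rcons_tuple t h) ord_max = h.
Proof. by rewrite (tnth_nth h) /= nth_rcons size_tuple ltnn eqxx. Qed.

(** The sign and the factor come from skew-symmetrising with the derivative
    index written last. *)
Lemma lf_sigma_down f k (T : pt -> k.-tuple I -> R) x : 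
  kform k (lf (T x)) -> (forall q, kform k (covD g q (fun y => lf (T y)) x)) ->
  lf (sigma_down_local g f T x) =
  ((-1) ^+ k / k.+1%:R) *: twist_ext g f k.+1%:R (fun y => lf (T y)) x.
Proof.
move=> kT kD; rewrite /sigma_down_local lf_skew sk_last; last exact: lf_hom.
congr (_ *: _); apply: eq_bigr => c _; congr (eps c _).
rewrite last_slot_lf /=.
have -> : (fun t : k.-tuple I =>
      f x * nabla g T x (tnth (rcons_tuple t c) ord_max)
        (belast_tuple (thead (rcons_tuple t c)) (behead_tuple (rcons_tuple t c))) -
      k.+1%:R * pd (tnth (rcons_tuple t c) ord_max) f x *
      T x (belast_tuple (thead (rcons_tuple t c)) (behead_tuple (rcons_tuple t c)))) =
    (fun t => f x * nabla g T x c t - k.+1%:R * pd c f x * T x t).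
  by apply: funext => t; rewrite belast_rcons tnth_rcons.
rewrite lfB !lfZ lf_nabla // sk_id //.
by apply: kformB; apply: kformZ.
Qed.

Lemma lf_weyl_up m (T : pt -> m.+2.-tuple I -> R) x c : kform m.+2 (lf (T x)) ->
  lf (weyl_up_local g T x c) = (- m.+1%:R^-1) *: weyl_int g x c (lf (T x)).
Proof.
move=> kT; rewrite /weyl_up_local lf_skew /= scaleNr -scalerN; congr (_ *: _).
rewrite /weyl_int -sumrN; apply: eq_bigr => a _; rewrite -linearN; congr (eps a _).
rewrite iot_lf.
have -> : (fun t : m.-tuple I => \sum_p \sum_q
   (\sum_r \sum_s weyl g x c (thead (cons_tuple a t)) r s * invmx (g x) r p * invmx (g x) s q) *
   T x (rcons_tuple (rcons_tuple (behead_tuple (cons_tuple a t)) p) q)) =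
  (fun t => \sum_p \sum_q (\sum_r \sum_s weyl g x c a r s * invmx (g x) r p * invmx (g x) s q) *
    T x (rcons_tuple (rcons_tuple t p) q)).
  apply: funext => t; rewrite theadE (_ : behead_tuple (cons_tuple a t) = t) //.
  exact: val_inj.
have L p q : lf (fun t : m.-tuple I => T x (rcons_tuple (rcons_tuple t p) q)) =
    - iot p (iot q (lf (T x))).
  have k1 : kform m.+1 (lf (fun u => T x (rcons_tuple u q))).
    by rewrite lf_rcons //; apply/kformZ/(kform_iot q kT).
  rewrite (lf_rcons p k1) lf_rcons // linearZ /= scalerA exprS mulrCA -expr2.
  by rewrite sqrr_sign mulr1 scaleN1r.
have -> : lf (fun t : m.-tuple I => \sum_p \sum_q
    (\sum_r \sum_s weyl g x c a r s * invmx (g x) r p * invmx (g x) s q) *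
    T x (rcons_tuple (rcons_tuple t p) q)) =
  - \sum_r \sum_s weyl g x c a r s *: up (g x) r (up (g x) s (lf (T x))).
  rewrite lf_sum; under eq_bigr => p _ do rewrite lf_sum.
  under eq_bigr => p _ do under eq_bigr => q _ do rewrite lfZ L scalerN scaler_suml.
  under eq_bigr => p _ do under eq_bigr => q _ do under eq_bigr => r _ do rewrite scaler_suml.
  under eq_bigr => p _ do rewrite sumrN.
  rewrite sumrN; congr (- _).
  have U r s : weyl g x c a r s *: up (g x) r (up (g x) s (lf (T x))) =
    \sum_p \sum_q (weyl g x c a r s * invmx (g x) r p * invmx (g x) s q) *: iot p (iot q (lf (T x))).
    rewrite upE scaler_sumr; apply: eq_bigr => p _.
    rewrite upE linear_sum !scaler_sumr; apply: eq_bigr => q _ /=.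
    by rewrite [iot p _]linearZ /= !scalerA.
  under [RHS]eq_bigr => r _ do under eq_bigr => s _ do rewrite U.
  under [RHS]eq_bigr => r _ do rewrite exchange_big.
  rewrite [RHS]exchange_big; apply: eq_bigr => p _ /=.
  under [RHS]eq_bigr => r _ do rewrite exchange_big.
  by rewrite [RHS]exchange_big.
rewrite sk_id //; apply/kformN/kform_sum => r _; apply: kform_sum => s _; apply/kformZ.
exact: (kform_up _ r (kform_up _ s kT)).
Qed.

Lemma lf_weyl_down m (T : pt -> m.+1.-tuple I -> R) x c : kform m.+1 (lf (T x)) ->
  lf (weyl_down_local g T x c) = (- (m.+2%:R^-1 * m.+1%:R^-1)) *: weyl_ext g x c (lf (T x)).
Proof.
move=> kT; rewrite /weyl_down_local lf_skew sk_last; last exact: lf_hom.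
rewrite /weyl_ext !scaler_sumr; apply: eq_bigr => h _; rewrite -[LHS]linearZ -[RHS]linearZ /=; congr (eps h _).
rewrite scalerA.
rewrite !scaler_sumr; apply: eq_bigr => b _; rewrite -[LHS]linearZ -[RHS]linearZ /=; congr (eps b _).
rewrite last_slot_lf iot_lf.
have -> : (fun t : m.-tuple I => \sum_p (\sum_r weyl g x c
     (tnth (rcons_tuple (cons_tuple b t) h) ord_max) (thead (rcons_tuple (cons_tuple b t) h)) r * invmx (g x) r p) *
     T x (rcons_tuple (behead_tuple (belast_tuple (thead (rcons_tuple (cons_tuple b t) h))
          (behead_tuple (rcons_tuple (cons_tuple b t) h)))) p)) =
   (fun t => \sum_p (\sum_r weyl g x c h b r * invmx (g x) r p) * T x (rcons_tuple t p)).
  apply: funext => t; rewrite belast_rcons tnth_rcons.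
  rewrite (_ : behead_tuple (cons_tuple b t) = t); last exact: val_inj.
  by rewrite (_ : thead _ = b) // /thead (tnth_nth h).
have -> : lf (fun t : m.-tuple I => \sum_p (\sum_r weyl g x c h b r * invmx (g x) r p) * T x (rcons_tuple t p)) =
  (-1) ^+ m *: \sum_r weyl g x c h b r *: up (g x) r (lf (T x)).
  rewrite lf_sum; under eq_bigr => p _ do rewrite lfZ lf_rcons // scaler_suml.
  rewrite exchange_big scaler_sumr; apply: eq_bigr => r _ /=.
  rewrite upE !scaler_sumr; apply: eq_bigr => p _.
  by rewrite !scalerA; congr (_ *: _); ring.
rewrite sk_id; last first.
  by apply/kformZ/kform_sum => r _; apply/kformZ/(kform_up _ r kT).
rewrite scalerA; congr (_ *: _); rewrite exprS.
have : (-1) ^+ m * (-1) ^+ m = 1 :> R by rewrite -expr2 sqrr_sign.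
move: ((-1) ^+ m) => e e2.
transitivity (- (m.+2%:R^-1 * m.+1%:R^-1) * (e * e)); last by rewrite e2 mulr1.
ring.
Qed.

End Bridge.

Section SmoothWeyl.
Variables (R : realType) (n : nat) (U : set 'rV[R]_n) (g : 'rV[R]_n -> 'M[R]_n).
Hypothesis oU : open U.
Hypothesis mg : local_metric U g.
Local Notation form := (seq 'I_n -> R^o).
Let sg : forall a b, smooth_on U (fun y => g y a b) := let: And3 h _ _ := mg in h.

Lemma smooth_curvature a b c d : smooth_on U (fun y => curvature g y a b c d).
Proof.
have sG p q r := smooth_christoffel oU mg p q r.
apply: smoothD => //; first by apply: smoothB => //; exact: smooth_pd.
by apply: smooth_sum => // e _; apply: smoothB => //; apply: smoothM.
Qed.
Lemma smooth_schouten a b : smooth_on U (fun y => schouten g y a b).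
Proof.
have sR p q : smooth_on U (fun y => ricci g y p q).
  by apply: smooth_sum => // e _; exact: smooth_curvature.
apply: smoothM => //; first exact: smooth_cst.
apply: smoothB => //; apply: smoothM => //; apply: smoothM => //; last exact: smooth_cst.
apply: smooth_sum => // p _; apply: smooth_sum => // q _; apply: smoothM => //.
exact: (smooth_inv oU mg).
Qed.
Lemma smooth_weyl a b c d : smooth_on U (fun y => weyl g y a b c d).
Proof.
have sS := smooth_schouten.
apply: smoothB => //; [apply: smoothB => //|].
- apply: smooth_sum => // e _; apply: smoothM => //; exact: smooth_curvature.
- by apply: smoothB => //; apply: smoothM.
- by apply: smoothB => //; apply: smoothM.
Qed.

Lemma smoothF_weyl_int a (F : 'rV[R]_n -> form) : smoothF U F -> smoothF U (fun y => weyl_int g y a (F y)).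
Proof.
move=> sF; apply: smoothF_sum => // e _; apply: smoothF_eps => //.
apply: smoothF_sum => // c _; apply: smoothF_sum => // f _.
apply: smoothFZ => //; first exact: smooth_weyl.
by apply: (smoothF_up oU mg); apply: (smoothF_up oU mg).
Qed.
Lemma smoothF_weyl_ext a (F : 'rV[R]_n -> form) : smoothF U F -> smoothF U (fun y => weyl_ext g y a (F y)).
Proof.
move=> sF; apply: smoothF_sum => // c _; apply: smoothF_eps => //.
apply: smoothF_sum => // e _; apply: smoothF_eps => //.
apply: smoothF_sum => // f _; apply: smoothFZ => //; first exact: smooth_weyl.
exact: (smoothF_up oU mg).
Qed.
Lemma smoothF_hookF m (T : 'rV[R]_n -> 'I_n -> form) c : (forall a, smoothF U (fun y => T y a)) ->
  smoothF U (fun y => hookF (g y) m (T y) c).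
Proof.
move=> sT.
have sc (r : R) F : smoothF U F -> smoothF U (fun y => r *: F y).
  by move=> sF; apply: (smoothFZ oU (f := fun=> r)) => //; exact: smooth_cst.
apply: smoothFB => //; [apply: smoothFB => //|].
- apply/sc/smoothF_iot; apply: smoothF_sum => // b _; exact: smoothF_eps.
- apply/sc/(smoothF_lo oU mg); apply: smoothF_sum => // p _; exact: (smoothF_up oU mg).
Qed.

Lemma smoothF_twist f r (F : 'rV[R]_n -> form) c : smooth_on U f -> smoothF U F ->
  smoothF U (fun y => twist g f r F c y).
Proof.
move=> sf sF; apply: smoothFB => //; apply: smoothFZ => //; first exact: (smoothF_covD oU mg).
by apply: smoothM => //; [exact: smooth_cst|exact: smooth_pd].
Qed.
Lemma smoothF_twist_div f r (F : 'rV[R]_n -> form) : smooth_on U f -> smoothF U F ->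
  smoothF U (fun y => twist_div g f r F y).
Proof.
by move=> sf sF; apply: smoothF_sum => // c _; apply: (smoothF_up oU mg); exact: smoothF_twist.
Qed.
Lemma smoothF_twist_ext f r (F : 'rV[R]_n -> form) : smooth_on U f -> smoothF U F ->
  smoothF U (fun y => twist_ext g f r F y).
Proof.
by move=> sf sF; apply: smoothF_sum => // c _; apply: smoothF_eps => //; exact: smoothF_twist.
Qed.
End SmoothWeyl.

(** * The derived forms of a local conformal Killing form *)

Lemma hookFZ (R : realType) n (G : 'M[R]_n) m (x : R) (T : 'I_n -> seq 'I_n -> R^o) c :
  hookF G m (fun a => x *: T a) c = x *: hookF G m T c.
Proof.
rewrite /hookF.
under eq_bigr => b _ do rewrite linearZ.
under [X in _ *: lo G c X]eq_bigr => b _ do rewrite linearZ.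
rewrite /= -!scaler_sumr [iot c (_ *: _)]linearZ [lo G c (_ *: _)]linearZ /=.
move: (iot c _) (lo G c _) (T c) => u v w; apply: funext => s; rewrite !FE; ring.
Qed.

Lemma iotv_iotv0 (R : realType) n (v : 'I_n -> R) (T : seq 'I_n -> R^o) : alt T -> iotv v (iotv v T) = 0.
Proof. by move=> aT; apply: lmod_double0; rewrite -iotv_iotv. Qed.
Lemma epsv_epsv0 (R : realType) n (v : 'I_n -> R) (T : seq 'I_n -> R^o) : epsv v (epsv v T) = 0.
Proof. by apply: lmod_double0; rewrite -epsv_epsv. Qed.

Section Twistor.
Variables (R : realType) (n : nat) (U : set 'rV[R]_n) (g : 'rV[R]_n -> 'M[R]_n).
Hypothesis oU : open U.
Hypothesis n3 : (3 <= n)%N.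
Local Notation form := (seq 'I_n -> R^o).
Local Notation pt := 'rV[R]_n.
Hypothesis mg : local_metric U g.
Let symg : forall x, U x -> (g x)^T = g x := let: And3 _ h _ := mg in h.
Let ug : forall x, U x -> g x \in unitmx := let: And3 _ _ h := mg in h.

Lemma twist_div_on f r (F F' : pt -> form) x : (forall y, U y -> F y = F' y) -> U x ->
  twist_div g f r F x = twist_div g f r F' x.
Proof.
by move=> e Ux; apply: eq_bigr => c _; rewrite /twist e // (covD_on g oU c e Ux).
Qed.
Lemma twist_ext_on f r (F F' : pt -> form) x : (forall y, U y -> F y = F' y) -> U x ->
  twist_ext g f r F x = twist_ext g f r F' x.
Proof.
by move=> e Ux; apply: eq_bigr => c _; rewrite /twist e // (covD_on g oU c e Ux).
Qed.

Variables (m : nat) (S : pt -> form).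
Hypothesis sS : smoothF U S.
Hypothesis kS : forall y, U y -> kform m.+1 (S y).
Hypothesis hookS : forall y, U y -> forall c, hookF (g y) m.+1 (fun a => covD g a S y) c = 0.
Hypothesis mn : (m.+1 < n)%N.

(** The forms rho and tau of the conformal Killing equation, as read off from
    [hookF_eq0]. *)
Definition rhoS y : form := m.+2%:R^-1 *: \sum_b eps b (covD g b S y).
Definition tauS y : form := (n%:R - m.+1%:R + 1)^-1 *: \sum_p up (g y) p (covD g p S y).

Let sc (r : R) F : smoothF U F -> smoothF U (fun y => r *: F y).
Proof. by move=> sF; apply: (smoothFZ oU (f := fun=> r)) => //; exact: smooth_cst. Qed.

Lemma smoothF_rhoS : smoothF U rhoS.
Proof.
by apply/sc/(smoothF_sum oU) => b _; apply: (smoothF_eps oU); exact: (smoothF_covD oU mg).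
Qed.
Lemma smoothF_tauS : smoothF U tauS.
Proof.
by apply/sc/(smoothF_sum oU) => b _; apply: (smoothF_up oU mg); exact: (smoothF_covD oU mg).
Qed.
Lemma kform_rhoS y : U y -> kform m.+2 (rhoS y).
Proof.
by move=> Uy; apply/kformZ/kform_sum => b _; apply/kform_eps/(kform_covD g oU b kS sS Uy).
Qed.
Lemma kform_tauS y : U y -> kform m (tauS y).
Proof.
by move=> Uy; apply/kformZ/kform_sum => b _; apply: (kform_up _ b (kform_covD g oU b kS sS Uy)).
Qed.
Lemma ckeS y : U y -> forall c, covD g c S y = iot c (rhoS y) + lo (g y) c (tauS y).
Proof. by move=> Uy c; rewrite (hookF_eq0 (hookS Uy c)). Qed.

Variable f : pt -> R.
Hypothesis sf : smooth_on U f.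

(** Contracting nabla_c S = iota_c rho + g_c /\ tau leaves only tau. *)
Lemma twist_divE x : U x -> twist_div g f (n%:R - m.+1%:R + 1) S x = (n%:R - m%:R) *: Tup g S tauS f x.
Proof.
move=> Ux; rewrite /twist_div.
have -> : n%:R - m.+1%:R + 1 = n%:R - m%:R :> R by rewrite -natr1; ring.
transitivity (\sum_c (f x *: up (g x) c (iot c (rhoS x)) + f x *: up (g x) c (lo (g x) c (tauS x))
   - (n%:R - m%:R) *: (pd c f x *: up (g x) c (S x)))).
  apply: eq_bigr => c _; rewrite /twist ckeS //; move: (rhoS x) (tauS x) (S x) => u v w.
  rewrite linearB /= [up _ c (_ *: w)]linearZ [up _ c (_ *: (_ + _))]linearZ /=.
  by rewrite [up _ c (_ + _)]linearD scalerDr scalerA.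
rewrite sumrB big_split /= -!scaler_sumr sum_up_iot //; last exact: (kform_rhoS Ux).1.
rewrite (sum_up_lo (symg Ux) (ug Ux) (kform_tauS Ux)) scaler0 add0r.
rewrite /Tup scalerBr scalerA mulrC -scalerA; congr (_ - _ *: _).
rewrite /iotv.
transitivity (\sum_c \sum_e (invmx (g x) c e * pd c f x) *: iot e (S x)).
  by apply: eq_bigr => c _; rewrite upE scaler_sumr; apply: eq_bigr => e _; rewrite scalerA mulrC.
rewrite exchange_big; apply: eq_bigr => e _ /=.
rewrite /grad scaler_suml; apply: eq_bigr => c _.
by rewrite (symHE (symg Ux) c e).
exact: symg.
Qed.

(** Taking the skew part of nabla_c S leaves only rho. *)
Lemma twist_extE x : U x -> twist_ext g f m.+2%:R S x = m.+2%:R *: Tdn S rhoS f x.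
Proof.
move=> Ux; rewrite /twist_ext.
transitivity (\sum_c (f x *: eps c (iot c (rhoS x)) + f x *: eps c (lo (g x) c (tauS x))
   - m.+2%:R *: (pd c f x *: eps c (S x)))).
  apply: eq_bigr => c _; rewrite /twist ckeS //; move: (rhoS x) (tauS x) (S x) => u v w.
  rewrite linearB /= [eps c (_ *: w)]linearZ [eps c (_ *: (_ + _))]linearZ /=.
  by rewrite [eps c (_ + _)]linearD scalerDr scalerA.
rewrite sumrB big_split /= -!scaler_sumr (sum_eps_lo (symg Ux)) scaler0 addr0.
rewrite (sum_eps_iot (kform_rhoS Ux)) /Tdn scalerBr scalerA mulrC -scalerA.
by [].
Qed.

Variable lam : pt -> R.
Hypothesis ae : forall x, U x -> forall a b,
  hessian g f x a b + schouten g x a b * f x = lam x * g x a b.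

Let sT := smoothF_Tup oU mg sS smoothF_tauS sf.
Let kT := kform_Tup g kS kform_tauS f.
Let sN := smoothF_Tdn oU sS smoothF_rhoS sf.
Let kN := kform_Tdn kS kform_rhoS f.

Lemma covD_twist_div a x : U x -> covD g a (twist_div g f (n%:R - m.+1%:R + 1) S) x =
  (n%:R - m%:R) *: covD g a (Tup g S tauS f) x.
Proof. by move=> Ux; rewrite (covD_on g oU a twist_divE Ux) (covDc g a _ sT Ux). Qed.

Lemma covD_twist_ext a x : U x -> covD g a (twist_ext g f m.+2%:R S) x =
  m.+2%:R *: covD g a (Tdn S rhoS f) x.
Proof. by move=> Ux; rewrite (covD_on g oU a twist_extE Ux) (covDc g a _ sN Ux). Qed.

Lemma hook_twist_div c x : (0 < m)%N -> U x ->
  hookF (g x) m (fun a => covD g a (twist_div g f (n%:R - m.+1%:R + 1) S) x) c =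
  (f x * - ((n%:R - m%:R) / (2 * (n%:R - m.+1%:R)))) *: hookF (g x) m (fun a => weyl_int g x a (S x)) c.
Proof.
move=> m0 Ux; under eq_fun => a do rewrite covD_twist_div //.
rewrite hookFZ (hook_Tup oU n3 mg sS smoothF_rhoS smoothF_tauS kS kform_rhoS kform_tauS ckeS Ux sf (ae Ux) c m0 mn).
by rewrite scalerA; congr (_ *: _); ring.
Qed.

Lemma hook_twist_ext c x : U x ->
  hookF (g x) m.+2 (fun a => covD g a (twist_ext g f m.+2%:R S) x) c =
  (f x * (m.+2%:R / m.+1%:R)) *: hookF (g x) m.+2 (fun a => weyl_ext g x a (S x)) c.
Proof.
move=> Ux; under eq_fun => a do rewrite covD_twist_ext //.
rewrite hookFZ (hook_Tdn oU mg sS smoothF_rhoS smoothF_tauS kS kform_rhoS kform_tauS ckeS Ux sf (ae Ux) c mn).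
by rewrite scalerA; congr (_ *: _); ring.
Qed.

Section Scale.
Variables (V : set pt) (gh : pt -> 'M[R]_n) (Om : pt -> R).
Hypothesis oV : open V.
Hypothesis VU : V `<=` U.
Hypothesis f0 : forall y, V y -> f y != 0.
Hypothesis sOm : smooth_on V Om.
Hypothesis OmE : forall y, V y -> Om y ^+ 2 = (f y ^+ 2)^-1.
Hypothesis ghE : forall y, V y -> gh y = Om y ^+ 2 *: g y.

Let mV : local_metric V g.
Proof.
have [a b c] := mg; split=> [p q|x /VU /b //|x /VU /c //].
exact: smooth_sub VU (a p q).
Qed.
Let Om0 y : V y -> Om y != 0.
Proof. by move=> Vy; rewrite -sqrf_eq0 OmE // invr_eq0 sqrf_eq0 f0. Qed.
Let sfV := smooth_sub VU sf.
Let sub F : smoothF U F -> smoothF V F.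
Proof. by move=> sF s; exact: smooth_sub VU (sF s). Qed.

(** Om is +-1/f.  Differentiating Om^2 = 1/f^2 avoids choosing the sign. *)
Lemma upsE a x : V x -> ups Om a x = - (f x)^-1 * pd a f x.
Proof.
move=> Vx.
have f2 y : V y -> f y * f y != 0 by move=> Vy; rewrite mulf_neq0 // f0.
have df := smooth_diff sfV Vx.
have e1 := pd_Om2 sOm Om0 a Vx.
have e2 : pd a (fun y => Om y ^+ 2) x = pd a (fun y => (f y * f y)^-1) x.
  by apply: (pd_on a oV Vx) => y Vy; rewrite OmE // expr2.
rewrite e2 pdV ?f2 ?pdM // in e1; last exact: differentiableM.
rewrite OmE // in e1; move: (f0 Vx) e1.
move: (pd a f x) (f x) (ups Om a x) => p q u q0 e1.
have -> : u = 2 * (q ^+ 2)^-1 * u * (q ^+ 2 / 2) by field; rewrite q0.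
by rewrite -e1; field; rewrite q0.
Qed.

(** By [killing_Tup] the trace part of nabla Tup is g_c /\ iota_(grad f) tau.
    Contracting Tup with d log Om = - df / f gives - iota_(grad f) tau, because
    iota_(grad f) iota_(grad f) S = 0, so the trace part disappears in the new
    scale. *)
Lemma killing_twist_div c x : (0 < m)%N -> V x ->
  (forall e, hookF (g x) m (fun a => covD g a (twist_div g f (n%:R - m.+1%:R + 1) S) x) e = 0) ->
  covD gh c (fun y => Om y ^+ m.+1 *: twist_div g f (n%:R - m.+1%:R + 1) S y) x =
  iot c (m.+1%:R^-1 *: twist_ext gh (fun=> 1) 0
    (fun y => Om y ^+ m.+1 *: twist_div g f (n%:R - m.+1%:R + 1) S y) x).
Proof.
move=> m0 Vx hk; have Ux := VU Vx.
have nm : (n%:R - m%:R : R) != 0 by rewrite subr_eq0 eqr_nat gtn_eqF // ltnW.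
have hT e : hookF (g x) m (fun a => covD g a (Tup g S tauS f) x) e = 0.
  have := hk e; under eq_fun => a do rewrite covD_twist_div //.
  by rewrite hookFZ => /eqP; rewrite scaler_eq0 (negbTE nm) => /eqP.
pose X : form := m.+1%:R^-1 *: \sum_b eps b (covD g b (Tup g S tauS f) x).
pose Z : form := (n%:R - m%:R) *: (Om x ^+ m.+1 *: (X + epsv ((ups Om)^~ x) (Tup g S tauS f x))).
have kX : kform m.+1 X.
  by apply/kformZ/kform_sum => b _; apply/kform_eps/(kform_covD g oU b kT sT Ux).
have kZ : kform m.+1 Z.
  by apply/kformZ/kformZ/kformD => //; apply/kform_epsv/kT.
have key e : covD gh e (fun y => Om y ^+ m.+1 *: twist_div g f (n%:R - m.+1%:R + 1) S y) x = iot e Z.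
  transitivity (covD gh e (fun y => (n%:R - m%:R) *: (Om y ^+ m.+1 *: Tup g S tauS f y)) x).
    by apply: (covD_on gh oV e) => // y Vy; rewrite twist_divE ?scalerA 1?mulrC //; exact: VU.
  rewrite (covDc gh e _ _ Vx); last by apply: (smoothFZ oV); [exact: smoothX|exact: sub].
  rewrite [RHS]linearZ /=; congr (_ *: _).
  have k0 := killing_Tup oU n3 mg sS smoothF_rhoS smoothF_tauS kS kform_rhoS kform_tauS ckeS Ux sf
    (ae Ux) m0 (ltnW mn) (hT e).
  apply: (killing_conformal oV mV sOm Om0 ghE (sub sT) Vx (kT Ux) k0).
  have -> : upsv g Om x = fun d => - (f x)^-1 * grad g f x d.
    apply: funext => d; rewrite /upsv /grad mulr_sumr; apply: eq_bigr => e' _.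
    by rewrite upsE //; ring.
  have -> : iotv (fun d => - (f x)^-1 * grad g f x d) (Tup g S tauS f x) =
      - (f x)^-1 *: iotv (grad g f x) (Tup g S tauS f x).
    by rewrite /iotv scaler_sumr; apply: eq_bigr => d _; rewrite scalerA.
  rewrite /Tup linearB /= [iotv _ (f x *: _)]linearZ /= iotv_iotv0 ?subr0; last exact: (kS Ux).1.
  by rewrite scalerA mulNr mulVf ?f0 // scaleN1r subrr.
(* The number operator recovers Z from its contractions. *)
rewrite key; congr (iot c _).
have -> : twist_ext gh (fun=> 1) 0 (fun y => Om y ^+ m.+1 *: twist_div g f (n%:R - m.+1%:R + 1) S y) x =
   \sum_e eps e (iot e Z).
  by apply: eq_bigr => e _; rewrite /twist key scale1r mul0r scale0r subr0.
by rewrite (sum_eps_iot kZ) scalerA mulVf ?scale1r // pnatr_eq0.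
Qed.

(** Dually, d log Om /\ Tdn = - df /\ rho because df /\ df /\ S = 0. *)
Lemma dual_killing_twist_ext c x : V x ->
  (forall e, hookF (g x) m.+2 (fun a => covD g a (twist_ext g f m.+2%:R S) x) e = 0) ->
  covD gh c (fun y => Om y ^+ m.+3 *: twist_ext g f m.+2%:R S y) x =
  lo (gh x) c ((n%:R - m.+1%:R)^-1 *: twist_div gh (fun=> 1) 0
    (fun y => Om y ^+ m.+3 *: twist_ext g f m.+2%:R S y) x).
Proof.
move=> Vx hk; have Ux := VU Vx.
have m2 : (m.+2%:R : R) != 0 by rewrite pnatr_eq0.
have hT e : hookF (g x) m.+2 (fun a => covD g a (Tdn S rhoS f) x) e = 0.
  have := hk e; under eq_fun => a do rewrite covD_twist_ext //.
  by rewrite hookFZ => /eqP; rewrite scaler_eq0 (negbTE m2) => /eqP.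
pose Y : form := (n%:R - m.+2%:R + 1)^-1 *: \sum_p up (g x) p (covD g p (Tdn S rhoS f) x).
pose Z : form := m.+2%:R *: (Om x ^+ m.+3 *: ((Om x ^+ 2)^-1 *: (Y + iotv (upsv g Om x) (Tdn S rhoS f x)))).
have kY : kform m.+1 Y.
  by apply/kformZ/kform_sum => b _; apply: (kform_up _ b (kform_covD g oU b kN sN Ux)).
have kZ : kform m.+1 Z.
  by apply/kformZ/kformZ/kformZ/kformD => //; exact: (kform_iotv _ (kN Ux)).
have [_ sgh ugh] := conformal_metric oV mV sOm Om0 ghE.
have key e : covD gh e (fun y => Om y ^+ m.+3 *: twist_ext g f m.+2%:R S y) x = lo (gh x) e Z.
  transitivity (covD gh e (fun y => m.+2%:R *: (Om y ^+ m.+3 *: Tdn S rhoS f y)) x).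
    by apply: (covD_on gh oV e) => // y Vy; rewrite twist_extE ?scalerA 1?mulrC //; exact: VU.
  rewrite (covDc gh e _ _ Vx); last by apply: (smoothFZ oV); [exact: smoothX|exact: sub].
  rewrite [RHS]linearZ /=; congr (_ *: _).
  have k0 := killing_Tdn oU mg sS smoothF_rhoS kform_rhoS ckeS Ux sf
    (ae Ux) mn (hT e).
  apply: (dual_killing_conformal oV mV sOm Om0 ghE (sub sN) Vx (kN Ux) k0).
  have -> : (ups Om)^~ x = fun d => - (f x)^-1 * pd d f x.
    by apply: funext => d; rewrite upsE.
  have -> : epsv (fun d => - (f x)^-1 * pd d f x) (Tdn S rhoS f x) =
      - (f x)^-1 *: epsv (fun d => pd d f x) (Tdn S rhoS f x).
    by rewrite /epsv scaler_sumr; apply: eq_bigr => d _; rewrite scalerA.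
  rewrite /Tdn linearB /= [epsv _ (f x *: _)]linearZ /= epsv_epsv0 ?subr0.
  by rewrite scalerA mulNr mulVf ?f0 // scaleN1r subrr.
(* The divergence recovers Z. *)
rewrite key; congr (lo _ c _).
have -> : twist_div gh (fun=> 1) 0 (fun y => Om y ^+ m.+3 *: twist_ext g f m.+2%:R S y) x =
   \sum_e up (gh x) e (lo (gh x) e Z).
  by apply: eq_bigr => e _; rewrite /twist key scale1r mul0r scale0r subr0.
rewrite (sum_up_lo (sgh _ Vx) (ugh _ Vx) kZ) scalerA mulVf ?scale1r //.
by rewrite subr_eq0 eqr_nat gtn_eqF.
Qed.
End Scale.
End Twistor.

(** * Form fields on a manifold *)

Section Manifold.
Variables (R : realType) (n : nat) (M : topologicalType) (X : manifold R n M).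
Local Notation form := (seq 'I_n -> R^o).
Local Notation pt := 'rV[R]_n.

Lemma open_chart_on (W : set M) (i : chart X) : open W -> open (chart_on W i).
Proof.
move=> oW; rewrite openE => x [cx Wx]; rewrite /interior.
have h1 : nbhs x (cod i) by apply: open_nbhs_nbhs; split=> //; exact: cod_open.
have h2 : nbhs x (point i @^-1` W).
  by apply: (point_continuous cx); apply: open_nbhs_nbhs.
exact: filterI h1 h2.
Qed.

Arguments open_chart_on [W] i _.

Lemma overlapP (W : set M) (i j : chart X) y : chart_on W j y -> chart_overlap i j y ->
  chart_on W i (coord i (point j y)) /\ point i (coord i (point j y)) = point j y.
Proof.
move=> [_ Wy] [_ dy]; have [cy e] := coordK dy.
by split=> //; split=> //; rewrite e.
Qed.

(** [is_form] for the list encoding, which is closed under the operators used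
    here (see [is_formE]). *)
Definition form_sect (W : set M) k (F : chart X -> pt -> form) : Prop :=
  [/\ forall i, smoothF (chart_on W i) (F i),
      forall i x, chart_on W i x -> kform k (F i x)
    & forall i j y, chart_on W j y -> chart_overlap i j y ->
        F j y = pull (transition_jac i j y) (F i (coord i (point j y)))].

(** A metric over the open set W only, such as the Einstein metric off the zeros
    of alpha. *)
Definition metric_sect (W : set M) (h : metric_field X) : Prop :=
  (forall i, local_metric (chart_on W i) (h i)) /\
  (forall i j y, chart_on W j y -> chart_overlap i j y ->
     h j y = transition_jac i j y *m h i (coord i (point j y)) *m (transition_jac i j y)^T).

Lemma lf_val k (T : form) : hom k T -> lf (fun t : k.-tuple 'I_n => T t : R) = T.
Proof. by move=> hT; apply: (@hom_lfP _ _ k) => // [|t]; [exact: lf_hom|rewrite lfE]. Qed.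

Lemma is_formE W k (T : form_field X k) :
  is_form W T <-> form_sect W k (fun i x => lf (T i x)).
Proof.
split=> -[H1 H2 H3]; split.
- by move=> i; apply: smoothF_lf => a; exact: H1.
- by move=> i x cx; apply/alternatingP => s a; exact: H2.
- move=> i j y cy oy; rewrite -lf_bigtuple; congr lf; apply: funext => b; exact: H3.
- move=> i a; have := H1 i a; congr smooth_on.
  by apply: funext => x; rewrite lfE.
- by move=> i x cx; have /alternatingP := H2 i x cx.
- move=> i j y cy oy b; have := H3 i j y cy oy; rewrite -lf_bigtuple => /lf_inj.
  by move=> ->.
Qed.

Lemma form_sect_ext W k F F' : open W -> (forall i x, chart_on W i x -> F i x = F' i x) ->
  form_sect W k F -> form_sect W k F'.
Proof.
move=> oW e [H1 H2 H3]; split.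
- move=> i; exact (smoothF_near (open_chart_on i oW) (e i) (H1 i)).
- by move=> i x cx; rewrite -e //; exact: H2.
- by move=> i j y cy oy; rewrite -!e //; [exact: H3|exact: (overlapP cy oy).1].
Qed.

Lemma form_sect_is_form W k F : open W -> form_sect W k F ->
  is_form W (fun i x (t : k.-tuple 'I_n) => F i x t : R).
Proof.
move=> oW sF; apply/is_formE; apply: (form_sect_ext oW _ sF) => i x cx.
by case: sF => _ kF _; rewrite lf_val //; exact: (kF i x cx).2.
Qed.

Lemma form_sect_sub (W W' : set M) k F : W' `<=` W -> form_sect W k F -> form_sect W' k F.
Proof.
move=> sW [H1 H2 H3]; split.
- by move=> i s; apply: smooth_sub (H1 i s) => x [cx /sW].
- by move=> i x [cx /sW Wx]; exact: H2.
- by move=> i j y [cy /sW Wy]; exact: H3.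
Qed.

Lemma metric_sect_sub (W W' : set M) h : W' `<=` W -> metric_sect W h -> metric_sect W' h.
Proof.
move=> sW [H1 H2]; split.
- move=> i; have [a b c] := H1 i; split.
  + by move=> p q; apply: smooth_sub (a p q) => x [cx /sW].
  + by move=> x [cx /sW Wx]; exact: b.
  + by move=> x [cx /sW Wx]; exact: c.
- by move=> i j y [cy /sW Wy]; exact: H2.
Qed.

Lemma form_sect_scale (W : set M) k (f : M -> R) F : open W -> smooth_fun X W f ->
  form_sect W k F -> form_sect W k (fun i x => f (point i x) *: F i x).
Proof.
move=> oW sf [H1 H2 H3]; split.
- by move=> i; apply: (smoothFZ (open_chart_on i oW) (sf i)).
- by move=> i x cx; apply/kformZ/H2.
- move=> i j y cy oy; rewrite linearZ /= (overlapP cy oy).2; congr (_ *: _).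
  exact: H3.
Qed.

Lemma metric_sect_scale (W : set M) (f : M -> R) h : open W -> smooth_fun X W f ->
  (forall p, W p -> f p != 0) ->
  metric_sect W h -> metric_sect W (fun i x => f (point i x) ^+ 2 *: h i x).
Proof.
move=> oW sf f0 [H1 H2]; split.
- move=> i; apply: (conformal_metric (open_chart_on i oW) (H1 i) (sf i)) => // y [_ Wy].
  exact: f0.
- move=> i j y cy oy; rewrite (overlapP cy oy).2 (H2 i j y cy oy).
  by rewrite -scalemxAr -scalemxAl.
Qed.

Lemma is_metric_sect h : is_metric h -> metric_sect setT h.
Proof.
move=> [H1 H2 H3 H4]; split.
- move=> i; split.
  + by move=> a b; apply: smooth_sub (H1 i a b) => x [].
  + by move=> x [cx _]; exact: H2.
  + by move=> x [cx _]; exact: H3.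
- by move=> i j y _; exact: H4.
Qed.

Lemma transition_unit (W : set M) h (i j : chart X) y : metric_sect W h ->
  chart_on W j y -> chart_overlap i j y -> transition_jac i j y \in unitmx.
Proof.
move=> [mh1 mh2] cy oy; have [_ _ uh] := mh1 j.
by have := uh _ cy; rewrite (mh2 i j y cy oy) !unitmx_mul => /andP[/andP[]].
Qed.

Section Natural.
Variables (W : set M) (h : metric_field X) (f : M -> R) (k : nat) (F : chart X -> pt -> form) (r : R).
Hypothesis oW : open W.
Hypothesis mh : metric_sect W h.
Hypothesis sf : smooth_fun X W f.
Hypothesis sF : form_sect W k F.

(** Each factor transforms tensorially: nabla F by [covD_change], df by the
    chain rule, F by assumption. *)
Lemma twist_transition (i j : chart X) y c : chart_on W j y -> chart_overlap i j y ->
  twist (h j) (f \o point j) r (F j) c y =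
  \sum_d transition_jac i j y c d *: pull (transition_jac i j y)
     (twist (h i) (f \o point i) r (F i) d (coord i (point j y))).
Proof.
move=> cy oy; have [sm kF tF] := sF; have [mh1 mh2] := mh.
pose U := chart_on W i; pose U' := chart_on W j `&` chart_overlap i j.
have oU' : open U' by apply: openI; [exact: open_chart_on|exact: (open_chart_on j (dom_open i))].
pose phi (z : pt) := coord i (point j z).
have sphi d : smooth_on U' (fun z => phi z 0 d).
  by apply: smooth_sub (transition_smooth i j d) => z [].
have phiU z : U' z -> U (phi z) by move=> [cz oz]; exact: (overlapP cz oz).1.
have JE z : U' z -> forall b a, transition_jac i j z b a = pd b (fun z => phi z 0 a) z.
  by move=> Uz b a; apply: jacobianE => d; exact: smooth_diff (sphi d) Uz.
have gE' z : U' z -> h j z = transition_jac i j z *m h i (phi z) *m (transition_jac i j z)^T.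
  by move=> [cz oz]; exact: mh2.
have mj : local_metric U' (h j).
  have [a b e] := mh1 j; split.
  + by move=> p q; apply: smooth_sub (a p q) => x [].
  + by move=> x [+ _]; exact: b.
  + by move=> x [+ _]; exact: e.
have Uy : U' y by split.
have tF' z : U' z -> F j z = pull (transition_jac i j z) (F i (phi z)).
  by move=> [cz oz]; exact: tF.
rewrite /twist (covD_change oU' sphi phiU (mh1 i) mj JE gE' c (sm i) (kF i) tF' Uy).
have -> : pd c (f \o point j) y = \sum_d transition_jac i j y c d * pd d (f \o point i) (phi y).
  rewrite -(pd_phi sphi phiU JE c (sf i) Uy); apply: (pd_on c oU' Uy) => z [cz oz] /=.
  by rewrite (overlapP cz oz).2.
rewrite (tF' _ Uy) mulr_sumr scaler_suml scaler_sumr -sumrB; apply: eq_bigr => d _.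
rewrite -/(phi y) linearB /= [pull _ (_ *: covD _ _ _ _)]linearZ [pull _ (_ *: F i _)]linearZ /=.
rewrite (overlapP cy oy).2; move: (pull _ _) (pull _ _) (pd _ _ _) => u v p.
by apply: funext => s; rewrite !FE; ring.
Qed.

Lemma form_sect_twist_ext : form_sect W k.+1 (fun i => twist_ext (h i) (f \o point i) r (F i)).
Proof.
have [sm kF tF] := sF; have [mh1 mh2] := mh.
split.
- by move=> i; apply: (smoothF_twist_ext (open_chart_on i oW) (mh1 i)) => //; exact: sf.
- move=> i x cx; apply: kform_sum => c _; apply: kform_eps; apply: kformB; apply: kformZ.
    exact: (kform_covD _ (open_chart_on i oW) _ (kF i) (sm i)).
  exact: kF.
- move=> i j y cy oy; rewrite /twist_ext -epsv_pull; apply: eq_bigr => c _.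
  by rewrite (twist_transition c cy oy).
Qed.

Lemma form_sect_twist_div : form_sect W k.-1 (fun i => twist_div (h i) (f \o point i) r (F i)).
Proof.
have [sm kF tF] := sF; have [mh1 mh2] := mh.
split.
- by move=> i; apply: (smoothF_twist_div (open_chart_on i oW) (mh1 i)) => //; exact: sf.
- move=> i x cx; apply: kform_sum => c _; apply: kform_up; apply: kformB; apply: kformZ.
    exact: (kform_covD _ (open_chart_on i oW) _ (kF i) (sm i)).
  exact: kF.
- move=> i j y cy oy.
  have [_ _ uh] := mh1 i; have [ci _] := overlapP cy oy.
  rewrite /twist_div (mh2 i j y cy oy).
  under eq_bigr => c _ do rewrite (twist_transition c cy oy).
  by rewrite up_pull //; [exact: uh|exact: (transition_unit mh)].
Qed.

End Natural.
End Manifold.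
Arguments open_chart_on {R n M X} [W] i _.

(** * The zero locus of the almost Einstein scale *)

Section Locus.
Variables (R : realType) (n : nat) (M : topologicalType) (X : manifold R n M).
Local Notation pt := 'rV[R]_n.

Lemma near_chart_neq0 i (F : pt -> R) p : dom i p -> {for coord i p, continuous F} ->
  F (coord (m := X) i p) != 0 -> nbhs p [set q | dom (m := X) i q /\ F (coord i q) != 0].
Proof.
move=> dp cF F0.
have h1 : nbhs p (dom i) by apply: open_nbhs_nbhs; split=> //; exact: dom_open.
have h2 : nbhs (coord i p) (F @^-1` [set r | r != 0]).
  by apply: cF; apply: open_nbhs_nbhs; split.
exact: (filterI h1 (coord_continuous dp h2)).
Qed.

(** If F x is not 0, then F does not vanish on a neighbourhood of the point of
    M with coordinates x, and D meets that neighbourhood. *)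
Lemma dense_vanish (D : set M) i (F : pt -> R) : dense D ->
  (forall x, cod i x -> {for x, continuous F}) ->
  (forall x, cod i x -> D (point (m := X) i x) -> F x = 0) ->
  forall x, cod i x -> F x = 0.
Proof.
move=> dD cF F0 x cx; apply/eqP/negP => /negP Fx.
pose A := [set q | dom (m := X) i q /\ F (coord i q) != 0].
have oA : open A.
  rewrite openE => q [dq Fq]; apply: near_chart_neq0 => //.
  by apply: cF; exact: (coordK dq).1.
have [dp cp] := pointK cx.
have [q [[dq Fq] Dq]] : (A `&` D) !=set0.
  by apply: dD => //; exists (point i x); split=> //; rewrite cp.
have [cq eq] := coordK dq.
by move/eqP: Fq; apply; apply: F0 => //; rewrite eq.
Qed.

Lemma open_nonzero (f : M -> R) : smooth_fun X setT f -> open [set p | f p != 0].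
Proof.
move=> sf; rewrite openE => p fp; have [i dp] := chart_cover X p.
have [cp ep] := coordK dp.
have cf : {for coord i p, continuous (f \o point i)} by apply: (smooth_cont (sf i)).
have := @near_chart_neq0 i (f \o point i) p dp cf.
rewrite /= ep => /(_ fp); apply: filterS => q [dq].
by rewrite (coordK dq).2.
Qed.

Lemma smooth_fun_sub (W W' : set M) (f : M -> R) : W' `<=` W -> smooth_fun X W f -> smooth_fun X W' f.
Proof. by move=> sW sf i; apply: smooth_sub (sf i) => x [cx /sW]. Qed.

(** Near a point where f has sign e this function is e / f. *)
Lemma smooth_inv_norm (f : M -> R) : smooth_fun X setT f ->
  smooth_fun X [set p | f p != 0] (fun p => `|f p|^-1).
Proof.
move=> sf i; have oW := open_nonzero sf.
have si := smooth_fun_sub (@subsetT _ [set p | f p != 0]) sf i.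
apply: smooth_local => x [cx fx].
have sgn (e : R) : e != 0 -> 0 < e * f (point i x) -> `|e| = 1 ->
   exists V, [/\ open V, V x & smooth_on V ((fun p => `|f p|^-1) \o point i)].
  move=> e0 ef e1.
  pose V := [set y | cod i y /\ 0 < e * f (point i y)].
  have sV : V `<=` chart_on [set p | f p != 0] i.
    by move=> y [cy ey]; split=> //=; apply: contraTneq ey => ->; rewrite mulr0 ltxx.
  have oV : open V.
    rewrite openE => y [cy ey]; apply: filterI; first by apply: open_nbhs_nbhs; split=> //; exact: cod_open.
    have cf : {for y, continuous (fun y => e * (f \o point i) y)}.
      have se : smooth_on (chart_on setT i) (fun y => e * (f \o point i) y).
        by apply: smoothM; [exact: (open_chart_on i openT)|exact: smooth_cst|exact: sf].
      exact: (smooth_cont se).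
    apply: (cf [set r | 0 < r]); apply: open_nbhs_nbhs; split=> //; exact: open_gt.
  exists V; split=> //.
  apply: (smooth_near oV (f := fun y => e * ((f \o point i) y)^-1)).
    move=> y [cy ey] /=; rewrite -[`|f _|]mul1r -e1 -normrM gtr0_norm // invfM.
    have -> : e^-1 = e; last by [].
    by have : e * e = 1; [rewrite -expr2 -real_normK ?num_real // e1 expr1n|move/(congr1 (fun z => e^-1 * z)); rewrite mulr1 mulKf].
  apply: smoothM => //; first exact: smooth_cst.
  by apply: smoothV => //; [move=> y Vy; exact: (sV y Vy).2|exact: smooth_sub sV si].
have [f0|f0] := ltP 0 (f (point i x)).
  by apply: (sgn 1); rewrite ?oner_neq0 ?mul1r ?normr1.
apply: (sgn (-1)); rewrite ?oppr_eq0 ?oner_neq0 ?normrN ?normr1 //.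
by rewrite mulN1r oppr_gt0 lt_neqAle fx.
Qed.

End Locus.

Lemma twist_extZ (R : realType) n (V : set 'rV[R]_n) g r (F : 'rV[R]_n -> seq 'I_n -> R^o) x :
  smoothF V F -> V x -> twist_ext g (fun=> 1) 0 (fun y => r *: F y) x = r *: twist_ext g (fun=> 1) 0 F x.
Proof.
move=> sF Vx; rewrite scaler_sumr; apply: eq_bigr => c _.
by rewrite /twist (covDc g c r sF Vx) !mul0r !scale0r !subr0 !scale1r linearZ.
Qed.
Lemma twist_divZ (R : realType) n (V : set 'rV[R]_n) g r (F : 'rV[R]_n -> seq 'I_n -> R^o) x :
  smoothF V F -> V x -> twist_div g (fun=> 1) 0 (fun y => r *: F y) x = r *: twist_div g (fun=> 1) 0 F x.
Proof.
move=> sF Vx; rewrite scaler_sumr; apply: eq_bigr => c _.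
by rewrite /twist (covDc g c r sF Vx) !mul0r !scale0r !subr0 !scale1r linearZ.
Qed.

(** * Conformal invariance, curvature conditions and Killing forms *)

Section Global.
Variables (R : realType) (n : nat) (M : topologicalType) (X : manifold R n M).
Variables (c : set (metric_field X)) (alpha : density X).
Hypothesis n3 : (3 <= n)%N.
Hypothesis cs : conformal_structure c.
Hypothesis AE : almost_einstein c alpha.
Local Notation form := (seq 'I_n -> R^o).
Local Notation pt := 'rV[R]_n.

Let i0 : 'I_n := Ordinal (ltnW (ltnW n3)).

Let mg g : c g -> metric_sect setT g.
Proof. by move=> cg; have [_ cm _] := cs; exact/is_metric_sect/cm. Qed.
Let oc i : open (chart_on (X := X) setT i) := open_chart_on i openT.
Let salpha g : c g -> smooth_fun X setT (alpha g).
Proof. by move=> cg; have [[sa _] _ _] := AE; exact: sa. Qed.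

Lemma conformal_killingE k (T : weighted_field X k) :
  (forall g, c g -> is_form setT (T g)) ->
  conformal_killing c T <-> forall g, c g -> forall i x, chart_on setT i x -> forall e,
     hookF (g i x) k (fun a => covD (g i) a (fun y => lf (T g i y)) x) e = 0.
Proof.
move=> fT.
have E g i x e : c g -> chart_on setT i x -> lf (hook_part (g i x) (nabla (g i) (T g i) x) e) =
    hookF (g i x) k (fun a => covD (g i) a (fun y => lf (T g i y)) x) e.
  move=> cg cx; have /is_formE[sF kF _] := fT g cg.
  have kD b : lf (nabla (g i) (T g i) x b) = covD (g i) b (fun y => lf (T g i y)) x.
    by rewrite lf_nabla //; exact: kF.
  rewrite lf_hook_part => [|b]; last first.
    by rewrite kD; exact: (kform_covD (g i) (@oc i) b (kF i) (sF i) cx).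
  by congr (hookF _ _ _ _); apply: funext => b; rewrite kD.
split=> H g cg i x.
- move=> cx e; rewrite -E // -(lf0 R n k); congr lf; apply: funext => a.
  exact: (H g cg i x cx.1 e a).
- move=> cx e a; have cx' : chart_on setT i x by split.
  by rewrite -[LHS](lfE (hook_part (g i x) (nabla (g i) (T g i) x) e)) E // H.
Qed.

Section Form.
Variables (k : nat) (sigma : weighted_field X k).
Hypothesis wf : is_weighted_form c k.+1%:R sigma.
Local Notation S g i := (fun y => lf (sigma g i y)).

Let sect g : c g -> form_sect setT k (fun i => S g i).
Proof. by move=> cg; apply/is_formE/wf.1. Qed.

Lemma lf_down g i x : c g -> chart_on setT i x ->
  lf (sigma_down alpha sigma g i x) =
  ((-1) ^+ k / k.+1%:R) *: twist_ext (g i) (alpha g \o point i) k.+1%:R (S g i) x.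
Proof.
move=> cg cx; have [sF kF _] := sect cg.
rewrite /sigma_down (lf_sigma_down i0) //; first exact: kF.
by move=> q; exact: (kform_covD (g i) (@oc i) q (kF i) (sF i) cx).
Qed.

Lemma form_sect_cst W m (r : R) (F : chart X -> pt -> form) : open W -> form_sect W m F ->
  form_sect W m (fun i x => r *: F i x).
Proof. by move=> oW; apply: (form_sect_scale (f := fun=> r)) => // i; exact: smooth_cst. Qed.

Lemma is_form_down g : c g -> is_form setT (sigma_down alpha sigma g).
Proof.
move=> cg; apply/is_formE.
apply: (form_sect_ext openT) (form_sect_cst ((-1) ^+ k / k.+1%:R) openT
   (form_sect_twist_ext k.+1%:R openT (mg cg) (salpha cg) (sect cg))) => i x cx.
by rewrite lf_down.
Qed.

(** The data of a rescaling in the form required by the local transformation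
    laws, with Om = exp Upsilon so that the exponential weights become powers. *)
Lemma weight_rep g h Upsilon i : c g -> c h -> smooth_fun X setT Upsilon -> rescaling Upsilon g h ->
  let Om := fun y => expR (Upsilon (point i y)) in
  [/\ smooth_on (chart_on setT i) Om, forall y, chart_on setT i y -> h i y = Om y ^+ 2 *: g i y,
      (alpha h \o point i) = (fun y => Om y * (alpha g \o point i) y) &
      forall y, chart_on setT i y -> S h i y = Om y ^+ k.+1 *: S g i y].
Proof.
move=> cg ch sU resc Om; split.
- by apply: smooth_expR => //; exact: sU.
- by move=> y [cy _]; rewrite resc // expRM_natl.
- have [[_ wa] _ _] := AE; apply: funext => y /=.
  by rewrite (wa g h Upsilon) // mul1r.
- move=> y [cy _]; rewrite -lfZ; congr lf; apply: funext => a.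
  by rewrite (wf.2 g h Upsilon) // expRM_natl.
Qed.

Lemma weighted_down : is_weighted_form c k.+2%:R (sigma_down alpha sigma).
Proof.
split; first exact: is_form_down.
move=> g h Upsilon cg ch sU resc i x cx a; have cx' : chart_on setT i x by split.
have [sOm hE aE SE] := weight_rep i cg ch sU resc.
have [sF kF _] := sect cg; have [mgi _] := mg cg.
rewrite -[LHS](lfE (sigma_down alpha sigma h i x)) -[sigma_down _ _ g i x a](lfE (sigma_down alpha sigma g i x)).
rewrite !lf_down // aE (twist_ext_on _ (@oc i) _ _ SE cx').
rewrite (twist_ext_conformal (@oc i) (mgi i) sOm _ hE (salpha cg i) (sF i) cx' (kF i x cx')).
  by rewrite expRM_natl /=; rewrite !FE; ring.
by move=> y _; rewrite gt_eqF // expR_gt0.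
Qed.

End Form.

Section FormUp.
Variables (m : nat) (sigma : weighted_field X m.+1).
Hypothesis wf : is_weighted_form c m.+2%:R sigma.
Local Notation S g i := (fun y => lf (sigma g i y)).
Local Notation r := (n%:R - m.+1%:R + 1).

Let sect g : c g -> form_sect setT m.+1 (fun i => S g i).
Proof. by move=> cg; apply/is_formE/wf.1. Qed.

Lemma lf_up g i x : c g -> chart_on setT i x ->
  lf (sigma_up alpha sigma g i x) = (-1) ^+ m *: twist_div (g i) (alpha g \o point i) r (S g i) x.
Proof.
move=> cg cx; have [sF kF _] := sect cg.
have [mgi _] := mg cg; have [_ sy _] := mgi i.
rewrite /sigma_up (lf_sigma_up i0) //; [exact: sy|exact: kF|].
by move=> q; exact: (kform_covD (g i) (@oc i) q (kF i) (sF i) cx).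
Qed.

Lemma is_form_up g : c g -> is_form setT (sigma_up alpha sigma g).
Proof.
move=> cg; apply/is_formE.
apply: (form_sect_ext openT) (form_sect_cst ((-1) ^+ m) openT
   (form_sect_twist_div r openT (mg cg) (salpha cg) (sect cg))) => i x cx.
by rewrite lf_up.
Qed.

Lemma weighted_up : is_weighted_form c m.+1%:R (sigma_up alpha sigma).
Proof.
split; first exact: is_form_up.
move=> g h Upsilon cg ch sU resc i x cx a; have cx' : chart_on setT i x by split.
have [sOm hE aE SE] := weight_rep wf i cg ch sU resc.
have [sF kF _] := sect cg; have [mgi _] := mg cg.
rewrite -[LHS](lfE (sigma_up alpha sigma h i x)) -[sigma_up _ _ g i x a](lfE (sigma_up alpha sigma g i x)).
rewrite !lf_up // aE (twist_div_on _ (@oc i) _ _ SE cx').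
rewrite (twist_div_conformal (@oc i) (mgi i) sOm _ hE (salpha cg i) (sF i) cx' (kF i x cx')).
  by rewrite expRM_natl /=; rewrite !FE; ring.
by move=> y _; rewrite gt_eqF // expR_gt0.
Qed.

End FormUp.
Section Killing.
Variables (m : nat) (sigma : weighted_field X m.+1).
Hypothesis wf : is_weighted_form c m.+2%:R sigma.
Hypothesis ck : conformal_killing c sigma.
Hypothesis mn : (m.+1 < n)%N.
Local Notation S g i := (fun y => lf (sigma g i y)).
Local Notation r := (n%:R - m.+1%:R + 1).
Local Notation f g i := (alpha g \o point (m := X) i).

Let sect g : c g -> form_sect setT m.+1 (fun i => S g i).
Proof. by move=> cg; apply/is_formE/wf.1. Qed.
Let sF g i : c g -> smoothF (chart_on setT i) (S g i).
Proof. by case/sect=> + _ _; apply. Qed.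
Let kF g i : c g -> forall x, chart_on setT i x -> kform m.+1 (S g i x).
Proof. by case/sect=> _ + _; apply. Qed.
Let mgi g i : c g -> local_metric (chart_on setT i) (g i).
Proof. by move=> cg; exact: (mg cg).1. Qed.
Let sf g i : c g -> smooth_on (chart_on setT i) (f g i).
Proof. by move=> cg; exact: salpha. Qed.

Let hookS g i : c g -> forall y, chart_on setT i y -> forall e,
  hookF (g i y) m.+1 (fun a => covD (g i) a (S g i) y) e = 0.
Proof.
by move=> cg y cy e; move/(conformal_killingE (wf.1)): ck; apply.
Qed.

(** The trace that the almost Einstein equation leaves undetermined. *)
Definition einstein_factor g i x : R := n%:R^-1 * \sum_p \sum_q invmx (g i x) p q *
  (hessian (g i) (f g i) x p q + schouten (g i) x p q * alpha g (point i x)).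

Lemma almost_einstein_hessian g i : c g -> forall x, chart_on setT i x -> forall a b,
  hessian (g i) (f g i) x a b + schouten (g i) x a b * f g i x = einstein_factor g i x * g i x a b.
Proof.
move=> cg x cx a b; have [_ ae _] := AE.
have := ae g cg i x cx.1 a b; rewrite /sym_tracefree -/(einstein_factor g i x).
have -> : hessian (g i) (f g i) x b a = hessian (g i) (f g i) x a b.
  rewrite /hessian (pdC b a (@oc i) (@sf g i cg) cx); congr (_ - _).
  by apply: eq_bigr => d _; rewrite (christoffelC (@oc i) (@mgi g i cg)).
rewrite (schoutenC (@oc i) (@mgi g i cg) cx b a) /=.
move: (hessian _ _ _ _ _) (schouten _ _ _ _) (einstein_factor _ _ _) => u v w /eqP.
by rewrite subr_eq0 => /eqP <-; field.
Qed.

Lemma covD_up g i a x : c g -> chart_on setT i x ->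
  covD (g i) a (fun y => lf (sigma_up alpha sigma g i y)) x =
  (-1) ^+ m *: covD (g i) a (twist_div (g i) (f g i) r (S g i)) x.
Proof.
move=> cg cx; rewrite (covD_on (g i) (@oc i) a (fun y cy => lf_up wf cg cy) cx).
rewrite (covDc (g i) a _ _ cx) //.
exact: (smoothF_twist_div (@oc i) (@mgi g i cg) r (@sf g i cg) (@sF g i cg)).
Qed.

Lemma covD_down g i a x : c g -> chart_on setT i x ->
  covD (g i) a (fun y => lf (sigma_down alpha sigma g i y)) x =
  ((-1) ^+ m.+1 / m.+2%:R) *: covD (g i) a (twist_ext (g i) (f g i) m.+2%:R (S g i)) x.
Proof.
move=> cg cx; rewrite (covD_on (g i) (@oc i) a (fun y cy => lf_down wf cg cy) cx).
rewrite (covDc (g i) a _ _ cx) //.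
exact: (smoothF_twist_ext (@oc i) (@mgi g i cg) _ (@sf g i cg) (@sF g i cg)).
Qed.

Let sc0 : ((-1) ^+ m.+1 / m.+2%:R : R) != 0.
Proof. by rewrite mulf_neq0 ?signr_eq0 // invr_eq0 pnatr_eq0. Qed.

Definition weyl_int_vanishes := forall g, c g -> forall i x, chart_on setT i x -> forall e,
  hookF (g i x) m (fun a => weyl_int (g i) x a (S g i x)) e = 0.
Definition weyl_ext_vanishes := forall g, c g -> forall i x, chart_on setT i x -> forall e,
  hookF (g i x) m.+2 (fun a => weyl_ext (g i) x a (S g i x)) e = 0.

(** alpha can be cancelled where it is not zero, hence, by density and
    continuity, everywhere. *)
Lemma cancel_alpha (H : metric_field X -> chart X -> 'I_n -> pt -> form) :
  (forall g i e, c g -> smoothF (chart_on setT i) (H g i e)) ->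
  (forall g, c g -> forall i x, chart_on setT i x -> forall e, f g i x *: H g i e x = 0) ->
  forall g, c g -> forall i x, chart_on setT i x -> forall e, H g i e x = 0.
Proof.
move=> sH H0 g cg i x cx e; apply: funext => s.
have [_ _ dA] := AE.
apply: (dense_vanish (i := i) (F := fun y => H g i e y s) (dA g cg)) cx.1.
- by move=> y cy; exact: (smooth_cont (sH g i e cg s) (conj cy I)).
- move=> y cy ay; have /eqP := H0 g cg i y (conj cy I) e.
  by rewrite scaler_eq0 (negbTE ay) /= => /eqP ->.
Qed.

(** The constant relating the two projections is nonzero, and alpha is
    cancelled with [cancel_alpha]. *)
Lemma conformal_killing_upE : (0 < m)%N ->
  conformal_killing c (sigma_up alpha sigma) <-> weyl_int_vanishes.
Proof.
move=> m0.
have E g i x e : c g -> chart_on setT i x ->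
    hookF (g i x) m (fun a => covD (g i) a (fun y => lf (sigma_up alpha sigma g i y)) x) e =
    ((-1) ^+ m * - ((n%:R - m%:R) / (2 * (n%:R - m.+1%:R)))) *:
      (f g i x *: hookF (g i x) m (fun a => weyl_int (g i) x a (S g i x)) e).
  move=> cg cx; under eq_fun => a do rewrite covD_up //.
  rewrite hookFZ (hook_twist_div (@oc i) n3 (@mgi g i cg) (@sF g i cg) (@kF g i cg) (@hookS g i cg) mn (@sf g i cg)
    (@almost_einstein_hessian g i cg) e m0 cx).
  by rewrite !scalerA; congr (_ *: _); ring.
have c0 : ((-1) ^+ m * - ((n%:R - m%:R) / (2 * (n%:R - m.+1%:R))) : R) != 0.
  rewrite mulf_neq0 ?signr_eq0 // oppr_eq0 mulf_neq0 //.
    by rewrite subr_eq0 eqr_nat gtn_eqF // ltnW.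
  by rewrite invr_eq0 mulf_neq0 ?pnatr_eq0 // subr_eq0 eqr_nat gtn_eqF.
rewrite (conformal_killingE (T := sigma_up alpha sigma) (is_form_up wf)).
split=> H; last by move=> g cg i x cx e; rewrite E // H // !scaler0.
apply: (cancel_alpha (H := fun g i e x => hookF (g i x) m (fun a => weyl_int (g i) x a (S g i x)) e)).
- move=> g i e cg; apply: (smoothF_hookF (@oc i) (@mgi g i cg)) => a.
  exact: (smoothF_weyl_int (@oc i) (@mgi g i cg) a (@sF g i cg)).
- move=> g cg i x cx e; have /eqP := H g cg i x cx e.
  by rewrite E // scaler_eq0 (negbTE c0) => /eqP.
Qed.

Lemma conformal_killing_downE : conformal_killing c (sigma_down alpha sigma) <-> weyl_ext_vanishes.
Proof.
have E g i x e : c g -> chart_on setT i x ->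
    hookF (g i x) m.+2 (fun a => covD (g i) a (fun y => lf (sigma_down alpha sigma g i y)) x) e =
    ((-1) ^+ m.+1 / m.+2%:R * (m.+2%:R / m.+1%:R)) *:
      (f g i x *: hookF (g i x) m.+2 (fun a => weyl_ext (g i) x a (S g i x)) e).
  move=> cg cx; under eq_fun => a do rewrite covD_down //.
  rewrite hookFZ (hook_twist_ext (@oc i) (@mgi g i cg) (@sF g i cg) (@kF g i cg) (@hookS g i cg) mn (@sf g i cg)
    (@almost_einstein_hessian g i cg) e cx).
  by rewrite !scalerA; congr (_ *: _); ring.
have c0 : ((-1) ^+ m.+1 / m.+2%:R * (m.+2%:R / m.+1%:R) : R) != 0.
  by rewrite mulf_neq0 // mulf_neq0 ?invr_eq0 ?pnatr_eq0.
rewrite (conformal_killingE (T := sigma_down alpha sigma) (is_form_down wf)).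
split=> H; last by move=> g cg i x cx e; rewrite E // H // !scaler0.
apply: (cancel_alpha (H := fun g i e x => hookF (g i x) m.+2 (fun a => weyl_ext (g i) x a (S g i x)) e)).
- move=> g i e cg; apply: (smoothF_hookF (@oc i) (@mgi g i cg)) => a.
  exact: (smoothF_weyl_ext (@oc i) (@mgi g i cg) a (@sF g i cg)).
- move=> g cg i x cx e; have /eqP := H g cg i x cx e.
  by rewrite E // scaler_eq0 (negbTE c0) => /eqP.
Qed.

End Killing.

Section Einstein.
Variables (g : metric_field X).
Hypothesis cg : c g.
Local Notation W := (nonzero_locus alpha g).
Local Notation Om := (fun p => `|alpha g p|^-1).
Local Notation gh := (einstein_metric alpha g).

Lemma open_locus : open W.
Proof. by have := open_nonzero (salpha cg). Qed.

Lemma smooth_Om : smooth_fun X W Om.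
Proof. exact: (smooth_inv_norm (salpha cg)). Qed.

(** Written with the positive factor 1/|alpha|, so that the weights of
    [einstein_rep] are its powers. *)
Lemma einstein_metricE i x : gh i x = Om (point i x) ^+ 2 *: g i x.
Proof. by rewrite /einstein_metric exprVn real_normK ?num_real. Qed.

Lemma einstein_sect : metric_sect W gh.
Proof.
have -> : gh = fun i x => Om (point i x) ^+ 2 *: g i x.
  by apply: funext => i; apply: funext => x; exact: einstein_metricE.
apply: (metric_sect_scale open_locus smooth_Om).
  by move=> p Wp; rewrite invr_eq0 normr_eq0.
exact: (metric_sect_sub (@subsetT _ _) (mg cg)).
Qed.

Lemma lf_einstein_rep k (w : nat) (T : weighted_field X k) i x : chart_on W i x ->
  lf (einstein_rep alpha g w%:R T i x) = Om (point i x) ^+ w *: lf (T g i x).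
Proof.
move=> [_ Wx]; rewrite -lfZ; congr lf; apply: funext => a.
rewrite /einstein_rep expRM_natl expRN lnK //.
by rewrite posrE normr_gt0.
Qed.

Lemma einstein_rep_sect k w (T : weighted_field X k) : is_form setT (T g) ->
  form_sect W k (fun i x => lf (einstein_rep alpha g w%:R T i x)).
Proof.
move=> /is_formE fT; have sW : W `<=` setT by exact: subsetT.
have sw : smooth_fun X W (fun p => Om p ^+ w).
  by move=> i; apply: (smoothX w (open_chart_on i open_locus) (smooth_Om i)).
apply: (form_sect_ext open_locus _ (form_sect_scale open_locus sw (form_sect_sub sW fT))).
by move=> i x cx; rewrite lf_einstein_rep.
Qed.

(** rho has to be given globally: the exterior derivative is, and it determines
    rho up to the factor k + 1. *)
Lemma killing_formI k (T : form_field X k) : form_sect W k (fun i x => lf (T i x)) ->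
  (forall i x, chart_on W i x -> forall e, covD (gh i) e (fun y => lf (T i y)) x =
     iot e (k.+1%:R^-1 *: twist_ext (gh i) (fun=> 1) 0 (fun y => lf (T i y)) x)) ->
  killing_form W gh T.
Proof.
move=> sT H.
have sD : form_sect W k.+1 (fun i x => k.+1%:R^-1 *: twist_ext (gh i) (fun=> 1) 0 (fun y => lf (T i y)) x).
  apply: (form_sect_cst _ open_locus).
  by apply: (form_sect_twist_ext (f := fun=> 1) 0 open_locus einstein_sect _ sT) => i; exact: smooth_cst.
exists (fun i x t => (k.+1%:R^-1 *: twist_ext (gh i) (fun=> 1) 0 (fun y => lf (T i y)) x) t).
  exact: (form_sect_is_form open_locus sD).
move=> i x cx u a; have [_ kT _] := sT; have [_ kD _] := sD.
rewrite -[LHS](lfE (fun a => \sum_e u 0 e * nabla (gh i) (T i) x e a)) -[RHS](lfE (int_mul u _)).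
rewrite lf_int_mul lf_val; last exact: (kD i x cx).2.
rewrite lf_sum /iotv; apply: (congr1 (fun F : form => F a)); apply: eq_bigr => e _.
by rewrite lfZ lf_nabla ?H //; exact: kT.
Qed.

(** As in [killing_formI], tau is determined by the divergence. *)
Lemma dual_killing_formI k (T : form_field X k.+1) : form_sect W k.+1 (fun i x => lf (T i x)) ->
  (forall i x, chart_on W i x -> forall e, covD (gh i) e (fun y => lf (T i y)) x =
     lo (gh i x) e ((n%:R - k%:R)^-1 *: twist_div (gh i) (fun=> 1) 0 (fun y => lf (T i y)) x)) ->
  dual_killing_form W gh T.
Proof.
move=> sT H.
have sD : form_sect W k (fun i x => (n%:R - k%:R)^-1 *: twist_div (gh i) (fun=> 1) 0 (fun y => lf (T i y)) x).
  apply: (form_sect_cst _ open_locus).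
  by apply: (form_sect_twist_div (f := fun=> 1) 0 open_locus einstein_sect _ sT) => i; exact: smooth_cst.
exists (fun i x t => ((n%:R - k%:R)^-1 *: twist_div (gh i) (fun=> 1) 0 (fun y => lf (T i y)) x) t).
  exact: (form_sect_is_form open_locus sD).
move=> i x cx u a; have [_ kT _] := sT; have [_ kD _] := sD.
rewrite -[LHS](lfE (fun a => \sum_e u 0 e * nabla (gh i) (T i) x e a)) ext_mulE.
rewrite lf_val; last exact: (kD i x cx).2.
rewrite lf_sum; apply: (congr1 (fun F : form => F a)).
transitivity (\sum_e u 0 e *: lo (gh i x) e ((n%:R - k%:R)^-1 *: twist_div (gh i) (fun=> 1) 0 (fun y => lf (T i y)) x)).
  by apply: eq_bigr => e _; rewrite lfZ lf_nabla ?H //; exact: kT.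
move: (_ *: twist_div _ _ _ _ _) => Z; rewrite /lo /epsv.
under eq_bigr => e _ do rewrite scaler_sumr.
rewrite exchange_big; apply: eq_bigr => b _ /=.
by rewrite mxE scaler_suml; apply: eq_bigr => e _; rewrite scalerA.
Qed.

End Einstein.

(** A constant factor between the components and the operator does not affect
    the vanishing of the projection. *)
Lemma hook_part_lf0 p (T : metric_field X -> chart X -> pt -> 'I_n -> p.-tuple 'I_n -> R)
    (H : metric_field X -> chart X -> pt -> 'I_n -> form) (q : R) : q != 0 ->
  (forall g, c g -> forall i x, chart_on setT i x -> forall e, kform p (H g i x e)) ->
  (forall g, c g -> forall i x, chart_on setT i x -> forall e, lf (T g i x e) = q *: H g i x e) ->
  (forall g, c g -> forall i x, cod i x -> forall e a, hook_part (g i x) (T g i x) e a = 0) <->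
  (forall g, c g -> forall i x, chart_on setT i x -> forall e, hookF (g i x) p (H g i x) e = 0).
Proof.
move=> q0 kH TE.
have E g' i x e : c g' -> chart_on setT i x ->
    lf (hook_part (g' i x) (T g' i x) e) = q *: hookF (g' i x) p (H g' i x) e.
  move=> cg cx; rewrite lf_hook_part => [|b]; last by rewrite TE //; exact/kformZ/kH.
  by rewrite -hookFZ; congr (hookF _ _ _ _); apply: funext => b; rewrite TE.
split=> h g' cg i x cx e.
- have h0 : q *: hookF (g' i x) p (H g' i x) e = 0.
    by rewrite -E // -(lf0 R n p); congr lf; apply: funext => a; exact: (h g' cg i x cx.1 e a).
  by move/eqP: h0; rewrite scaler_eq0 (negbTE q0) => /eqP.
- move=> a; have cx' : chart_on setT i x by split.
  by rewrite -[LHS](lfE (hook_part (g' i x) (T g' i x) e)) E // h // scaler0.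
Qed.

Lemma weyl_condition_upE p (sigma : weighted_field X p.+2) : is_weighted_form c p.+3%:R sigma ->
  weyl_condition_up c sigma <-> weyl_int_vanishes sigma.
Proof.
move=> wf.
have kS g i x : c g -> chart_on setT i x -> kform p.+2 (lf (sigma g i x)).
  by move=> cg cx; have /is_formE[_ kF _] := wf.1 g cg; exact: kF.
apply: (hook_part_lf0 (q := - p.+1%:R^-1)
  (H := fun g i x e => weyl_int (g i) x e (lf (sigma g i x)))).
- by rewrite oppr_eq0 invr_eq0 pnatr_eq0.
- move=> g cg i x cx e.
  exact: (@kform_weyl_int _ _ setT (g i) p.+1 (fun=> lf (sigma g i x)) (fun _ _ => kS g i x cg cx) x I e).
- by move=> g cg i x cx e; rewrite (lf_weyl_up (g i)) //; exact: kS.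
Qed.

Lemma weyl_condition_downE m (sigma : weighted_field X m.+1) : is_weighted_form c m.+2%:R sigma ->
  weyl_condition_down c sigma <-> weyl_ext_vanishes sigma.
Proof.
move=> wf.
have kS g i x : c g -> chart_on setT i x -> kform m.+1 (lf (sigma g i x)).
  by move=> cg cx; have /is_formE[_ kF _] := wf.1 g cg; exact: kF.
apply: (hook_part_lf0 (q := - (m.+2%:R^-1 * m.+1%:R^-1))
  (H := fun g i x e => weyl_ext (g i) x e (lf (sigma g i x)))).
- by rewrite oppr_eq0 mulf_neq0 // invr_eq0 pnatr_eq0.
- move=> g cg i x cx e.
  apply: kform_sum => a _; apply: kform_eps; apply: kform_sum => b _; apply: kform_eps.
  apply: kform_sum => d _; apply: kformZ; exact: (kform_up _ d (kS g i x cg cx)).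
- by move=> g cg i x cx e; rewrite (lf_weyl_down (g i)) //; exact: kS.
Qed.

Section KillingEinstein.
Variables (m : nat) (sigma : weighted_field X m.+1).
Hypothesis wf : is_weighted_form c m.+2%:R sigma.
Hypothesis ck : conformal_killing c sigma.
Hypothesis mn : (m.+1 < n)%N.
Variables (g : metric_field X).
Hypothesis cg : c g.
Local Notation W := (nonzero_locus alpha g).
Local Notation gh := (einstein_metric alpha g).
Local Notation r := (n%:R - m.+1%:R + 1).
Local Notation f i := (alpha g \o point (m := X) i).
Local Notation S i := (fun y => lf (sigma g i y)).
Local Notation Om i := (fun y => `|alpha g (point (m := X) i y)|^-1).

Let sub (i : chart X) : chart_on W i `<=` chart_on setT i.
Proof. by move=> x [cx _]; split. Qed.
Let oV (i : chart X) : open (chart_on W i). Proof. exact: (open_chart_on i (open_locus cg)). Qed.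
Let mgi (i : chart X) : local_metric (chart_on setT i) (g i). Proof. exact: (mg cg).1. Qed.
Let sOm (i : chart X) : smooth_on (chart_on W i) (Om i). Proof. exact: (smooth_Om cg). Qed.
Let f0 (i : chart X) y : chart_on W i y -> f i y != 0. Proof. by case. Qed.
Let OmE (i : chart X) y : chart_on W i y -> Om i y ^+ 2 = (f i y ^+ 2)^-1.
Proof. by move=> _; rewrite exprVn real_normK ?num_real. Qed.
Let ghE (i : chart X) y : chart_on W i y -> gh i y = Om i y ^+ 2 *: g i y.
Proof. by move=> _; exact: einstein_metricE. Qed.
Let sF (i : chart X) : smoothF (chart_on setT i) (S i).
Proof. by have /is_formE[+ _ _] := wf.1 g cg; apply. Qed.
Let kF (i : chart X) y : chart_on setT i y -> kform m.+1 (S i y).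
Proof. by have /is_formE[_ + _] := wf.1 g cg; apply. Qed.
Let hookS (i : chart X) y : chart_on setT i y -> forall e,
  hookF (g i y) m.+1 (fun a => covD (g i) a (S i) y) e = 0.
Proof. by move=> cy e; move/(conformal_killingE (wf.1)): ck; apply. Qed.
Let ae (i : chart X) y : chart_on setT i y -> forall a b,
  hessian (g i) (f i) y a b + schouten (g i) y a b * f i y = einstein_factor g i y * g i y a b.
Proof. exact: (almost_einstein_hessian cg). Qed.

Lemma killing_up : (0 < m)%N -> weyl_int_vanishes sigma ->
  killing_form W gh (einstein_rep alpha g m.+1%:R (sigma_up alpha sigma)).
Proof.
move=> m0 hW; have fT := is_form_up wf cg.
apply: (killing_formI cg (einstein_rep_sect cg m.+1 fT)) => i x cx e.
pose F (y : pt) := Om i y ^+ m.+1 *: twist_div (g i) (f i) r (S i) y.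
have sFF : smoothF (chart_on W i) F.
  apply: (smoothFZ (@oV i)); first by apply: (smoothX _ (@oV i)); exact: sOm.
  move=> s; apply: (smooth_sub (@sub i)).
  exact: (smoothF_twist_div (@oc i) (@mgi i) r (salpha cg i) (@sF i)).
have TE y : chart_on W i y -> lf (einstein_rep alpha g m.+1%:R (sigma_up alpha sigma) i y) = (-1) ^+ m *: F y.
  move=> cy; rewrite (lf_einstein_rep _ _ cy) (lf_up wf cg (@sub i y cy)) /F.
  by rewrite !scalerA mulrC.
rewrite (covD_on (gh i) (@oV i) e TE cx) (twist_ext_on _ (@oV i) _ _ TE cx).
rewrite (twist_extZ _ _ sFF cx) (covDc (gh i) e _ sFF cx).
rewrite scalerA mulrC -scalerA [RHS]linearZ /=; congr (_ *: _).
apply: (killing_twist_div (@oc i) n3 (@mgi i) (@sF i) (@kF i) (@hookS i) mn (salpha cg i) (@ae i)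
  (@oV i) (@sub i) (@f0 i) (@sOm i) (@OmE i) (@ghE i) e m0 cx) => b.
rewrite (hook_twist_div (@oc i) n3 (@mgi i) (@sF i) (@kF i) (@hookS i) mn (salpha cg i) (@ae i) b m0 (@sub i x cx)).
by rewrite (hW g cg i x (@sub i x cx)) scaler0.
Qed.

Lemma killing_down : weyl_ext_vanishes sigma ->
  dual_killing_form W gh (einstein_rep alpha g m.+3%:R (sigma_down alpha sigma)).
Proof.
move=> hW; have fT := is_form_down wf cg.
apply: (dual_killing_formI cg (einstein_rep_sect cg m.+3 fT)) => i x cx e.
pose F (y : pt) := Om i y ^+ m.+3 *: twist_ext (g i) (f i) m.+2%:R (S i) y.
have sFF : smoothF (chart_on W i) F.
  apply: (smoothFZ (@oV i)); first by apply: (smoothX _ (@oV i)); exact: sOm.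
  move=> s; apply: (smooth_sub (@sub i)).
  exact: (smoothF_twist_ext (@oc i) (@mgi i) _ (salpha cg i) (@sF i)).
have TE y : chart_on W i y -> lf (einstein_rep alpha g m.+3%:R (sigma_down alpha sigma) i y) =
    ((-1) ^+ m.+1 / m.+2%:R) *: F y.
  move=> cy; rewrite (lf_einstein_rep _ _ cy) (lf_down wf cg (@sub i y cy)) /F.
  by rewrite !scalerA mulrC.
rewrite (covD_on (gh i) (@oV i) e TE cx) (twist_div_on _ (@oV i) _ _ TE cx).
rewrite (twist_divZ _ _ sFF cx) (covDc (gh i) e _ sFF cx).
move: ((-1) ^+ m.+1 / m.+2%:R) => q; rewrite scalerA mulrC -scalerA [RHS]linearZ /=; congr (_ *: _).
apply: (dual_killing_twist_ext (@oc i) (@mgi i) (@sF i) (@kF i) (@hookS i) mn (salpha cg i) (@ae i)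
  (@oV i) (@sub i) (@f0 i) (@sOm i) (@OmE i) (@ghE i) e cx) => b.
rewrite (hook_twist_ext (@oc i) (@mgi i) (@sF i) (@kF i) (@hookS i) mn (salpha cg i) (@ae i) b (@sub i x cx)).
by rewrite (hW g cg i x (@sub i x cx)) scaler0.
Qed.
End KillingEinstein.
End Global.

Theorem theorem5p1 (R : realType) (n : nat) (M : topologicalType)
    (X : manifold R n M) (c : set (metric_field X)) (alpha : density X)
    (k : nat) (sigma : weighted_field X k) :
  (3 <= n)%N ->
  conformal_structure c ->
  almost_einstein c alpha ->
  is_weighted_form c k.+1%:R sigma ->
  [/\ (1 <= k <= n)%N ->
        is_weighted_form c k%:R (sigma_up alpha sigma),
      (k <= n - 1)%N ->
        is_weighted_form c k.+2%:R (sigma_down alpha sigma),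
      conformal_killing c sigma -> (2 <= k <= n - 1)%N ->
        (conformal_killing c (sigma_up alpha sigma) <->
         weyl_condition_up c sigma) /\
        (weyl_condition_up c sigma -> forall g, c g ->
         killing_form (nonzero_locus alpha g) (einstein_metric alpha g)
           (einstein_rep alpha g k%:R (sigma_up alpha sigma)))
    & conformal_killing c sigma -> (1 <= k <= n - 2)%N ->
        (conformal_killing c (sigma_down alpha sigma) <->
         weyl_condition_down c sigma) /\
        (weyl_condition_down c sigma -> forall g, c g ->
         dual_killing_form (nonzero_locus alpha g) (einstein_metric alpha g)
           (einstein_rep alpha g k.+2%:R (sigma_down alpha sigma)))].
Proof.
move=> n3 cs AE wf; split.
- case: k sigma wf => [//|m] sigma wf _.
  exact: (weighted_up n3 cs AE wf).
- by move=> _; exact: (weighted_down n3 cs AE wf).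
- case: k sigma wf => [//|[//|p]] sigma wf ck /andP[_ kn].
  have mn : (p.+2 < n)%N by lia.
  rewrite (weyl_condition_upE wf); split; first exact: (conformal_killing_upE n3 cs AE wf ck mn).
  by move=> h g cg; exact: (killing_up n3 cs AE wf ck mn cg).
- case: k sigma wf => [//|m] sigma wf ck /andP[_ kn].
  have mn : (m.+1 < n)%N by lia.
  rewrite (weyl_condition_downE wf); split; first exact: (conformal_killing_downE n3 cs AE wf ck mn).
  by move=> h g cg; exact: (killing_down n3 cs AE wf ck mn cg).
Qed.
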